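(* Let $V$ be a two-sided quaternionic Banach space, $\omega\in[0,\pi)$ and $T\in\mathrm{Sect}(\omega)$. For $0<\alpha<1$ we have $$T^{\alpha}v=\frac{\sin(\alpha\pi)}{\pi}\int_0^{+\infty}t^{\alpha-1}(t\mathcal{I}+T)^{-1}Tv\,dt,\qquad\forall v\in\mathcal{D}(T).$$ More generally, for $n,m\in\mathbb{N}$ and $0<\alpha<n\le m$ we have $$T^{\alpha}v=\frac{\Gamma(m)}{\Gamma(\alpha)\Gamma(m-\alpha)}\int_0^{+\infty}t^{\alpha-1}\big[T(t\mathcal{I}+T)^{-1}\big]^mv\,dt,\qquad\forall v\in\mathcal{D}(T^n).$$
   Context: $\mathbb{H}$ denotes the quaternions, $\mathbb{S}=\{p\in\mathbb{H}:\mathrm{Re}(p)=0,|p|=1\}$, $\mathbb{C}_I=\mathbb{R}+I\mathbb{R}$ for $I\in\mathbb{S}$; $\arg(s)=\arccos(\mathrm{Re}(s)/|s|)\in[0,\pi]$ for $s\ne0$; $I_s=\underline{s}/|\underline{s}|$ with $\underline{s}$ the imaginary part of $s$ (any $I_s\in\mathbb{S}$ if $s\in\mathbb{R}$). $\mathcal{K}(V)$, $\mathcal{B}(V)$: closed, resp. bounded, right-linear operators on $V$; $(Ba)v=B(av)$, $(aB)v=a(Bv)$ for $a\in\mathbb{H}$, $B\in\mathcal{B}(V)$; $\mathcal{I}$ is the identity; $\mathcal{D}(\cdot)$ is the domain. For $T\in\mathcal{K}(V)$: $\mathcal{Q}_s(T)=T^2-2\mathrm{Re}(s)T+|s|^2\mathcal{I}$,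 $\rho_S(T)=\{s\in\mathbb{H}:\mathcal{Q}_s(T)^{-1}\in\mathcal{B}(V)\}$, $\sigma_S(T)=\mathbb{H}\setminus\rho_S(T)$, $S_L^{-1}(s,T)=\mathcal{Q}_s(T)^{-1}\overline{s}-T\mathcal{Q}_s(T)^{-1}$, $S_R^{-1}(s,T)=-(T-\overline{s}\mathcal{I})\mathcal{Q}_s(T)^{-1}$. Sectors: $\Sigma_\varphi=\{s\in\mathbb{H}\setminus\{0\}:\arg(s)<\varphi\}$ for $\varphi\in(0,\pi]$; $\overline{\Sigma_0}:=[0,\infty)$. $T\in\mathrm{Sect}(\omega)$, $\omega\in[0,\pi)$, means $T\in\mathcal{K}(V)$, $\sigma_S(T)\subset\overline{\Sigma_\omega}$, and for every $\varphi\in(\omega,\pi)$ there is $C>0$ with $\|S_L^{-1}(s,T)\|\le C/|s|$ and $\|S_R^{-1}(s,T)\|\le C/|s|$ for all $s\notin\overline{\Sigma_\varphi}$. Fractional powers: $s^\alpha=e^{\alpha(\ln|s|+I_s\arg(s))}$ for $s\in\mathbb{H}\setminus(-\infty,0]$. For $\alpha>0$ and any $n\in\mathbb{N}$ with $n>\alpha$, $T^\alpha:=(\mathcal{I}+T)^n\,\big(s^\alpha(1+s)^{-n}\big)(T)$ (with natural domain; independent of $n$), where the bounded operator is $$\big(s^\alpha(1+s)^{-n}\big)(T)=\frac1{2\pi}\int_{\partial(\Sigma_{\varphi}\cap\mathbb{C}_I)}s^\alpha(1+s)^{-n}\,ds_I\,S_R^{-1}(s,T),\qquad ds_I=-I\,ds,$$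 for any $I\in\mathbb{S}$, $\varphi\in(\omega,\pi)$, the path going from $\infty e^{I\varphi}$ via $0$ to $\infty e^{-I\varphi}$. *)

(* Defs.v *)
From Stdlib Require Import Reals Lra Psatz FunctionalExtensionality ProofIrrelevance.
From Coquelicot Require Import Coquelicot.
Open Scope R_scope.

(** * Quaternions *)

Record quat := mkquat { q0 : R; q1 : R; q2 : R; q3 : R }.

Definition qreal (x : R) : quat := mkquat x 0 0 0.
Definition qadd (p q : quat) : quat :=
  mkquat (q0 p + q0 q) (q1 p + q1 q) (q2 p + q2 q) (q3 p + q3 q).
Definition qopp (p : quat) : quat := mkquat (- q0 p) (- q1 p) (- q2 p) (- q3 p).
Definition qmul (p q : quat) : quat :=
  mkquat (q0 p * q0 q - q1 p * q1 q - q2 p * q2 q - q3 p * q3 q)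
         (q0 p * q1 q + q1 p * q0 q + q2 p * q3 q - q3 p * q2 q)
         (q0 p * q2 q - q1 p * q3 q + q2 p * q0 q + q3 p * q1 q)
         (q0 p * q3 q + q1 p * q2 q - q2 p * q1 q + q3 p * q0 q).
Definition qscale (x : R) (p : quat) : quat :=
  mkquat (x * q0 p) (x * q1 p) (x * q2 p) (x * q3 p).
Definition qconj (p : quat) : quat := mkquat (q0 p) (- q1 p) (- q2 p) (- q3 p).
Definition qim (p : quat) : quat := mkquat 0 (q1 p) (q2 p) (q3 p).
Definition qabs (p : quat) : R :=
  sqrt (q0 p ^ 2 + q1 p ^ 2 + q2 p ^ 2 + q3 p ^ 2).
Definition qinv (p : quat) : quat := qscale (/ (qabs p ^ 2)) (qconj p).
Fixpoint qpow (p : quat) (n : nat) : quat :=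
  match n with O => qreal 1 | S k => qmul p (qpow p k) end.

Definition imag_unit (J : quat) : Prop := q0 J = 0 /\ qabs J = 1.

Definition qarg (s : quat) : R := acos (q0 s / qabs s).

(** The direction [I_s]; an arbitrary imaginary unit is used for real [s]. *)
Definition qdir (s : quat) : quat :=
  if Req_EM_T (qabs (qim s)) 0 then mkquat 0 1 0 0
  else qscale (/ qabs (qim s)) (qim s).

(** [qcis J x] is [e^(J x)] for an imaginary unit [J]. *)
Definition qcis (J : quat) (x : R) : quat :=
  qadd (qreal (cos x)) (qscale (sin x) J).

(** [s^a = e^(a (ln|s| + I_s arg s))], meaningful off the half-line (-oo, 0]. *)
Definition qpower (s : quat) (a : R) : quat :=
  qscale (exp (a * ln (qabs s))) (qcis (qdir s) (a * qarg s)).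

Definition sector (phi : R) (s : quat) : Prop := s <> qreal 0 /\ qarg s < phi.

(** The topological closure of [sector phi] when [0 < phi]; by convention the
    half-line [0, +oo) when [phi = 0]. *)
Definition closed_sector (phi : R) (s : quat) : Prop :=
  (phi = 0 /\ exists x : R, 0 <= x /\ s = qreal x) \/
  (0 < phi /\
   forall eps : R, 0 < eps ->
     exists p : quat, sector phi p /\ qabs (qadd s (qopp p)) < eps).

(** * Two-sided quaternionic Banach spaces *)

(** The real scalar multiplication [scal] of the underlying Banach space is
    required to agree with both quaternionic ones; in particular [1 v = v = v 1]. *)
Record QBanach := {
  qb_space :> CompleteNormedModule R_AbsRing;
  lact : quat -> qb_space -> qb_space;
  ract : qb_space -> quat -> qb_space;
  lact_addl : forall p q v, lact (qadd p q) v = plus (lact p v) (lact q v);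
  lact_addr : forall p u v, lact p (plus u v) = plus (lact p u) (lact p v);
  lact_mul : forall p q v, lact (qmul p q) v = lact p (lact q v);
  lact_real : forall (x : R) v, lact (qreal x) v = scal x v;
  ract_addl : forall u v p, ract (plus u v) p = plus (ract u p) (ract v p);
  ract_addr : forall v p q, ract v (qadd p q) = plus (ract v p) (ract v q);
  ract_mul : forall v p q, ract v (qmul p q) = ract (ract v p) q;
  ract_real : forall v (x : R), ract v (qreal x) = scal x v;
  lact_ract : forall p v q, ract (lact p v) q = lact p (ract v q);
  norm_lact : forall p v, norm (lact p v) = qabs p * norm v;
  norm_ract : forall v p, norm (ract v p) = norm v * qabs p
}.

Arguments lact {_} _ _.
Arguments ract {_} _ _.

(** * Unbounded operators *)

(** An operator is represented by its graph: [A v w] means that [v] lies in the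
    domain of [A] and [A v = w].  All operations carry their natural domains. *)
Definition op (V : QBanach) := V -> V -> Prop.

Section Operators.
Context {V : QBanach}.

Definition op_dom (A : op V) (v : V) : Prop := exists w, A v w.
Definition op_id : op V := fun v w => w = v.
Definition op_add (A B : op V) : op V :=
  fun v w => exists a b, A v a /\ B v b /\ w = plus a b.
Definition op_mul (A B : op V) : op V := fun v w => exists u, B v u /\ A u w.
Definition op_scal (x : R) (A : op V) : op V :=
  fun v w => exists u, A v u /\ w = scal x u.
Definition op_sub (A B : op V) : op V := op_add A (op_scal (-1) B).
Definition op_inv (A : op V) : op V := fun v w => A w v.
Fixpoint op_pow (A : op V) (n : nat) : op V :=
  match n with O => op_id | S k => op_mul A (op_pow A k) end.

(** The two-sided scaling [(a A) v = a (A v)] and [(A a) v = A (a v)]. *)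
Definition op_lscal (a : quat) (A : op V) : op V :=
  fun v w => exists u, A v u /\ w = lact a u.
Definition op_rscal (A : op V) (a : quat) : op V := fun v w => A (lact a v) w.

(** [K(V)]: the graph is that of a function, is a right linear subspace, and is
    closed in [V * V]. *)
Definition closed_operator (A : op V) : Prop :=
  (forall v w w', A v w -> A v w' -> w = w') /\
  A zero zero /\
  (forall v w v' w', A v w -> A v' w' -> A (plus v v') (plus w w')) /\
  (forall v w a, A v w -> A (ract v a) (ract w a)) /\
  closed (fun p : V * V => A (fst p) (snd p)).

End Operators.

(** * The normed space [B(V)] *)

Record Bop (V : QBanach) := {
  bop_fun :> V -> V;
  bop_add : forall u v, bop_fun (plus u v) = plus (bop_fun u) (bop_fun v);
  bop_ract : forall v a, bop_fun (ract v a) = ract (bop_fun v) a;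
  bop_bounded : exists C, forall v, norm (bop_fun v) <= C * norm v
}.

Section BoundedOperators.
Context {V : QBanach}.

Lemma Bop_ext (A B : Bop V) : (forall v, A v = B v) -> A = B.
Proof.
  destruct A as [f fa fr fb], B as [g ga gr gb]; simpl; intros H.
  assert (E : f = g) by (apply functional_extensionality; exact H).
  subst g; f_equal; apply proof_irrelevance.
Qed.

Lemma bop_scal (A : Bop V) (x : R) (v : V) : A (scal x v) = scal x (A v).
Proof. now rewrite <- !ract_real, bop_ract. Qed.

Lemma ract_scal (x : R) (v : V) (a : quat) : ract (scal x v) a = scal x (ract v a).
Proof. now rewrite <- !lact_real, lact_ract. Qed.

Lemma norm_scal_R (x : R) (v : V) : norm (scal x v) = Rabs x * norm v.
Proof.
  rewrite <- lact_real, norm_lact; f_equal; unfold qabs; simpl.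
  rewrite <- sqrt_Rsqr_abs; f_equal; unfold Rsqr; ring.
Qed.

Lemma norm_zero_V : norm (zero : V) = 0.
Proof. exact (@norm_zero R_AbsRing V). Qed.

Lemma Bop_plus_bounded (A B : Bop V) :
  exists C, forall v, norm (plus (A v) (B v)) <= C * norm v.
Proof.
  destruct (bop_bounded _ A) as [a Ha], (bop_bounded _ B) as [b Hb].
  exists (a + b); intros v.
  eapply Rle_trans; [exact (norm_triangle (A v) (B v)) |].
  specialize (Ha v); specialize (Hb v); lra.
Qed.

Lemma Bop_plus_add (A B : Bop V) u v :
  plus (A (plus u v)) (B (plus u v)) = plus (plus (A u) (B u)) (plus (A v) (B v)).
Proof.
  rewrite !bop_add, <- !plus_assoc; f_equal.
  rewrite !plus_assoc; f_equal; apply plus_comm.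
Qed.

Lemma Bop_plus_ract (A B : Bop V) v a :
  plus (A (ract v a)) (B (ract v a)) = ract (plus (A v) (B v)) a.
Proof. now rewrite !bop_ract, ract_addl. Qed.

Definition Bop_plus (A B : Bop V) : Bop V :=
  Build_Bop V _ (Bop_plus_add A B) (Bop_plus_ract A B) (Bop_plus_bounded A B).

Lemma Bop_scal_bounded (x : R) (A : Bop V) :
  exists C, forall v, norm (scal x (A v) : V) <= C * norm v.
Proof.
  destruct (bop_bounded _ A) as [a Ha].
  exists (Rabs x * a); intros v.
  rewrite norm_scal_R, Rmult_assoc.
  apply Rmult_le_compat_l; [apply Rabs_pos | apply Ha].
Qed.

Lemma Bop_scal_add (x : R) (A : Bop V) u v :
  scal x (A (plus u v)) = plus (scal x (A u)) (scal x (A v)).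
Proof. rewrite bop_add; exact (scal_distr_l x (A u) (A v)). Qed.

Lemma Bop_scal_ract (x : R) (A : Bop V) v a :
  scal x (A (ract v a)) = ract (scal x (A v)) a.
Proof. now rewrite bop_ract, ract_scal. Qed.

Definition Bop_scal (x : R) (A : Bop V) : Bop V :=
  Build_Bop V _ (Bop_scal_add x A) (Bop_scal_ract x A) (Bop_scal_bounded x A).

Lemma Bop_zero_add (u v : V) : (zero : V) = plus zero zero.
Proof. now rewrite plus_zero_r. Qed.

Lemma Bop_zero_ract (v : V) (a : quat) : zero = ract (zero : V) a.
Proof.
  transitivity (scal 0 (ract (zero : V) a)).
  - symmetry; exact (scal_zero_l (ract (zero : V) a)).
  - rewrite <- ract_scal; f_equal; exact (scal_zero_l (zero : V)).
Qed.

Lemma Bop_zero_bounded : exists C, forall v : V, norm (zero : V) <= C * norm v.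
Proof. exists 0; intros v; rewrite norm_zero_V; lra. Qed.

Definition Bop_zero : Bop V :=
  Build_Bop V (fun _ => zero) Bop_zero_add Bop_zero_ract Bop_zero_bounded.

(** Operator norm: supremum of [|B v|] over the closed unit ball. *)
Definition opnorm (B : Bop V) : R :=
  real (Lub_Rbar (fun x => exists v : V, norm v <= 1 /\ x = norm (B v))).

Lemma opnorm_lub (B : Bop V) :
  is_lub_Rbar (fun x => exists v : V, norm v <= 1 /\ x = norm (B v)) (opnorm B).
Proof.
  unfold opnorm.
  set (E := fun x => exists v : V, norm v <= 1 /\ x = norm (B v)).
  destruct (bop_bounded _ B) as [C HC].
  assert (HE : is_ub_Rbar E (Finite (Rabs C))).
  { intros x (v & Hv & ->); simpl.
    apply Rle_trans with (1 := HC v).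
    assert (H0 := norm_ge_0 v); assert (H1 := Rle_abs C); assert (H2 := Rabs_pos C).
    nra. }
  assert (H0 : E 0).
  { exists zero; rewrite norm_zero_V; split; [lra|].
    assert (HB : B zero = zero).
    { transitivity (B (scal 0 zero)).
      - f_equal; symmetry; exact (scal_zero_l (zero : V)).
      - rewrite bop_scal; exact (scal_zero_l (B zero)). }
    rewrite HB, norm_zero_V; reflexivity. }
  assert (HL := Lub_Rbar_correct E).
  assert (Hge := proj1 HL 0 H0); assert (Hle := proj2 HL _ HE).
  destruct (Lub_Rbar E) as [l| |]; simpl in *; [exact HL | easy | easy].
Qed.

Lemma opnorm_ge (B : Bop V) (v : V) : norm (B v) <= opnorm B * norm v.
Proof.
  destruct (Req_dec (norm v) 0) as [H0|H0].
  - destruct (bop_bounded _ B) as [C HC]; specialize (HC v).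
    rewrite H0 in *; lra.
  - assert (Hp : 0 < norm v) by (assert (H := norm_ge_0 v); lra).
    assert (Hi := Rinv_0_lt_compat _ Hp).
    assert (H : norm (B (scal (/ norm v) v)) <= opnorm B).
    { apply (proj1 (opnorm_lub B)); exists (scal (/ norm v) v); split; [|reflexivity].
      rewrite norm_scal_R, Rabs_pos_eq by lra.
      rewrite Rinv_l by lra; lra. }
    rewrite bop_scal, norm_scal_R, Rabs_pos_eq in H by lra.
    apply Rmult_le_compat_r with (r := norm v) in H; [|lra].
    replace (/ norm v * norm (B v) * norm v) with (norm (B v)) in H by (field; lra).
    exact H.
Qed.

Lemma opnorm_le (B : Bop V) (C : R) :
  0 <= C -> (forall v, norm (B v) <= C * norm v) -> opnorm B <= C.
Proof.
  intros HC H; apply (proj2 (opnorm_lub B) (Finite C)).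
  intros x (v & Hv & ->); simpl.
  apply Rle_trans with (1 := H v); assert (H0 := norm_ge_0 v); nra.
Qed.

Lemma opnorm_pos (B : Bop V) : 0 <= opnorm B.
Proof.
  apply Rle_trans with (norm (B zero)); [apply norm_ge_0|].
  apply (proj1 (opnorm_lub B)); exists zero; rewrite norm_zero_V; split; [lra|easy].
Qed.

Lemma opnorm_triangle (A B : Bop V) : opnorm (Bop_plus A B) <= opnorm A + opnorm B.
Proof.
  assert (HA := opnorm_pos A); assert (HB := opnorm_pos B).
  apply opnorm_le; [lra|]; intros v; simpl.
  eapply Rle_trans; [exact (norm_triangle (A v) (B v)) |].
  assert (H1 := opnorm_ge A v); assert (H2 := opnorm_ge B v); lra.
Qed.

Lemma opnorm_scal (x : R) (A : Bop V) : opnorm (Bop_scal x A) <= Rabs x * opnorm A.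
Proof.
  assert (HA := opnorm_pos A); assert (Hx := Rabs_pos x).
  apply opnorm_le; [nra|]; intros v; simpl.
  rewrite norm_scal_R, Rmult_assoc.
  apply Rmult_le_compat_l; [lra | apply opnorm_ge].
Qed.

Lemma opnorm_eq_0 (A : Bop V) : opnorm A = 0 -> A = Bop_zero.
Proof.
  intros H; apply Bop_ext; intros v; simpl.
  apply (norm_eq_zero (A v)); apply Rle_antisym; [|apply norm_ge_0].
  assert (H1 := opnorm_ge A v); rewrite H in H1; lra.
Qed.

Lemma Bop_plus_comm (A B : Bop V) : Bop_plus A B = Bop_plus B A.
Proof. apply Bop_ext; intros v; apply plus_comm. Qed.

Lemma Bop_plus_assoc (A B C : Bop V) :
  Bop_plus A (Bop_plus B C) = Bop_plus (Bop_plus A B) C.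
Proof. apply Bop_ext; intros v; apply plus_assoc. Qed.

Lemma Bop_plus_zero_r (A : Bop V) : Bop_plus A Bop_zero = A.
Proof. apply Bop_ext; intros v; apply plus_zero_r. Qed.

Lemma Bop_plus_opp_r (A : Bop V) : Bop_plus A (Bop_scal (-1) A) = Bop_zero.
Proof.
  apply Bop_ext; intros v; simpl.
  transitivity (plus (A v) (opp (A v))).
  - f_equal; exact (scal_opp_one (A v)).
  - exact (plus_opp_r (A v)).
Qed.

Definition Bop_AbelianMonoid_mixin :=
  AbelianMonoid.Mixin (Bop V) Bop_plus Bop_zero
    Bop_plus_comm Bop_plus_assoc Bop_plus_zero_r.
Canonical Bop_AbelianMonoid :=
  AbelianMonoid.Pack (Bop V) Bop_AbelianMonoid_mixin (Bop V).

Definition Bop_AbelianGroup_mixin :=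
  AbelianGroup.Mixin Bop_AbelianMonoid (Bop_scal (-1)) Bop_plus_opp_r.
Canonical Bop_AbelianGroup :=
  AbelianGroup.Pack (Bop V)
    (AbelianGroup.Class _ Bop_AbelianMonoid_mixin Bop_AbelianGroup_mixin) (Bop V).

Lemma Bop_scal_assoc (x y : R) (A : Bop V) :
  Bop_scal x (Bop_scal y A) = Bop_scal (mult x y) A.
Proof. apply Bop_ext; intros v; exact (scal_assoc x y (A v)). Qed.

Lemma Bop_scal_one (A : Bop V) : Bop_scal one A = A.
Proof. apply Bop_ext; intros v; exact (scal_one (A v)). Qed.

Lemma Bop_scal_distr_l (x : R) (A B : Bop V) :
  Bop_scal x (Bop_plus A B) = Bop_plus (Bop_scal x A) (Bop_scal x B).
Proof. apply Bop_ext; intros v; exact (scal_distr_l x (A v) (B v)). Qed.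

Lemma Bop_scal_distr_r (x y : R) (A : Bop V) :
  Bop_scal (plus x y) A = Bop_plus (Bop_scal x A) (Bop_scal y A).
Proof. apply Bop_ext; intros v; exact (scal_distr_r x y (A v)). Qed.

Definition Bop_ModuleSpace_mixin :=
  ModuleSpace.Mixin R_Ring Bop_AbelianGroup Bop_scal
    Bop_scal_assoc Bop_scal_one Bop_scal_distr_l Bop_scal_distr_r.
Canonical Bop_ModuleSpace :=
  ModuleSpace.Pack R_Ring (Bop V)
    (ModuleSpace.Class _ _ _ Bop_ModuleSpace_mixin) (Bop V).

Definition Bop_ball (A : Bop V) (e : R) (B : Bop V) : Prop :=
  opnorm (minus B A) < e.

Lemma Bop_ball_center (A : Bop V) (e : posreal) : Bop_ball A e A.
Proof.
  unfold Bop_ball; rewrite minus_eq_zero.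
  apply Rle_lt_trans with 0; [|apply cond_pos].
  apply opnorm_le; [lra|]; intros v; simpl; rewrite norm_zero_V; lra.
Qed.

Lemma Bop_ball_sym (A B : Bop V) (e : R) : Bop_ball A e B -> Bop_ball B e A.
Proof.
  unfold Bop_ball; intros H; apply Rle_lt_trans with (2 := H).
  rewrite <- (opp_minus B A).
  apply Rle_trans with (1 := opnorm_scal (-1) (minus B A)).
  rewrite Rabs_left by lra; lra.
Qed.

Lemma Bop_ball_triangle (A B C : Bop V) (e1 e2 : R) :
  Bop_ball A e1 B -> Bop_ball B e2 C -> Bop_ball A (e1 + e2) C.
Proof.
  unfold Bop_ball; intros H1 H2.
  rewrite (minus_trans B C A).
  apply Rle_lt_trans with (1 := opnorm_triangle (minus C B) (minus B A)); lra.
Qed.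

Definition Bop_UniformSpace_mixin :=
  UniformSpace.Mixin (Bop V) Bop_zero Bop_ball
    Bop_ball_center Bop_ball_sym Bop_ball_triangle.
Canonical Bop_UniformSpace :=
  UniformSpace.Pack (Bop V) Bop_UniformSpace_mixin (Bop V).

Canonical Bop_NormedModuleAux :=
  NormedModuleAux.Pack R_AbsRing (Bop V)
    (NormedModuleAux.Class R_AbsRing _
       (ModuleSpace.class R_Ring Bop_ModuleSpace) Bop_UniformSpace_mixin) (Bop V).

Lemma Bop_norm_compat1 (A B : Bop V) (e : R) :
  opnorm (minus B A) < e -> ball A e B.
Proof. easy. Qed.

Lemma Bop_norm_compat2 (A B : Bop V) (e : posreal) :
  ball A e B -> opnorm (minus B A) < 1 * e.
Proof. rewrite Rmult_1_l; easy. Qed.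

Definition Bop_NormedModule_mixin :=
  NormedModule.Mixin R_AbsRing Bop_NormedModuleAux opnorm 1
    opnorm_triangle opnorm_scal Bop_norm_compat1 Bop_norm_compat2 opnorm_eq_0.
Canonical Bop_NormedModule :=
  NormedModule.Pack R_AbsRing (Bop V)
    (NormedModule.Class R_AbsRing _ _ Bop_NormedModule_mixin) (Bop V).

(** [is_bop A B]: the operator [A] is everywhere defined and equals [B] in [B(V)]. *)
Definition is_bop (A : op V) (B : Bop V) : Prop := forall v w, A v w <-> w = B v.

Definition bop_graph (B : Bop V) : op V := fun v w => w = B v.

End BoundedOperators.

(** * S-spectrum, S-resolvent operators and sectorial operators *)

Section SFunctionalCalculus.
Context {V : QBanach}.

Definition Qop (s : quat) (T : op V) : op V :=
  op_add (op_sub (op_pow T 2) (op_scal (2 * q0 s) T)) (op_scal (qabs s ^ 2) op_id).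

Definition rho_S (T : op V) (s : quat) : Prop :=
  exists B : Bop V, is_bop (op_inv (Qop s T)) B.

Definition sigma_S (T : op V) (s : quat) : Prop := ~ rho_S T s.

Definition S_L (s : quat) (T : op V) : op V :=
  op_sub (op_rscal (op_inv (Qop s T)) (qconj s)) (op_mul T (op_inv (Qop s T))).

Definition S_R (s : quat) (T : op V) : op V :=
  op_scal (-1)
    (op_mul (op_sub T (op_lscal (qconj s) op_id)) (op_inv (Qop s T))).

(** [A] belongs to [B(V)] and its operator norm is at most [C]. *)
Definition bounded_by (A : op V) (C : R) : Prop :=
  exists B : Bop V, is_bop A B /\ norm B <= C.

Definition Sect (omega : R) (T : op V) : Prop :=
  closed_operator T /\
  (forall s, sigma_S T s -> closed_sector omega s) /\
  (forall phi, omega < phi < PI ->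
     exists C, 0 < C /\
       forall s, ~ closed_sector phi s ->
         bounded_by (S_L s T) (C / qabs s) /\ bounded_by (S_R s T) (C / qabs s)).

End SFunctionalCalculus.

(** * Integrals over the half-line *)

(** Absolutely convergent integral of a vector-valued function over (0, +oo),
    improper at both ends. *)
Definition is_int_pos {W : NormedModule R_AbsRing} (g : R -> W) (l : W) : Prop :=
  is_RInt_gen g (at_right 0) (Rbar_locally p_infty) l /\
  ex_RInt_gen (fun t => norm (g t)) (at_right 0) (Rbar_locally p_infty).

(** [op_integral A v w]: [v] lies in the domain of [A t] for all [t > 0], and
    [w] is the integral of [A t v] over (0, +oo). *)
Definition op_integral {V : QBanach} (A : R -> op V) : op V :=
  fun v w => exists g : R -> V, (forall t, 0 < t -> A t v (g t)) /\ is_int_pos g w.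

Definition Gamma (x : R) : R :=
  RInt_gen (fun t => Rpower t (x - 1) * exp (- t)) (at_right 0) (Rbar_locally p_infty).

(** * Fractional powers *)

Section FractionalPowers.
Context {V : QBanach}.

(** [B] is the integral in [B(V)] of [f(s) ds_J S_R^{-1}(s,T)], [ds_J = - J ds],
    over the ray [s = r e^(J theta)], [r] from [0] to [+oo]. *)
Definition is_ray_integral (f : quat -> quat) (T : op V) (J : quat) (theta : R)
    (B : Bop V) : Prop :=
  exists F : R -> Bop V,
    (forall r, 0 < r ->
       let s := qscale r (qcis J theta) in
       is_bop (op_lscal (qmul (f s) (qmul (qopp J) (qcis J theta))) (S_R s T)) (F r)) /\
    is_int_pos F B.

(** [B = f(T)], the integral over the boundary of the sector of half-opening
    [phi] in [C_J]: the ray at angle [phi] is run through towards [0], then the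
    ray at angle [- phi] away from [0]. *)
Definition is_calculus (f : quat -> quat) (T : op V) (J : quat) (phi : R)
    (B : Bop V) : Prop :=
  exists B1 B2 : Bop V,
    is_ray_integral f T J phi B1 /\
    is_ray_integral f T J (- phi) B2 /\
    B = scal (/ (2 * PI)) (minus B2 B1).

(** [T^alpha = (1 + T)^k (s^alpha (1 + s)^(-k))(T)], computed with the exponent
    [k], the plane [C_J] and the angle [phi]. *)
Definition frac_pow (k : nat) (J : quat) (phi : R) (T : op V) (alpha : R) : op V :=
  fun v w => exists B : Bop V,
    is_calculus
      (fun s => qmul (qpower s alpha) (qinv (qpow (qadd (qreal 1) s) k))) T J phi B /\
    op_mul (op_pow (op_add op_id T) k) (bop_graph B) v w.

End FractionalPowers.

(* Main.v *)
(** On the two rays [s = r e^(J phi)] and [s = r e^(- J phi)] the left multiplications by [J] cancel,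
    so that [f(T)] is the real operator [1/pi int_0^oo (Im (f e^(i phi)) p - r Im f q) dr] with
    [q = Q_s(T)^(-1)] and [p = T q].  The scalar identity
    [K s^a = int_0^oo t^(a-1) (s/(t+s))^m dt], [K = Gamma a Gamma (m-a) / Gamma m], and Fubini's
    theorem reduce the claim to the rational functions [(s/(t+s))^m (1+s)^(-k)], which the calculus
    maps to [(T (t+T)^(-1))^m (1+T)^(-k)].  Cauchy's theorem enters only by turning rays: the
    resolvent from the angle [phi] to [pi], scalar functions from [phi] to [0].  The two forms of the
    constant for [m = 1] agree by Euler's reflection formula. *)

Require Import Defs.
From Stdlib Require Import Reals.
From Coquelicot Require Import Coquelicot.
From Stdlib Require Import Lra Lia List Classical ClassicalEpsilon.
From Stdlib Require Import FunctionalExtensionality PropExtensionality.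
Open Scope R_scope.

(** * Linear identities in real modules *)

(** What can be inverted is [Q_s(T)]: its coefficients are real, and it depends on [s = r e^(J th)]
    only through [r cos th] and [r]. Each identity of the complex calculus is therefore restated for
    the pair [q], [p] with real coefficients; complex numbers occur only as scalars, split into real
    and imaginary parts. Turning a ray means the following. If [d_th P = d_r F], Fubini on a polar
    rectangle expresses the difference of the integrals of [P] along two rays by the limits of [F]
    on small and large arcs. For scalar functions this is the Cauchy-Riemann equation; for [q] and
    [p] it follows from a resolvent identity in two real parameters. Convergence rests on one family
    of majorants, [t^(a-1) (1+t)^(-b)] with [0 < a < b], each dominated by a kernel whose
    antiderivative is elementary. This gives existence, tails, vanishing arcs and Fubini on the
    quadrant without measure theory. *)

Inductive vexpr :=
  | VAtom (i : nat) | VZero | VPlus (a b : vexpr) | VOpp (a : vexpr)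
  | VMinus (a b : vexpr) | VScal (x : R) (a : vexpr).

Fixpoint veval {W : ModuleSpace R_Ring} (l : list W) (e : vexpr) : W :=
  match e with
  | VAtom i => nth i l zero
  | VZero => zero
  | VPlus a b => plus (veval l a) (veval l b)
  | VOpp a => opp (veval l a)
  | VMinus a b => minus (veval l a) (veval l b)
  | VScal x a => scal x (veval l a)
  end.

Fixpoint vcoef (e : vexpr) (j : nat) : R :=
  match e with
  | VAtom i => if Nat.eqb i j then 1 else 0
  | VZero => 0
  | VPlus a b => vcoef a j + vcoef b j
  | VOpp a => - vcoef a j
  | VMinus a b => vcoef a j - vcoef b j
  | VScal x a => x * vcoef a j
  end.

Fixpoint vbound (e : vexpr) : nat :=
  match e with
  | VAtom i => S i
  | VZero => O
  | VPlus a b | VMinus a b => Nat.max (vbound a) (vbound b)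
  | VOpp a | VScal _ a => vbound a
  end.

(** Normal form of a linear expression: two expressions agree as soon as their coefficient functions
    agree below a common bound on the atoms. *)
Fixpoint vcomb {W : ModuleSpace R_Ring} (l : list W) (c : nat -> R) (n : nat) : W :=
  match n with
  | O => zero
  | S k => plus (vcomb l c k) (scal (c k) (nth k l zero))
  end.

Lemma vcomb_zero {W : ModuleSpace R_Ring} (l : list W) (c : nat -> R) n :
  (forall i, (i < n)%nat -> c i = 0) -> vcomb l c n = zero.
Proof.
  induction n as [|n IH]; intros H; simpl; [easy|].
  rewrite IH by (intros; apply H; lia); rewrite H by lia.
  rewrite plus_zero_l; exact (scal_zero_l (nth n l zero : W)).
Qed.

Lemma vcomb_atom {W : ModuleSpace R_Ring} (l : list W) (j n : nat) :
  (j < n)%nat -> vcomb l (fun k => if Nat.eqb j k then 1 else 0) n = nth j l zero.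
Proof.
  induction n as [|n IH]; intros H; [lia|]; simpl.
  destruct (Nat.eqb_spec j n) as [->|E].
  - rewrite vcomb_zero, plus_zero_l.
    + exact (scal_one (nth n l zero : W)).
    + intros i Hi; destruct (Nat.eqb_spec n i); [lia|easy].
  - rewrite IH by lia.
    rewrite (scal_zero_l (nth n l zero : W) : scal 0 (nth n l zero) = zero).
    apply plus_zero_r.
Qed.

Lemma vcomb_plus {W : ModuleSpace R_Ring} (l : list W) (c d : nat -> R) n :
  vcomb l (fun k => c k + d k) n = plus (vcomb l c n) (vcomb l d n).
Proof.
  induction n as [|n IH]; simpl; [now rewrite plus_zero_r|].
  rewrite IH.
  rewrite (scal_distr_r (c n) (d n) _ : scal (c n + d n) (nth n l zero) = _).
  rewrite <- !plus_assoc; f_equal.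
  rewrite !plus_assoc; f_equal; apply plus_comm.
Qed.

Lemma vcomb_scal {W : ModuleSpace R_Ring} (l : list W) (x : R) (c : nat -> R) n :
  vcomb l (fun k => x * c k) n = scal x (vcomb l c n).
Proof.
  induction n as [|n IH]; simpl; [now rewrite scal_zero_r|].
  rewrite IH, scal_distr_l; f_equal; symmetry; exact (scal_assoc x (c n) _).
Qed.

Lemma vcomb_ext {W : ModuleSpace R_Ring} (l : list W) (c d : nat -> R) n :
  (forall i, (i < n)%nat -> c i = d i) -> vcomb l c n = vcomb l d n.
Proof.
  induction n as [|n IH]; intros H; simpl; [easy|].
  rewrite IH by (intros; apply H; lia); now rewrite H by lia.
Qed.

Lemma veval_vcomb {W : ModuleSpace R_Ring} (l : list W) (e : vexpr) n :
  (vbound e <= n)%nat -> veval l e = vcomb l (vcoef e) n.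
Proof.
  induction e as [i| |a IHa b IHb|a IHa|a IHa b IHb|x a IHa]; simpl; intros H.
  - symmetry; now apply vcomb_atom.
  - symmetry; now apply vcomb_zero.
  - now rewrite IHa, IHb, vcomb_plus by lia.
  - rewrite IHa by lia.
    rewrite (vcomb_ext l (fun k => - vcoef a k) (fun k => -1 * vcoef a k)) by (intros; ring).
    rewrite vcomb_scal; symmetry; exact (scal_opp_one (vcomb l (vcoef a) n)).
  - rewrite IHa, IHb by lia.
    rewrite (vcomb_ext l (fun k => vcoef a k - vcoef b k) (fun k => vcoef a k + -1 * vcoef b k)) by (intros; ring).
    rewrite vcomb_plus, vcomb_scal; unfold minus; f_equal.
    symmetry; exact (scal_opp_one (vcomb l (vcoef b) n)).
  - now rewrite IHa, vcomb_scal by lia.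
Qed.

(** A recursive conjunction rather than a bounded quantifier, so that [cbn] unfolds it into finitely
    many equations between reals for [ring]. *)
Fixpoint vcoef_eq (e1 e2 : vexpr) (n : nat) : Prop :=
  match n with
  | O => True
  | S k => vcoef e1 k = vcoef e2 k /\ vcoef_eq e1 e2 k
  end.

Lemma veval_eq {W : ModuleSpace R_Ring} (l : list W) (e1 e2 : vexpr) :
  vcoef_eq e1 e2 (Nat.max (vbound e1) (vbound e2)) -> veval l e1 = veval l e2.
Proof.
  intros H; set (n := Nat.max (vbound e1) (vbound e2)) in *.
  rewrite (veval_vcomb l e1 n), (veval_vcomb l e2 n) by lia.
  apply vcomb_ext; clearbody n; induction n as [|n IH]; intros i Hi; [lia|].
  destruct H as [H0 H]; destruct (Nat.eq_dec i n) as [->|]; [easy|].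
  apply IH; [easy|lia].
Qed.

Ltac vmem x l :=
  lazymatch l with
  | nil => constr:(false)
  | cons x _ => constr:(true)
  | cons _ ?t => vmem x t
  end.
Ltac vadd x l := lazymatch vmem x l with true => l | false => constr:(cons x l) end.
Ltac vatoms e l :=
  lazymatch e with
  | plus ?a ?b => let l := vatoms a l in vatoms b l
  | minus ?a ?b => let l := vatoms a l in vatoms b l
  | opp ?a => vatoms a l
  | scal _ ?a => vatoms a l
  | zero => l
  | ?a => vadd a l
  end.
Ltac vindex x l :=
  lazymatch l with
  | cons x _ => constr:(O)
  | cons _ ?t => let i := vindex x t in constr:(S i)
  end.
Ltac vreify e l :=
  lazymatch e with
  | plus ?a ?b => let a := vreify a l in let b := vreify b l in constr:(VPlus a b)
  | minus ?a ?b => let a := vreify a l in let b := vreify b l in constr:(VMinus a b)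
  | opp ?a => let a := vreify a l in constr:(VOpp a)
  | scal ?x ?a => let a := vreify a l in constr:(VScal x a)
  | zero => constr:(VZero)
  | ?a => let i := vindex a l in constr:(VAtom i)
  end.

(** Proves linear identities between vectors, leaving the comparisons of
    coefficients that [ring] does not settle. *)
Ltac vring :=
  lazymatch goal with
  | |- @eq ?T ?x ?y =>
      let l0 := constr:(@nil T) in
      let l := vatoms x l0 in let l := vatoms y l in
      let a := vreify x l in let b := vreify y l in
      refine (@veval_eq _ l a b _);
      cbn [vcoef_eq vcoef vbound Nat.max Nat.eqb];
      repeat apply conj; try exact I; try ring
  end.

Lemma norm_minus_sym {W : NormedModule R_AbsRing} (x y : W) :
  norm (minus x y) = norm (minus y x).
Proof. rewrite <- (norm_opp (minus x y)); f_equal; vring. Qed.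

Lemma norm_minus_triangle {W : NormedModule R_AbsRing} (x y z : W) :
  norm (minus x z) <= norm (minus x y) + norm (minus y z).
Proof.
  replace (minus x z) with (plus (minus x y) (minus y z)) by vring.
  apply norm_triangle.
Qed.

Lemma norm_minus_le {W : NormedModule R_AbsRing} (x y : W) :
  norm (minus x y) <= norm x + norm y.
Proof. unfold minus; rewrite <- (norm_opp y); apply norm_triangle. Qed.

(** The axioms of a normed module give only [<=]; the converse is the same inequality for [/ x]
    applied to [scal x v]. *)
Lemma norm_scal_real {W : NormedModule R_AbsRing} (x : R) (v : W) :
  norm (scal x v) = Rabs x * norm v.
Proof.
  apply Rle_antisym; [exact (norm_scal x v)|].
  destruct (Req_dec x 0) as [->|Hx].
  { rewrite Rabs_R0, Rmult_0_l; apply norm_ge_0. }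
  assert (Hp := Rabs_pos_lt x Hx).
  assert (H := norm_scal (/ x) (scal x v)).
  assert (E : v = scal (/ x) (scal x v)) by (vring; field; exact Hx).
  change (abs (/ x)) with (Rabs (/ x)) in H; rewrite Rabs_inv in H.
  apply Rmult_le_reg_l with (/ Rabs x); [now apply Rinv_0_lt_compat|].
  rewrite <- Rmult_assoc, Rinv_l by lra; rewrite Rmult_1_l, E at 1; exact H.
Qed.

Lemma norm_le_eq {W : NormedModule R_AbsRing} (x y : W) (c : R) :
  x = y -> norm y <= c -> norm x <= c.
Proof. now intros ->. Qed.

Lemma minus_eq_0 {W : NormedModule R_AbsRing} (x y : W) :
  (forall eps, 0 < eps -> norm (minus x y) <= eps) -> x = y.
Proof.
  intros H.
  assert (E : minus x y = zero).
  { apply (norm_eq_zero (minus x y)), Rle_antisym; [|apply norm_ge_0].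
    apply le_epsilon; intros e He; specialize (H e He); lra. }
  replace x with (plus (minus x y) y) by vring.
  rewrite E; vring.
Qed.

Lemma filterlim_norm_eps {T : Type} {W : NormedModule R_AbsRing} (F : (T -> Prop) -> Prop)
    {FF : Filter F} (f : T -> W) (l : W) :
  filterlim f F (locally l) <-> forall eps, 0 < eps -> F (fun t => norm (minus (f t) l) < eps).
Proof.
  split.
  - intros H eps He; apply (H (fun y => norm (minus y l) < eps)).
    apply (locally_le_locally_norm l); exists (mkposreal eps He); intros y Hy; exact Hy.
  - intros H P HP; destruct (locally_norm_le_locally l P HP) as [e He].
    apply filter_imp with (2 := H e (cond_pos e)).
    intros t Ht; apply He; exact Ht.
Qed.

Lemma continuous_norm_eps {U : UniformSpace} {W : NormedModule R_AbsRing} (f : U -> W) (x : U) :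
  continuous f x <->
  forall eps, 0 < eps -> locally x (fun t => norm (minus (f t) (f x)) < eps).
Proof. apply (filterlim_norm_eps (locally x)). Qed.

Lemma is_derive_norm_eps {W : NormedModule R_AbsRing} (f : R -> W) (x : R) (l : W) :
  (forall eps, 0 < eps -> locally x (fun y =>
     norm (minus (minus (f y) (f x)) (scal (y - x) l)) <= eps * Rabs (y - x))) ->
  is_derive f x l.
Proof.
  intros H; split; [apply is_linear_scal_l|].
  intros x' Hx'; apply (is_filter_lim_locally_unique x) in Hx'; subst x'.
  intros eps; generalize (H eps (cond_pos eps)); apply filter_imp; intros y Hy; exact Hy.
Qed.

(** * Integrals over bounded intervals *)

(** A linear map commutes exactly with Riemann sums, and its continuity passes this to the limit. *)
Lemma is_RInt_linear {U W : NormedModule R_AbsRing} (L : U -> W) (HL : is_linear L)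
    (f : R -> U) (a b : R) (I : U) :
  is_RInt f a b I -> is_RInt (fun t => L (f t)) a b (L I).
Proof.
  intros H.
  assert (E : forall s, L (Riemann_sum f s) = Riemann_sum (fun t => L (f t)) s).
  { intros s; apply (SF_cons_ind
      (fun s => L (Riemann_sum f s) = Riemann_sum (fun t => L (f t)) s)).
    - intros x0; unfold Riemann_sum; simpl; apply (linear_zero L HL).
    - intros h s0 IH; rewrite !Riemann_sum_cons, (linear_plus L HL), IH.
      f_equal; apply (linear_scal L HL). }
  unfold is_RInt.
  apply filterlim_ext with
    (f := fun s => L (scal (sign (b - a)) (Riemann_sum f s))).
  { intros s; rewrite (linear_scal L HL); f_equal; apply E. }
  apply (filterlim_comp _ _ _ _ L _ _ _ H), (linear_cont L I HL).
Qed.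

(** The majorant comes with an antiderivative [G], so that every estimate ends in values of
    elementary functions. *)
Lemma RInt_norm_le {W : CompleteNormedModule R_AbsRing} (f : R -> W) (g G : R -> R) (a b : R) :
  a <= b ->
  (forall t, a <= t <= b -> continuous f t) ->
  (forall t, a <= t <= b -> is_derive G t (g t)) ->
  (forall t, a <= t <= b -> continuous g t) ->
  (forall t, a <= t <= b -> norm (f t) <= g t) ->
  norm (RInt f a b) <= G b - G a.
Proof.
  intros Hab Hf HG Hg Hle.
  apply (norm_RInt_le f g a b); [easy|easy| |].
  - apply (RInt_correct (V := W)), ex_RInt_continuous.
    rewrite Rmin_left, Rmax_right by easy; easy.
  - apply (is_RInt_derive (V := R_CompleteNormedModule) G g);
      rewrite Rmin_left, Rmax_right by easy; easy.
Qed.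

Lemma RInt_norm_le_const {W : CompleteNormedModule R_AbsRing} (f : R -> W) (C a b : R) :
  a <= b ->
  (forall t, a <= t <= b -> continuous f t) ->
  (forall t, a <= t <= b -> norm (f t) <= C) ->
  norm (RInt f a b) <= C * (b - a).
Proof.
  intros Hab Hf Hle.
  apply Rle_trans with (C * b - C * a); [|right; ring].
  apply (RInt_norm_le f (fun _ => C) (fun t => C * t)); try easy.
  - intros t _; auto_derive; [easy|ring].
  - intros; apply continuous_const.
Qed.

Lemma is_RInt_between {W : CompleteNormedModule R_AbsRing} (f : R -> W) (a b : R) :
  a <= b -> (forall t, a <= t <= b -> continuous f t) -> is_RInt f a b (RInt f a b).
Proof.
  intros Hab Hf; apply (RInt_correct (V := W)), ex_RInt_continuous.
  now rewrite Rmin_left, Rmax_right.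
Qed.

(** * Fubini's theorem on rectangles *)

Definition jointly_continuous {W : UniformSpace} (f : R -> R -> W) (x y : R) : Prop :=
  continuous (fun p : R * R => f (fst p) (snd p)) (x, y).

Lemma jointly_continuous_swap {W : UniformSpace} (f : R -> R -> W) x y :
  jointly_continuous f x y -> jointly_continuous (fun y x => f x y) y x.
Proof.
  intros H P HP; destruct (H P HP) as [e He].
  exists e; intros [y' x'] [H1 H2]; apply (He (x', y')); split; easy.
Qed.

Lemma jointly_continuous_2 {W : UniformSpace} (f : R -> R -> W) x y :
  jointly_continuous f x y -> continuous (f x) y.
Proof.
  intros H P HP; destruct (H P HP) as [e He].
  exists e; intros y' H'; apply (He (x, y')); split; [apply ball_center|easy].
Qed.

Lemma jointly_continuous_1 {W : UniformSpace} (f : R -> R -> W) x y :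
  jointly_continuous f x y -> continuous (fun t => f t y) x.
Proof.
  intros H; apply jointly_continuous_swap in H.
  now apply (jointly_continuous_2 (fun y x => f x y)).
Qed.

(** Compactness of the segment [{x} * [c, d]]: each of its points has a neighbourhood on which [f]
    varies by less than [eps / 2], and finitely many of these suffice. *)
Lemma uniform_continuity_segment {W : NormedModule R_AbsRing} (f : R -> R -> W) x c d eps :
  0 < eps ->
  (forall y, c <= y <= d -> jointly_continuous f x y) ->
  exists delta, 0 < delta /\ forall x' y, Rabs (x' - x) < delta -> c <= y <= d ->
    norm (minus (f x' y) (f x y)) < eps.
Proof.
  intros He Hf.
  assert (H1 : forall y, exists e : posreal, c <= y <= d ->
    forall x' y', Rabs (x' - x) < e -> Rabs (y' - y) < e ->
      norm (minus (f x' y') (f x y)) < eps / 2).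
  { intros y; destruct (classic (c <= y <= d)) as [Hy|Hy].
    - assert (H := Hf y Hy); unfold jointly_continuous in H; rewrite continuous_norm_eps in H.
      destruct (H (eps / 2) ltac:(lra)) as [e Hb].
      exists e; intros _ x' y' Hx Hy'; apply (Hb (x', y')); split; easy.
    - exists (mkposreal 1 Rlt_0_1); easy. }
  assert (H2 : forall y, {e : posreal | c <= y <= d ->
    forall x' y', Rabs (x' - x) < e -> Rabs (y' - y) < e ->
      norm (minus (f x' y') (f x y)) < eps / 2}).
  { intros y; apply constructive_indefinite_description, H1. }
  destruct (compactness_value_1d c d (fun y => proj1_sig (H2 y))) as [delta Hd].
  (* The covering property provided by compactness is doubly negated, hence [NNPP]; both [f x' y]
     and [f x y] are compared with the value at the centre [(x, t)]. *)
  exists delta; split; [apply cond_pos|]; intros x' y Hx' Hy.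
  destruct (NNPP _ (Hd y Hy)) as (t & Ht & Hyt & Hdt).
  destruct (H2 t) as [e He2]; simpl in *; specialize (He2 Ht).
  apply Rle_lt_trans with (1 := norm_minus_triangle _ (f x t) _).
  rewrite (norm_minus_sym (f x t)).
  assert (A := He2 x' y ltac:(lra) Hyt).
  assert (B := He2 x y ltac:(rewrite Rminus_diag, Rabs_R0; apply cond_pos) Hyt).
  lra.
Qed.

Lemma continuous_RInt_param {W : CompleteNormedModule R_AbsRing} (f : R -> R -> W)
    (a b x c d : R) :
  a < x < b -> c <= d ->
  (forall x y, a < x < b -> c <= y <= d -> jointly_continuous f x y) ->
  continuous (fun x => RInt (f x) c d) x.
Proof.
  intros Hx Hcd Hf; refine (proj2 (continuous_norm_eps (U := R_UniformSpace) (W := W) _ x) _); intros eps He.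
  (* The [+ 1] keeps the denominator positive when [c = d]. *)
  destruct (uniform_continuity_segment f x c d (eps / (d - c + 1))) as (e & He0 & Hu).
  { apply Rdiv_lt_0_compat; lra. }
  { intros; apply Hf; easy. }
  assert (Hm : 0 < Rmin e (Rmin (x - a) (b - x))) by (repeat apply Rmin_pos; lra).
  exists (mkposreal _ Hm); intros x' Hx'.
  assert (H' : Rabs (x' - x) < Rmin e (Rmin (x - a) (b - x))) by exact Hx'; clear Hx'.
  assert (H1 := Rmin_l e (Rmin (x - a) (b - x))).
  assert (H2 := Rmin_r e (Rmin (x - a) (b - x))).
  assert (H3 := Rmin_l (x - a) (b - x)); assert (H4 := Rmin_r (x - a) (b - x)).
  assert (Hx2 : a < x' < b) by (apply Rabs_def2 in H'; lra).
  rewrite <- (RInt_minus (V := W)).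
  2, 3: apply ex_RInt_continuous; rewrite Rmin_left, Rmax_right by easy;
        intros; apply jointly_continuous_2; apply Hf; easy.
  apply Rle_lt_trans with (eps / (d - c + 1) * (d - c)).
  - apply RInt_norm_le_const; [easy| |].
    + intros t Ht; apply (continuous_minus (V := W));
        apply jointly_continuous_2; apply Hf; easy.
    + intros t Ht; left; apply Hu; [lra|easy].
  - apply Rmult_lt_reg_r with (d - c + 1); [lra|].
    replace (eps / (d - c + 1) * (d - c) * (d - c + 1)) with (eps * (d - c)) by (field; lra).
    nra.
Qed.

Lemma RInt_const_V {W : CompleteNormedModule R_AbsRing} (a b : R) (v : W) :
  RInt (fun _ => v) a b = scal (b - a) v.
Proof. apply is_RInt_unique; exact (is_RInt_const a b v). Qed.

Lemma RInt_near_const {W : CompleteNormedModule R_AbsRing} (g : R -> W) (x x' e : R) :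
  (forall t, Rabs (t - x) <= Rabs (x' - x) -> continuous g t) ->
  (forall t, Rabs (t - x) <= Rabs (x' - x) -> norm (minus (g t) (g x)) <= e) ->
  norm (minus (RInt g x x') (scal (x' - x) (g x))) <= e * Rabs (x' - x).
Proof.
  intros Hc Hle.
  assert (Hex : ex_RInt g x x').
  { apply ex_RInt_continuous; intros z Hz; apply Hc.
    revert Hz; unfold Rmin, Rmax, Rabs; destruct (Rle_dec x x');
    destruct (Rcase_abs _), (Rcase_abs _); lra. }
  rewrite <- RInt_const_V, <- (RInt_minus (V := W)); [|easy|apply ex_RInt_const].
  destruct (Rle_lt_dec x x') as [H|H].
  - rewrite Rabs_pos_eq by lra.
    apply RInt_norm_le_const; [easy| |]; intros t Ht.
    + apply (continuous_minus (V := W)); [|apply continuous_const].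
      apply Hc; rewrite !Rabs_pos_eq; lra.
    + apply Hle; rewrite !Rabs_pos_eq; lra.
  - rewrite <- (opp_RInt_swap (V := W)), (norm_opp (V := W)).
    2: { apply (ex_RInt_minus (V := W)); [apply ex_RInt_swap; easy|apply ex_RInt_const]. }
    rewrite Rabs_left by lra.
    replace (- (x' - x)) with (x - x') by ring.
    apply RInt_norm_le_const; [lra| |]; intros t Ht.
    + apply (continuous_minus (V := W)); [|apply continuous_const].
      apply Hc; rewrite !Rabs_left1; lra.
    + apply Hle; rewrite !Rabs_left1; lra.
Qed.

Lemma is_derive_zero_eq {W : CompleteNormedModule R_AbsRing} (f : R -> W) (a b : R) :
  a <= b -> (forall x, a <= x <= b -> is_derive f x zero) -> f a = f b.
Proof.
  intros Hab H.
  assert (H1 : is_RInt (fun _ : R => zero : W) a b (minus (f b) (f a))).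
  { apply (is_RInt_derive (V := W) f (fun _ => zero));
      rewrite Rmin_left, Rmax_right by easy; [easy|intros; apply continuous_const]. }
  apply (is_RInt_unique (V := W)) in H1; rewrite RInt_const_V in H1.
  replace (f b) with (plus (minus (f b) (f a)) (f a)) by vring.
  rewrite <- H1; vring.
Qed.

(** Both sides, as functions [H] and [G] of the upper limit in [x], vanish at [a] and have
    derivative [RInt (f x) c d]; so their difference is constant. For [G] this is differentiation
    under the integral sign, by uniform continuity along the segment over [x]. The open margins
    around the rectangle give two-sided derivatives at its edges. *)
Lemma Fubini_rectangle {W : CompleteNormedModule R_AbsRing} (f : R -> R -> W)
    (a0 a b b0 c0 c d d0 : R) :
  a0 < a -> a <= b -> b < b0 -> c0 < c -> c <= d -> d < d0 ->
  (forall x y, a0 < x < b0 -> c0 < y < d0 -> jointly_continuous f x y) ->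
  RInt (fun x => RInt (f x) c d) a b = RInt (fun y => RInt (fun x => f x y) a b) c d.
Proof.
  intros Ha Hab Hb Hc Hcd Hd Hf.
  assert (Hx : forall x, a0 < x < b0 -> continuous (fun x => RInt (f x) c d) x).
  { intros x Hx; apply (continuous_RInt_param f a0 b0); [easy|easy|].
    intros; apply Hf; lra. }
  assert (Hs : forall x y, a0 < x < b0 -> c0 < y < d0 -> continuous (fun x => f x y) x).
  { intros; apply jointly_continuous_1, Hf; easy. }
  assert (Hexf : forall x x' y, a0 < x < b0 -> a0 < x' < b0 -> c0 < y < d0 ->
    ex_RInt (fun u => f u y) x x').
  { intros x x' y H1 H2 Hy; apply ex_RInt_continuous; intros z Hz; apply Hs; [|easy].
    revert Hz; unfold Rmin, Rmax; destruct (Rle_dec x x'); lra. }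
  assert (Hcy : forall x x' y, a0 < x < b0 -> a0 < x' < b0 -> c0 < y < d0 ->
    continuous (fun y => RInt (fun x => f x y) x x') y).
  { assert (Hle : forall x x' y, a0 < x -> x <= x' -> x' < b0 -> c0 < y < d0 ->
      continuous (fun y => RInt (fun x => f x y) x x') y).
    { intros x x' y H1 H2 H3 Hy.
      apply (continuous_RInt_param (fun y x => f x y) c0 d0); [easy|easy|].
      intros; apply jointly_continuous_swap, Hf; lra. }
    intros x x' y H1 H2 Hy; destruct (Rle_lt_dec x x') as [H|H].
    - apply Hle; lra.
    - apply (continuous_ext_loc _ (fun y => opp (RInt (fun x => f x y) x' x))).
      + apply (locally_interval _ y c0 d0); simpl; try easy.
        intros z H3 H4; apply (opp_RInt_swap (V := W)); apply Hexf; easy.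
      + apply (continuous_opp (V := W)), Hle; lra. }
  set (G := fun x => RInt (fun y => RInt (fun u => f u y) a x) c d).
  set (H := fun x => RInt (fun x => RInt (f x) c d) a x).
  assert (HG : forall x, a <= x <= b -> is_derive G x (RInt (f x) c d)).
  { intros x Hx1; apply is_derive_norm_eps; intros eps He.
    destruct (uniform_continuity_segment f x c d (eps / (d - c + 1))) as (e & He0 & Hu).
    { apply Rdiv_lt_0_compat; lra. }
    { intros; apply Hf; lra. }
    assert (Hm : 0 < Rmin e (Rmin (x - a0) (b0 - x))) by (repeat apply Rmin_pos; lra).
    exists (mkposreal _ Hm); intros x' Hx'.
    assert (H' : Rabs (x' - x) < Rmin e (Rmin (x - a0) (b0 - x))) by exact Hx'; clear Hx'.
    assert (H1 := Rmin_l e (Rmin (x - a0) (b0 - x))).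
    assert (H2 := Rmin_r e (Rmin (x - a0) (b0 - x))).
    assert (H3 := Rmin_l (x - a0) (b0 - x)); assert (H4 := Rmin_r (x - a0) (b0 - x)).
    assert (Hx2 : a0 < x' < b0) by (apply Rabs_def2 in H'; lra).
    assert (Hnear : forall t, Rabs (t - x) <= Rabs (x' - x) -> a0 < t < b0).
    { intros t Ht; assert (A : Rabs (t - x) < Rmin e (Rmin (x - a0) (b0 - x))) by lra.
      apply Rabs_def2 in A; lra. }
    assert (E : minus (minus (G x') (G x)) (scal (x' - x) (RInt (f x) c d)) =
      RInt (fun y => minus (RInt (fun u => f u y) x x') (scal (x' - x) (f x y))) c d).
    { assert (Hce : forall g : R -> W, (forall y, c0 < y < d0 -> continuous g y) -> ex_RInt g c d).
      { intros g Hg; apply ex_RInt_continuous; rewrite Rmin_left, Rmax_right by easy.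
        intros; apply Hg; lra. }
      rewrite (RInt_minus (V := W)).
      2: { apply Hce; intros; apply Hcy; lra. }
      2: { apply Hce; intros; apply (continuous_scal_r (V := W)), jointly_continuous_2, Hf; lra. }
      rewrite (RInt_scal (V := W))
        by (apply Hce; intros; apply jointly_continuous_2, Hf; lra).
      f_equal; unfold G; rewrite <- (RInt_minus (V := W)).
      2, 3: apply Hce; intros; apply Hcy; lra.
      apply RInt_ext; rewrite Rmin_left, Rmax_right by easy; intros y Hy.
      rewrite <- (RInt_Chasles (V := W) (fun u => f u y) a x x') by (apply Hexf; lra).
      vring. }
    change (norm (minus (minus (G x') (G x)) (scal (x' - x) (RInt (f x) c d)))
            <= eps * Rabs (x' - x)).
    rewrite E.
    apply Rle_trans with (eps / (d - c + 1) * Rabs (x' - x) * (d - c)).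
    - apply RInt_norm_le_const; [easy| |]; intros y Hy.
      + apply (continuous_minus (V := W)); [apply Hcy; lra|].
        apply (continuous_scal_r (V := W)), jointly_continuous_2, Hf; lra.
      + apply (RInt_near_const (fun u => f u y)); intros t Ht.
        * apply Hs; [now apply Hnear|lra].
        * left; apply Hu; [lra|easy].
    - apply Rle_trans with (eps * Rabs (x' - x) * ((d - c) / (d - c + 1))).
      + right; field; lra.
      + rewrite <- Rmult_1_r; apply Rmult_le_compat_l.
        * apply Rmult_le_pos; [lra|apply Rabs_pos].
        * apply Rmult_le_reg_r with (d - c + 1); [lra|].
          unfold Rdiv; rewrite Rmult_assoc, Rinv_l; lra. }
  assert (HH : forall x, a <= x <= b -> is_derive H x (RInt (f x) c d)).
  { intros x Hx1; apply (is_derive_RInt (fun x => RInt (f x) c d) H a).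
    - apply (locally_interval _ x a0 b0); simpl; try lra.
      intros z H1 H2; apply (RInt_correct (V := W)), ex_RInt_continuous; intros u Hu.
      apply Hx; revert Hu; unfold Rmin, Rmax; destruct (Rle_dec a z); lra.
    - apply Hx; lra. }
  assert (E : minus (G a) (H a) = minus (G b) (H b)).
  { apply (is_derive_zero_eq (fun x => minus (G x) (H x)) a b Hab); intros x Hx1.
    assert (D := is_derive_minus (V := W) G H x _ _ (HG x Hx1) (HH x Hx1)).
    assert (Z : minus (RInt (f x) c d) (RInt (f x) c d) = zero) by vring.
    exact (eq_rect _ (is_derive (fun x => minus (G x) (H x)) x) D _ Z). }
  assert (Ha0 : G a = zero).
  { unfold G; rewrite (RInt_ext _ (fun _ => zero)).
    - rewrite RInt_const_V; vring.
    - intros; apply (RInt_point (V := W)). }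
  assert (Hb0 : H a = zero) by apply (RInt_point (V := W)).
  rewrite Ha0, Hb0 in E.
  change (H b = G b).
  replace (G b) with (plus (minus (G b) (H b)) (H b)) by vring.
  rewrite <- E; vring.
Qed.

(** * Integrals over the half-line *)

Notation half_int f l := (is_RInt_gen f (at_right 0) (Rbar_locally p_infty) l).

Definition ends (P : R -> R -> Prop) : Prop :=
  filter_prod (at_right 0) (Rbar_locally p_infty) (fun ab => P (fst ab) (snd ab)).

(** The clause [a0 <= b0] ensures [a < b] for all admissible pairs, so truncated integrals are never
    reversed. *)
Lemma ends_char (P : R -> R -> Prop) :
  ends P <-> exists a0 b0, 0 < a0 /\ a0 <= b0 /\
    forall a b, 0 < a -> a < a0 -> b0 < b -> P a b.
Proof.
  split.
  - intros [Q S [e He] [M HM] H].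
    exists (Rmin e 1), (Rmax M 1); repeat split.
    + apply Rmin_pos; [apply cond_pos|lra].
    + assert (A := Rmin_r e 1); assert (B := Rmax_r M 1); lra.
    + intros a b Ha Hae Hb; apply (H a b).
      * apply He; [|easy].
        change (Rabs (a - 0) < e); rewrite Rminus_0_r, Rabs_pos_eq by lra.
        assert (A := Rmin_l e 1); lra.
      * apply HM; assert (B := Rmax_l M 1); lra.
  - intros (a0 & b0 & Ha0 & _ & H).
    apply (Filter_prod _ _ _ (fun a => 0 < a < a0) (fun b => b0 < b)).
    + exists (mkposreal a0 Ha0); intros a Ha Hp.
      change (Rabs (a - 0) < a0) in Ha; apply Rabs_def2 in Ha; lra.
    + now exists b0.
    + intros a b Ha Hb; simpl; apply H; easy.
Qed.

Lemma ends_and (P Q : R -> R -> Prop) :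
  ends P -> ends Q -> ends (fun a b => P a b /\ Q a b).
Proof. intros HP HQ; exact (filter_and _ _ HP HQ). Qed.

Lemma ends_imp (P Q : R -> R -> Prop) :
  (forall a b, 0 < a -> a < b -> P a b -> Q a b) -> ends P -> ends Q.
Proof.
  intros H HP; apply ends_char in HP; apply ends_char.
  destruct HP as (a0 & b0 & Ha0 & Hab & HP).
  exists a0, b0; repeat split; try easy; intros a b H1 H2 H3; apply H; try lra.
  now apply HP.
Qed.

Lemma ends_ex (P : R -> R -> Prop) :
  ends P -> exists a b, 0 < a /\ a < b /\ P a b.
Proof.
  intros HP; apply ends_char in HP; destruct HP as (a0 & b0 & Ha0 & Hab & HP).
  exists (a0 / 2), (b0 + 1); repeat split; try lra; apply HP; lra.
Qed.

Lemma half_int_char {W : NormedModule R_AbsRing} (f : R -> W) (l : W) :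
  half_int f l <-> forall eps, 0 < eps ->
    ends (fun a b => exists y, is_RInt f a b y /\ norm (minus y l) < eps).
Proof.
  split.
  - intros H eps He; apply (H (fun y => norm (minus y l) < eps)).
    apply (locally_le_locally_norm l); exists (mkposreal eps He); intros y Hy; exact Hy.
  - intros H P HP; destruct (locally_norm_le_locally l P HP) as [e He].
    refine (filter_imp (F := filter_prod (at_right 0) (Rbar_locally p_infty))
      _ _ _ (H e (cond_pos e))).
    intros t (y & Hy & Hy'); exists y; split; [easy|]; apply He; exact Hy'.
Qed.

Lemma half_int_linear {U W : NormedModule R_AbsRing} (L : U -> W) (HL : is_linear L)
    (f : R -> U) (I : U) :
  half_int f I -> half_int (fun t => L (f t)) (L I).
Proof.
  intros H P HP.
  refine (filter_imp (F := filter_prod (at_right 0) (Rbar_locally p_infty))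
    _ _ _ (H (fun y => P (L y)) (linear_cont L I HL P HP))).
  intros ab (y & Hy & Hy'); exists (L y); split; [|easy].
  now apply is_RInt_linear.
Qed.

Lemma half_int_ext {W : NormedModule R_AbsRing} (f g : R -> W) (l : W) :
  (forall t, 0 < t -> f t = g t) -> half_int f l -> half_int g l.
Proof.
  intros E; apply is_RInt_gen_ext.
  change (ends (fun a b => forall x, Rmin a b < x < Rmax a b -> f x = g x)).
  apply ends_char; exists 1, 1; repeat split; try lra.
  intros a b Ha Ha1 Hb x; rewrite Rmin_left by lra; intros Hx; apply E; lra.
Qed.

Lemma half_int_unique {W : CompleteNormedModule R_AbsRing} (f : R -> W) (l l' : W) :
  half_int f l -> half_int f l' -> l = l'.
Proof.
  intros H H'.
  apply (is_RInt_gen_unique (V := W)) in H; apply (is_RInt_gen_unique (V := W)) in H'.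
  now rewrite <- H.
Qed.

(** * A dominating kernel with an elementary antiderivative *)

(** An antiderivative [kap_prim d] of [kap d] tends to [-1/d] at [0] and to [0] at [+oo]. *)
Definition kap (d t : R) : R := Rpower t (d - 1) / (1 + Rpower t d) ^ 2.
Definition kap_prim (d t : R) : R := - / (d * (1 + Rpower t d)).

Lemma Rpower_pos x y : 0 < Rpower x y.
Proof. apply exp_pos. Qed.

Lemma is_derive_Rpower (a t : R) : 0 < t ->
  is_derive (fun t => Rpower t a) t (a * Rpower t (a - 1)).
Proof.
  intros Ht; unfold Rminus; rewrite Rpower_plus, Rpower_Ropp, Rpower_1 by easy.
  unfold Rpower; auto_derive; [easy|field; lra].
Qed.

Lemma continuous_Rpower (a t : R) : 0 < t -> continuous (fun t => Rpower t a) t.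
Proof. intros Ht; apply (ex_derive_continuous (V := R_NormedModule)); eexists; now apply is_derive_Rpower. Qed.

Lemma kap_pos d t : 0 < kap d t.
Proof.
  assert (H1 := Rpower_pos t d); assert (H2 := Rpower_pos t (d - 1)).
  unfold kap; apply Rdiv_lt_0_compat; nra.
Qed.

Lemma continuous_kap d t : 0 < t -> continuous (kap d) t.
Proof.
  intros Ht; assert (H1 := Rpower_pos t d).
  apply (ex_derive_continuous (V := R_NormedModule)); unfold kap, Rpower.
  auto_derive; repeat split; try easy; fold (Rpower t d); nra.
Qed.

Lemma is_derive_kap_prim d t : 0 < d -> 0 < t -> is_derive (kap_prim d) t (kap d t).
Proof.
  intros Hd Ht; assert (H1 := Rpower_pos t d).
  unfold kap, Rminus; rewrite Rpower_plus, Rpower_Ropp, Rpower_1 by easy.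
  unfold kap_prim, Rpower in *; auto_derive; [nra|field; split; nra].
Qed.

Lemma kap_prim_bounds d t : 0 < d -> - / d < kap_prim d t < 0.
Proof.
  intros Hd; assert (H1 := Rpower_pos t d); unfold kap_prim; split.
  - apply Ropp_lt_contravar, Rinv_lt_contravar; nra.
  - apply Ropp_lt_gt_0_contravar, Rinv_0_lt_compat; nra.
Qed.

Lemma kap_tails d eps : 0 < d -> 0 < eps ->
  ends (fun a b => kap_prim d a + / d < eps /\ - kap_prim d b < eps).
Proof.
  intros Hd He; apply ends_char.
  (* The tails are [t^d / (d (1 + t^d))] at [0] and [1 / (d (1 + t^d))] at infinity; the thresholds
     solve [t^d = d eps] and [t^d = 1 / (d eps)]. *)
  set (a0 := Rpower (d * eps) (/ d)); set (b0 := Rpower (/ (d * eps)) (/ d)).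
  assert (Hde : 0 < d * eps) by nra.
  assert (Hde' := Rinv_0_lt_compat _ Hde).
  assert (Ha0 : 0 < a0) by apply Rpower_pos.
  exists a0, (Rmax a0 b0); repeat split; [easy|apply Rmax_l| |].
  - assert (H2 : Rpower a d < d * eps).
    { apply Rlt_le_trans with (Rpower a0 d).
      - apply Rlt_Rpower_l; lra.
      - unfold a0; rewrite Rpower_mult, Rinv_l, Rpower_1; lra. }
    assert (H3 := Rpower_pos a d); unfold kap_prim.
    replace (- / (d * (1 + Rpower a d)) + / d) with (Rpower a d / d * / (1 + Rpower a d))
      by (field; lra).
    apply Rle_lt_trans with (Rpower a d / d * 1).
    + apply Rmult_le_compat_l; [apply Rlt_le, Rdiv_lt_0_compat; lra|].
      rewrite <- Rinv_1; apply Rinv_le_contravar; lra.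
    + rewrite Rmult_1_r; apply Rmult_lt_reg_r with d; [lra|].
      unfold Rdiv; rewrite Rmult_assoc, Rinv_l; lra.
  - assert (H2 : / (d * eps) < Rpower b d).
    { apply Rle_lt_trans with (Rpower b0 d).
      - unfold b0; rewrite Rpower_mult, Rinv_l, Rpower_1; lra.
      - assert (B := Rmax_r a0 b0); apply Rlt_Rpower_l; [lra|].
        split; [apply Rpower_pos|lra]. }
    unfold kap_prim; rewrite Ropp_involutive, <- (Rinv_inv eps).
    apply Rinv_lt_contravar.
    + apply Rmult_lt_0_compat; [now apply Rinv_0_lt_compat|nra].
    + rewrite Rinv_mult in H2.
      apply Rmult_lt_compat_l with (r := d) in H2; [|easy].
      rewrite <- Rmult_assoc, Rinv_r, Rmult_1_l in H2; lra.
Qed.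

(** [kap d] behaves like [t^(d-1)] at [0] and like [t^(-d-1)] at infinity, so [d] must be at most
    [a] and at most [b - a]. The factor [4] is the square of the [2] in [1 + t^d <= 2 (1+t)^d]. *)
Lemma kap_dominates a b t : 0 < t -> 0 < a < b ->
  Rpower t (a - 1) * Rpower (1 + t) (- b) <= 4 * kap (Rmin a (b - a)) t.
Proof.
  intros Ht Hab; set (d := Rmin a (b - a)).
  assert (Hd : 0 < d) by (apply Rmin_pos; lra).
  assert (Hda : d <= a) by apply Rmin_l; assert (Hdb : d <= b - a) by apply Rmin_r.
  assert (H1 : 1 + Rpower t d <= 2 * Rpower (1 + t) d).
  { assert (A : Rpower t d <= Rpower (1 + t) d) by (apply Rle_Rpower_l; lra).
    assert (B : Rpower (1 + t) 0 <= Rpower (1 + t) d) by (apply Rle_Rpower; lra).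
    rewrite Rpower_O in B; lra. }
  assert (H2 : Rpower t (a - d) * Rpower (1 + t) (2 * d) <= Rpower (1 + t) b).
  { apply Rle_trans with (Rpower (1 + t) (a - d) * Rpower (1 + t) (2 * d)).
    - apply Rmult_le_compat_r; [apply Rlt_le, Rpower_pos|].
      apply Rle_Rpower_l; lra.
    - rewrite <- Rpower_plus; apply Rle_Rpower; lra. }
  replace (a - 1) with ((d - 1) + (a - d)) by ring.
  rewrite Rpower_plus, Rpower_Ropp; unfold kap.
  assert (P0 := Rpower_pos t d); assert (P1 := Rpower_pos t (d - 1)).
  assert (P2 := Rpower_pos (1 + t) b); assert (P3 := Rpower_pos t (a - d)).
  apply Rmult_le_reg_r with (Rpower (1 + t) b * (1 + Rpower t d) ^ 2); [nra|].
  replace (Rpower t (d - 1) * Rpower t (a - d) * / Rpower (1 + t) b *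
    (Rpower (1 + t) b * (1 + Rpower t d) ^ 2)) with
    (Rpower t (d - 1) * (Rpower t (a - d) * (1 + Rpower t d) ^ 2)) by (field; lra).
  replace (4 * (Rpower t (d - 1) / (1 + Rpower t d) ^ 2) *
    (Rpower (1 + t) b * (1 + Rpower t d) ^ 2)) with
    (Rpower t (d - 1) * (4 * Rpower (1 + t) b)) by (field; lra).
  apply Rmult_le_compat_l; [lra|].
  apply Rle_trans with (Rpower t (a - d) * (2 * Rpower (1 + t) d) ^ 2).
  - apply Rmult_le_compat_l; [lra|]; nra.
  - replace ((2 * Rpower (1 + t) d) ^ 2) with (4 * Rpower (1 + t) (2 * d)).
    + lra.
    + replace (2 * d) with (d + d) by ring; rewrite Rpower_plus; ring.
Qed.

Lemma RInt_kap_le {W : CompleteNormedModule R_AbsRing} (f : R -> W) (C d a b : R) :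
  0 < d -> 0 < a <= b ->
  (forall t, 0 < t -> continuous f t) ->
  (forall t, 0 < t -> norm (f t) <= C * kap d t) ->
  norm (RInt f a b) <= C * (kap_prim d b - kap_prim d a).
Proof.
  intros Hd Hab Hf Hle; rewrite Rmult_minus_distr_l.
  apply (RInt_norm_le f (fun t => C * kap d t) (fun t => C * kap_prim d t)).
  - lra.
  - intros; apply Hf; lra.
  - intros; apply is_derive_scal, is_derive_kap_prim; lra.
  - intros; apply (continuous_scal_r (V := R_NormedModule)), continuous_kap; lra.
  - intros; apply Hle; lra.
Qed.

(** Two overlapping truncations differ only on the end pieces between [a, a'] and between [b', b];
    the variation of [kap_prim] there is at most the sum of the corresponding tails. *)
Lemma ends_RInt_close {W : CompleteNormedModule R_AbsRing} (f : R -> W) (C d a b a' b' : R) :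
  0 < d -> 0 < a <= b -> 0 < a' <= b' -> a' <= b -> a <= b' ->
  (forall t, 0 < t -> continuous f t) ->
  (forall t, 0 < t -> norm (f t) <= C * kap d t) ->
  norm (minus (RInt f a b) (RInt f a' b')) <=
    C * ((kap_prim d a + / d) + (kap_prim d a' + / d) - kap_prim d b - kap_prim d b').
Proof.
  intros Hd Hab Hab' H1 H2 Hf Hle.
  assert (HC : 0 <= C).
  { assert (A := Hle a ltac:(lra)); assert (B := norm_ge_0 (f a)).
    assert (D := kap_pos d a); nra. }
  assert (Hex : forall x y, 0 < x -> 0 < y -> ex_RInt f x y).
  { intros x y Hx Hy; apply ex_RInt_continuous; intros z Hz; apply Hf.
    apply Rlt_le_trans with (2 := proj1 Hz); now apply Rmin_pos. }
  assert (Hn : forall x y, 0 < x -> 0 < y -> norm (RInt f x y) <=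
     C * Rabs (kap_prim d y - kap_prim d x)).
  { assert (Hn : forall x y, 0 < x <= y -> norm (RInt f x y) <=
       C * Rabs (kap_prim d y - kap_prim d x)).
    { intros x y Hxy; apply Rle_trans with (1 := RInt_kap_le f C d x y Hd Hxy Hf Hle).
      apply Rmult_le_compat_l; [easy|apply Rle_abs]. }
    intros x y Hx Hy; destruct (Rle_lt_dec x y); [now apply Hn|].
    rewrite <- (opp_RInt_swap (V := W)), (norm_opp (V := W)), Rabs_minus_sym by now apply Hex.
    apply Hn; lra. }
  replace (minus (RInt f a b) (RInt f a' b')) with (plus (RInt f a a') (RInt f b' b)).
  2: { rewrite <- (RInt_Chasles (V := W) f a a' b), <- (RInt_Chasles (V := W) f a' b' b)
         by (apply Hex; lra); vring. }
  apply Rle_trans with (1 := norm_triangle (V := W) _ _).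
  assert (A := Hn a a' ltac:(lra) ltac:(lra)); assert (B := Hn b' b ltac:(lra) ltac:(lra)).
  apply Rle_trans with (1 := Rplus_le_compat _ _ _ _ A B).
  rewrite <- Rmult_plus_distr_l; apply Rmult_le_compat_l; [easy|].
  assert (K := fun t => kap_prim_bounds d t Hd).
  assert (Ka := K a); assert (Ka' := K a'); assert (Kb := K b); assert (Kb' := K b').
  unfold Rabs; destruct (Rcase_abs _), (Rcase_abs _); lra.
Qed.

Lemma half_int_dominated {W : CompleteNormedModule R_AbsRing} (f : R -> W) (C d : R) :
  0 < d ->
  (forall t, 0 < t -> continuous f t) ->
  (forall t, 0 < t -> norm (f t) <= C * kap d t) ->
  exists l, half_int f l.
Proof.
  intros Hd Hf Hle.
  assert (HC : 0 <= C).
  { assert (A := Hle 1 ltac:(lra)); assert (B := norm_ge_0 (f 1)).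
    assert (D := kap_pos d 1); nra. }
  destruct (proj1 (filterlim_locally_cauchy (U := W)
    (F := filter_prod (at_right 0) (Rbar_locally p_infty))
    (fun ab => RInt f (fst ab) (snd ab)))) as [l Hl].
  - intros eps.
    (* Four tails enter the Cauchy criterion, two for each truncation. *)
    assert (He : 0 < eps / (4 * C + 1)) by (apply Rdiv_lt_0_compat; [apply cond_pos|lra]).
    assert (HT := kap_tails d _ Hd He); apply ends_char in HT.
    destruct HT as (a0 & b0 & Ha0 & Hab0 & HT).
    exists (fun ab => 0 < fst ab < a0 /\ b0 < snd ab); split.
    + change (ends (fun a b => 0 < a < a0 /\ b0 < b)); apply ends_char.
      exists a0, b0; repeat split; easy.
    + intros [a b] [a' b'] [H1 H2] [H3 H4]; simpl in *.
      apply (norm_compat1 (V := W)).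
      eapply Rle_lt_trans; [apply (ends_RInt_close f C d); try easy; lra|].
      destruct (HT a b ltac:(lra) ltac:(lra) ltac:(lra)) as [T1 T2].
      destruct (HT a' b' ltac:(lra) ltac:(lra) ltac:(lra)) as [T3 T4].
      set (e := eps / (4 * C + 1)) in *.
      assert (E : pos eps = (4 * C + 1) * e) by (unfold e; field; lra).
      rewrite E; nra.
  - exists l; apply half_int_char; intros eps He.
    assert (H := proj1 (filterlim_norm_eps _ _ _) Hl eps He).
    change (ends (fun a b => norm (minus (RInt f a b) l) < eps)) in H.
    revert H; apply ends_imp; intros a b Ha Hab H; exists (RInt f a b); split; [|easy].
    apply is_RInt_between; [lra|intros; apply Hf; lra].
Qed.

(** Limit of [ends_RInt_close] as the second truncation exhausts the half-line: its two tails
    disappear. *)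
Lemma half_int_tail {W : CompleteNormedModule R_AbsRing} (f : R -> W) (C d a b : R) (l : W) :
  0 < d -> 0 < a <= b ->
  (forall t, 0 < t -> continuous f t) ->
  (forall t, 0 < t -> norm (f t) <= C * kap d t) ->
  half_int f l ->
  norm (minus (RInt f a b) l) <= C * ((kap_prim d a + / d) - kap_prim d b).
Proof.
  intros Hd Hab Hf Hle Hl.
  assert (HC : 0 <= C).
  { assert (A := Hle 1 ltac:(lra)); assert (B := norm_ge_0 (f 1)).
    assert (D := kap_pos d 1); nra. }
  apply le_epsilon; intros eps He.
  assert (He' : 0 < eps / (2 * C + 1)) by (apply Rdiv_lt_0_compat; lra).
  assert (HT := kap_tails d _ Hd He').
  assert (H := proj1 (half_int_char f l) Hl _ He').
  assert (H0 : ends (fun a' b' => a' <= b /\ a <= b')).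
  { apply ends_char; exists (Rmin a b), b; repeat split; try (unfold Rmin in *; destruct (Rle_dec a b); lra). }
  destruct (ends_ex _ (ends_and _ _ (ends_and _ _ HT H) H0))
    as (a' & b' & Ha' & Hab' & ((T1 & T2) & (y & Hy & Hy')) & (H1 & H2)).
  apply (is_RInt_unique (V := W)) in Hy; subst y.
  apply Rle_trans with (1 := norm_minus_triangle _ (RInt f a' b') _).
  assert (A := ends_RInt_close f C d a b a' b' Hd Hab ltac:(lra) ltac:(lra) ltac:(lra) Hf Hle).
  set (e := eps / (2 * C + 1)) in *.
  assert (E : eps = (2 * C + 1) * e) by (unfold e; field; lra).
  assert (P := kap_prim_bounds d a' Hd).
  apply Rle_trans with (1 := Rplus_le_compat _ _ _ _ A (Rlt_le _ _ Hy')).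
  rewrite E; nra.
Qed.

Lemma half_int_pos {W : CompleteNormedModule R_AbsRing} (f : R -> W) (C a b : R) :
  0 < a < b ->
  (forall t, 0 < t -> continuous f t) ->
  (forall t, 0 < t -> norm (f t) <= C * (Rpower t (a - 1) * Rpower (1 + t) (- b))) ->
  exists l, is_int_pos f l.
Proof.
  intros Hab Hf Hle.
  assert (Hd : 0 < Rmin a (b - a)) by (apply Rmin_pos; lra).
  assert (HC : 0 <= C).
  { assert (A := Hle 1 ltac:(lra)); assert (B := norm_ge_0 (f 1)).
    assert (D1 := Rpower_pos 1 (a - 1)); assert (D2 := Rpower_pos (1 + 1) (- b)).
    assert (D3 := Rmult_lt_0_compat _ _ D1 D2); nra. }
  assert (Hle' : forall t, 0 < t -> norm (f t) <= (C * 4) * kap (Rmin a (b - a)) t).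
  { intros t Ht; apply Rle_trans with (1 := Hle t Ht).
    rewrite Rmult_assoc; apply Rmult_le_compat_l; [easy|].
    now apply kap_dominates. }
  destruct (half_int_dominated f _ _ Hd Hf Hle') as [l Hl].
  destruct (half_int_dominated (fun t => norm (f t)) (C * 4) _ Hd) as [l' Hl'].
  - intros t Ht; apply (continuous_comp f norm); [now apply Hf|].
    apply (filterlim_norm (f t)).
  - intros t Ht; change (Rabs (norm (f t)) <= C * 4 * kap (Rmin a (b - a)) t).
    rewrite Rabs_pos_eq by apply norm_ge_0; now apply Hle'.
  - exists l; split; [easy|now exists l'].
Qed.

(** Each iterated integral is approximated by the integral over one large rectangle, where the order
    does not matter. A majorant that is a product makes the error of the inner truncation integrable
    in the outer variable. *)
Lemma Fubini_half_int {W : CompleteNormedModule R_AbsRing} (f : R -> R -> W)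
    (C d e : R) (A B : R -> W) (LA LB : W) :
  0 < d -> 0 < e ->
  (forall x y, 0 < x -> 0 < y -> jointly_continuous f x y) ->
  (forall x y, 0 < x -> 0 < y -> norm (f x y) <= C * kap d x * kap e y) ->
  (forall x, 0 < x -> half_int (f x) (A x)) ->
  (forall y, 0 < y -> half_int (fun x => f x y) (B y)) ->
  half_int A LA -> half_int B LB -> LA = LB.
Proof.
  intros Hd He Hf Hle HA HB HLA HLB.
  assert (HC : 0 <= C).
  { assert (H1 := Hle 1 1 ltac:(lra) ltac:(lra)); assert (H2 := norm_ge_0 (f 1 1)).
    assert (D := Rmult_lt_0_compat _ _ (kap_pos d 1) (kap_pos e 1)); nra. }
  (* Truncating the inner integral costs at most [C kap d x] times two tails [eta]; as [kap d] has
     total mass [1 / d], this adds up to [2 C / d * eta]. The other [eta] is the outer truncation.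
     The statement is generic because it is used for [f] and for [f] with its variables
     exchanged. *)
  assert (Key : forall (g : R -> R -> W) (G : R -> W) (LG : W) d e eta, 0 < d -> 0 < e -> 0 < eta ->
    (forall x y, 0 < x -> 0 < y -> jointly_continuous g x y) ->
    (forall x y, 0 < x -> 0 < y -> norm (g x y) <= C * kap d x * kap e y) ->
    (forall x, 0 < x -> half_int (g x) (G x)) -> half_int G LG ->
    exists a0 b0 c0 h0, (0 < a0 /\ a0 <= b0 /\ 0 < c0 /\ c0 <= h0) /\
      forall a b c h, 0 < a < a0 -> b0 < b -> 0 < c < c0 -> h0 < h ->
      norm (minus (RInt (fun x => RInt (g x) c h) a b) LG) <= eta + 2 * C / d * eta).
  { clear; intros g G LG d e eta Hd He Heta Hg Hle HG HLG.
    assert (HC : 0 <= C).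
    { assert (H1 := Hle 1 1 ltac:(lra) ltac:(lra)); assert (H2 := norm_ge_0 (g 1 1)).
      assert (D := Rmult_lt_0_compat _ _ (kap_pos d 1) (kap_pos e 1)); nra. }
    assert (H1 := proj1 (half_int_char G LG) HLG eta Heta).
    assert (H2 := kap_tails e eta He Heta); apply ends_char in H1, H2.
    destruct H1 as (a0 & b0 & Ha0 & Hab0 & H1), H2 as (c0 & h0 & Hc0 & Hch0 & H2).
    exists a0, b0, c0, h0; split; [easy|]; intros a b c h Ha Hb Hc Hh.
    destruct (H1 a b) as (y & Hy & Hy'); try easy.
    destruct (H2 c h) as (T1 & T2); try easy.
    assert (Hcx : forall x, 0 < x -> continuous (fun x => RInt (g x) c h) x).
    { intros x Hx; apply (continuous_RInt_param g 0 (x + 1)); [lra|lra|].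
      intros; apply Hg; lra. }
    assert (HI := is_RInt_between (fun x => RInt (g x) c h) a b ltac:(lra)
      ltac:(intros; apply Hcx; lra)).
    assert (HD := is_RInt_minus (V := W) _ _ _ _ _ _ HI Hy).
    apply Rle_trans with (1 := norm_minus_triangle _ y _).
    assert (N : norm (minus (RInt (fun x => RInt (g x) c h) a b) y) <=
      minus (C * (2 * eta) * kap_prim d b) (C * (2 * eta) * kap_prim d a)).
    { apply (norm_RInt_le _ (fun x => C * (2 * eta) * kap d x) a b _ _ ltac:(lra)) with (2 := HD).
      - intros x Hx.
        apply Rle_trans with (C * kap d x * ((kap_prim e c + / e) - kap_prim e h)).
        + apply half_int_tail; [easy|lra| | |apply HG; lra].
          * intros t Ht; apply jointly_continuous_2, Hg; lra.
          * intros t Ht; apply Hle; lra.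
        + assert (K := kap_pos d x); assert (K2 := Rmult_le_pos _ _ HC (Rlt_le _ _ K)); nra.
      - apply (is_RInt_derive (V := R_CompleteNormedModule) (fun x => C * (2 * eta) * kap_prim d x)
          (fun x => C * (2 * eta) * kap d x)); rewrite Rmin_left, Rmax_right by lra; intros x Hx.
        + apply is_derive_scal, is_derive_kap_prim; lra.
        + apply (continuous_scal_r (V := R_NormedModule)), continuous_kap; lra. }
    change (norm (minus (RInt (fun x => RInt (g x) c h) a b) y) <=
      C * (2 * eta) * kap_prim d b - C * (2 * eta) * kap_prim d a) in N.
    assert (Ka := kap_prim_bounds d a Hd); assert (Kb := kap_prim_bounds d b Hd).
    assert (HCe : 0 <= C * (2 * eta)) by nra.
    assert (N2 : C * (2 * eta) * kap_prim d b - C * (2 * eta) * kap_prim d a <= 2 * C / d * eta).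
    { replace (2 * C / d * eta) with (C * (2 * eta) * / d) by (field; lra); nra. }
    apply Rle_trans with (2 * C / d * eta + eta); [|lra].
    apply Rplus_le_compat; [exact (Rle_trans _ _ _ N N2)|exact (Rlt_le _ _ Hy')]. }
  apply minus_eq_0; intros eps Heps.
  set (M := 2 + 2 * C / d + 2 * C / e).
  assert (HM : 0 < M).
  { unfold M; assert (D1 : 0 <= 2 * C / d) by (apply Rdiv_le_0_compat; lra).
    assert (D2 : 0 <= 2 * C / e) by (apply Rdiv_le_0_compat; lra); lra. }
  assert (Heta : 0 < eps / M) by now apply Rdiv_lt_0_compat.
  assert (K1 := Key f A LA d e _ Hd He Heta Hf Hle HA HLA).
  assert (K2 := Key (fun y x => f x y) B LB e d _ He Hd Heta
    ltac:(intros; now apply jointly_continuous_swap, Hf)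
    ltac:(intros x y Hx Hy; rewrite Rmult_assoc, (Rmult_comm (kap e x)), <- Rmult_assoc; now apply Hle)
    HB HLB).
  destruct K1 as (a0 & b0 & c0 & h0 & (Ha0 & Hab0 & Hc0 & Hch0) & K1).
  destruct K2 as (c1 & h1 & a1 & b1 & (Hc1 & Hch1 & Ha1 & Hab1) & K2).
  set (a := Rmin a0 a1 / 2); set (b := Rmax b0 b1 + 1).
  set (c := Rmin c0 c1 / 2); set (h := Rmax h0 h1 + 1).
  assert (Hc : 0 < c /\ c < c0 /\ c < c1).
  { assert (P := Rmin_pos c0 c1 Hc0 Hc1); assert (P1 := Rmin_l c0 c1).
    assert (P2 := Rmin_r c0 c1); unfold c; lra. }
  assert (Hh : h0 < h /\ h1 < h).
  { assert (P1 := Rmax_l h0 h1); assert (P2 := Rmax_r h0 h1); unfold h; lra. }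
  assert (Ha : 0 < a /\ a < a0 /\ a < a1).
  { assert (P := Rmin_pos a0 a1 Ha0 Ha1); assert (P1 := Rmin_l a0 a1).
    assert (P2 := Rmin_r a0 a1); unfold a; lra. }
  assert (Hb : b0 < b /\ b1 < b).
  { assert (P1 := Rmax_l b0 b1); assert (P2 := Rmax_r b0 b1); unfold b; lra. }
  clearbody a b c h.
  specialize (K1 a b c h ltac:(lra) ltac:(lra) ltac:(lra) ltac:(lra)).
  specialize (K2 c h a b ltac:(lra) ltac:(lra) ltac:(lra) ltac:(lra)).
  rewrite (Fubini_rectangle f 0 a b (b + 1) 0 c h (h + 1)) in K1 by
    (try lra; intros; apply Hf; lra).
  apply Rle_trans with (1 := norm_minus_triangle _ (RInt (fun y => RInt (fun x => f x y) a b) c h) _).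
  rewrite (norm_minus_sym LA).
  apply Rle_trans with (1 := Rplus_le_compat _ _ _ _ K1 K2).
  right; set (eta := eps / M).
  replace eps with (M * eta) by (unfold eta; field; lra).
  unfold M; field; lra.
Qed.

(** * Rotation of the path of integration *)

(** [D] is both the angular derivative of [P] and the radial derivative of [F]. Integrating it over
    [[th0, th1] * [a, b]] in both orders leaves [P th1 - P th0] along the rays and [F th b - F th a]
    along the arcs. The limits [F0], [F1] are uniform in the angle and may be nonzero: both uses
    with a nonzero arc at infinity are essential later. *)
Lemma rotation_half_int {W : CompleteNormedModule R_AbsRing} (P D F : R -> R -> W)
    (t0 t1 th0 th1 : R) (I0 I1 F0 F1 : W) :
  t0 < th0 -> th0 <= th1 -> th1 < t1 ->
  (forall th r, t0 < th < t1 -> 0 < r -> is_derive (fun th => P th r) th (D th r)) ->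
  (forall th r, t0 < th < t1 -> 0 < r -> is_derive (F th) r (D th r)) ->
  (forall th r, t0 < th < t1 -> 0 < r -> jointly_continuous D th r) ->
  (forall eps, 0 < eps -> ends (fun a b => forall th, th0 <= th <= th1 ->
     norm (minus (F th a) F0) <= eps /\ norm (minus (F th b) F1) <= eps)) ->
  half_int (P th0) I0 -> half_int (P th1) I1 ->
  minus I1 I0 = scal (th1 - th0) (minus F1 F0).
Proof.
  intros Ht0 Ht Ht1 HP HF HD Hlim HI0 HI1.
  apply minus_eq_0; intros eps Heps.
  (* One [eta] for each truncated ray integral, and one for each arc multiplied by the length of the
     angular interval. *)
  set (M := 2 + 2 * (th1 - th0)).
  assert (HM : 0 < M) by (unfold M; lra).
  assert (Heta : 0 < eps / M) by now apply Rdiv_lt_0_compat.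
  set (eta := eps / M) in *.
  destruct (ends_ex _ (ends_and _ _ (Hlim _ Heta) (ends_and _ _
    (proj1 (half_int_char _ _) HI0 _ Heta) (proj1 (half_int_char _ _) HI1 _ Heta))))
    as (a & b & Ha & Hab & H1 & (y0 & Hy0 & Hn0) & (y1 & Hy1 & Hn1)).
  assert (E1 : minus y1 y0 = RInt (fun r => RInt (fun th => D th r) th0 th1) a b).
  { symmetry; apply is_RInt_unique, (is_RInt_ext (V := W) (fun r => minus (P th1 r) (P th0 r))).
    - rewrite Rmin_left, Rmax_right by lra; intros r Hr.
      symmetry; apply is_RInt_unique.
      apply (is_RInt_derive (V := W) (fun th => P th r));
        rewrite Rmin_left, Rmax_right by lra; intros th Hth.
      + apply HP; lra.
      + apply (jointly_continuous_1 D), HD; lra.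
    - now apply (is_RInt_minus (V := W)). }
  rewrite <- (Fubini_rectangle D t0 th0 th1 t1 0 a b (b + 1)) in E1 by
    (try lra; intros; apply HD; lra).
  assert (Hin : forall th, th0 <= th <= th1 -> RInt (D th) a b = minus (F th b) (F th a)).
  { intros th Hth; apply is_RInt_unique, (is_RInt_derive (V := W) (F th));
      rewrite Rmin_left, Rmax_right by lra; intros r Hr.
    - apply HF; lra.
    - apply (jointly_continuous_2 D), HD; lra. }
  assert (Hc : forall th, th0 <= th <= th1 -> continuous (fun th => RInt (D th) a b) th).
  { intros th Hth; apply (continuous_RInt_param D t0 t1); [lra|lra|].
    intros; apply HD; lra. }
  assert (N : norm (minus (minus y1 y0) (scal (th1 - th0) (minus F1 F0)))
    <= 2 * eta * (th1 - th0)).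
  { rewrite E1, <- RInt_const_V, <- (RInt_minus (V := W)).
    2: { apply ex_RInt_continuous; rewrite Rmin_left, Rmax_right by lra; apply Hc. }
    2: { apply ex_RInt_const. }
    apply RInt_norm_le_const; [lra| |]; intros th Hth.
    - apply (continuous_minus (V := W)); [now apply Hc|apply continuous_const].
    - rewrite Hin by easy; destruct (H1 th Hth) as [A B].
      assert (E : minus (minus (F th b) (F th a)) (minus F1 F0) =
        minus (minus (F th b) F1) (minus (F th a) F0)) by vring.
      apply (norm_le_eq (W := W) _ _ _ E).
      apply Rle_trans with (1 := norm_minus_le (W := W) _ _).
      apply Rle_trans with (1 := Rplus_le_compat _ _ _ _ B A); lra. }
  assert (E : minus (minus I1 I0) (scal (th1 - th0) (minus F1 F0)) =
    minus (minus (minus y1 y0) (scal (th1 - th0) (minus F1 F0)))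
      (minus (minus y1 I1) (minus y0 I0))) by vring.
  apply (norm_le_eq (W := W) _ _ _ E).
  apply Rle_trans with (1 := norm_minus_le (W := W) _ _).
  apply Rle_trans with (1 := Rplus_le_compat _ _ _ _ N (norm_minus_le (W := W) _ _)).
  apply Rle_trans with (2 * eta * (th1 - th0) + (eta + eta)).
  - apply Rplus_le_compat_l, Rplus_le_compat; apply Rlt_le; [exact Hn1|exact Hn0].
  - right; replace eps with (M * eta) by (unfold eta; field; lra); unfold M; ring.
Qed.

(** * Complex-valued functions of a real variable *)

Definition cder (f : R -> C) (x : R) (d : C) : Prop :=
  is_derive (fun t => Re (f t)) x (Re d) /\ is_derive (fun t => Im (f t)) x (Im d).

Definition ccont {U : UniformSpace} (f : U -> C) (x : U) : Prop :=
  continuous (fun t => Re (f t)) x /\ continuous (fun t => Im (f t)) x.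

Definition chalf_int (f : R -> C) (l : C) : Prop :=
  half_int (fun t => Re (f t)) (Re l) /\ half_int (fun t => Im (f t)) (Im l).

(** The logarithmic derivative, stated without division. It is additive over products, so products
    of powers are differentiated without expanding them. *)
Definition logder (f : R -> C) (x : R) (m : C) : Prop := cder f x (m * f x)%C.

Lemma Ceq (z w : C) : Re z = Re w -> Im z = Im w -> z = w.
Proof. destruct z, w; simpl; congruence. Qed.

Lemma is_derive_eq (f : R -> R) (x d d' : R) : is_derive f x d -> d = d' -> is_derive f x d'.
Proof. now intros H <-. Qed.

Lemma cder_mult (f g : R -> C) (x : R) (df dg : C) :
  cder f x df -> cder g x dg -> cder (fun t => f t * g t)%C x (df * g x + f x * dg)%C.
Proof.
  intros [F1 F2] [G1 G2]; split.
  - apply (is_derive_ext (fun t => Re (f t) * Re (g t) - Im (f t) * Im (g t)));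
      [easy|].
    eapply is_derive_eq.
    + apply (is_derive_minus (V := R_NormedModule));
        apply (is_derive_mult (K := R_AbsRing)); try eassumption; exact Rmult_comm.
    + unfold minus, plus, opp, mult; simpl; unfold Re, Im; ring.
  - apply (is_derive_ext (fun t => Re (f t) * Im (g t) + Im (f t) * Re (g t)));
      [easy|].
    eapply is_derive_eq.
    + apply (is_derive_plus (V := R_NormedModule));
        apply (is_derive_mult (K := R_AbsRing)); try eassumption; exact Rmult_comm.
    + unfold minus, plus, opp, mult; simpl; unfold Re, Im; ring.
Qed.

Lemma Cmod_sq (z : C) : Re z ^ 2 + Im z ^ 2 = Cmod z ^ 2.
Proof. unfold Cmod; rewrite pow2_sqrt; [easy|]; nra. Qed.

Lemma norm_sq_pos (z : C) : z <> 0%C -> 0 < Re z ^ 2 + Im z ^ 2.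
Proof. intros H; rewrite Cmod_sq; apply pow_lt; now apply Cmod_gt_0. Qed.

Lemma cder_inv (f : R -> C) (x : R) (df : C) :
  f x <> 0%C -> cder f x df -> cder (fun t => / f t)%C x (- (df / (f x * f x)))%C.
Proof.
  intros Hf [F1 F2]; assert (Hp := norm_sq_pos _ Hf).
  assert (Ex1 : ex_derive (fun t => Re (f t)) x) by now exists (Re df).
  assert (Ex2 : ex_derive (fun t => Im (f t)) x) by now exists (Im df).
  set (u := fun t => Re (f t)) in *; set (v := fun t => Im (f t)) in *.
  assert (D1 : Derive (fun t => u t) x = Re df) by exact (is_derive_unique _ _ _ F1).
  assert (D2 : Derive (fun t => v t) x = Im df) by exact (is_derive_unique _ _ _ F2).
  change (0 < u x ^ 2 + v x ^ 2) in Hp.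
  assert (Hp2 : u x * u x + v x * v x <> 0) by nra.
  assert (E : (- (df / (f x * f x)) = - ((Re df, Im df) / ((u x, v x) * (u x, v x))))%C).
  { unfold u, v; destruct (f x), df; easy. }
  rewrite E; clear E.
  assert (Hne : (u x * u x - v x * v x) ^ 2 + (u x * v x + v x * u x) ^ 2 <> 0).
  { replace ((u x * u x - v x * v x) ^ 2 + (u x * v x + v x * u x) ^ 2)
      with ((u x * u x + v x * v x) ^ 2) by ring.
    now apply pow_nonzero. }
  split.
  - apply (is_derive_ext (fun t => u t / (u t ^ 2 + v t ^ 2))); [easy|].
    auto_derive; [repeat split; try easy; lra|].
    rewrite D1, D2; simpl; field; split; simpl in *; lra.
  - apply (is_derive_ext (fun t => - v t / (u t ^ 2 + v t ^ 2))); [easy|].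
    auto_derive; [repeat split; try easy; lra|].
    rewrite D1, D2; simpl; field; split; simpl in *; lra.
Qed.

Lemma logder_ext (f : R -> C) (x : R) (m m' : C) : m = m' -> logder f x m -> logder f x m'.
Proof. now intros <-. Qed.

Lemma logder_mult (f g : R -> C) (x : R) (m n : C) :
  logder f x m -> logder g x n -> logder (fun t => f t * g t)%C x (m + n)%C.
Proof.
  intros F G; unfold logder.
  replace ((m + n) * (f x * g x))%C with ((m * f x) * g x + f x * (n * g x))%C by ring.
  now apply cder_mult.
Qed.

Lemma logder_inv (f : R -> C) (x : R) (m : C) : f x <> 0%C -> logder f x m -> logder (fun t => / f t)%C x (- m)%C.
Proof.
  intros Hf F; unfold logder.
  replace (- m * / f x)%C with (- ((m * f x) / (f x * f x)))%C by (field; easy).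
  now apply cder_inv.
Qed.

Lemma logder_const (c : C) (x : R) : logder (fun _ => c) x 0%C.
Proof.
  unfold logder; rewrite Cmult_0_l; split;
    exact (is_derive_const (K := R_AbsRing) (V := R_NormedModule) _ x).
Qed.

Lemma logder_pow (f : R -> C) (x : R) (m : C) (n : nat) : logder f x m -> logder (fun t => f t ^ n)%C x (INR n * m)%C.
Proof.
  intros F; induction n as [|n IH].
  - apply (logder_ext _ _ 0%C); [simpl; ring|apply (logder_const 1%C)].
  - apply (logder_ext _ _ (m + INR n * m)%C).
    + rewrite S_INR, RtoC_plus; ring.
    + exact (logder_mult _ _ _ _ _ F IH).
Qed.

Lemma ccont_mult {U : UniformSpace} (f g : U -> C) x :
  ccont f x -> ccont g x -> ccont (fun t => f t * g t)%C x.
Proof.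
  intros [F1 F2] [G1 G2]; split.
  - apply (continuous_minus (V := R_NormedModule) (fun t => Re (f t) * Re (g t)));
      now apply (continuous_mult (K := R_AbsRing)).
  - apply (continuous_plus (V := R_NormedModule) (fun t => Re (f t) * Im (g t)));
      now apply (continuous_mult (K := R_AbsRing)).
Qed.

Lemma ccont_plus {U : UniformSpace} (f g : U -> C) x :
  ccont f x -> ccont g x -> ccont (fun t => f t + g t)%C x.
Proof.
  intros [F1 F2] [G1 G2]; split;
    now apply (continuous_plus (V := R_NormedModule)).
Qed.

Lemma ccont_opp {U : UniformSpace} (f : U -> C) x : ccont f x -> ccont (fun t => - f t)%C x.
Proof.
  intros [F1 F2]; split; now apply (continuous_opp (V := R_NormedModule)).
Qed.

Lemma ccont_const {U : UniformSpace} (c : C) (x : U) : ccont (fun _ => c) x.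
Proof. split; apply continuous_const. Qed.

Lemma ccont_RtoC {U : UniformSpace} (f : U -> R) x :
  continuous f x -> ccont (fun t => RtoC (f t)) x.
Proof. intros H; split; [exact H|apply continuous_const]. Qed.

Lemma ccont_inv {U : UniformSpace} (f : U -> C) x :
  f x <> 0%C -> ccont f x -> ccont (fun t => / f t)%C x.
Proof.
  intros Hf [F1 F2]; assert (Hp := norm_sq_pos _ Hf).
  assert (Hi : continuous (fun t => / (Re (f t) ^ 2 + Im (f t) ^ 2)) x).
  { apply (continuous_comp (fun t => Re (f t) ^ 2 + Im (f t) ^ 2) Rinv).
    - apply (continuous_plus (V := R_NormedModule) (fun t => Re (f t) ^ 2));
        [apply (continuous_mult (K := R_AbsRing) (fun t => Re (f t)))|
         apply (continuous_mult (K := R_AbsRing) (fun t => Im (f t)))]; try easy;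
        apply (continuous_mult (K := R_AbsRing)); try easy; apply continuous_const.
    - apply continuous_Rinv; lra. }
  split.
  - apply (continuous_mult (K := R_AbsRing) (fun t => Re (f t))); easy.
  - apply (continuous_mult (K := R_AbsRing) (fun t => - Im (f t))); [|easy].
    now apply (continuous_opp (V := R_NormedModule)).
Qed.

Lemma ccont_pow {U : UniformSpace} (f : U -> C) x n :
  ccont f x -> ccont (fun t => f t ^ n)%C x.
Proof.
  intros F; induction n as [|n IH]; [exact (ccont_const 1%C x)|].
  exact (ccont_mult _ _ _ F IH).
Qed.

Lemma chalf_int_ext (f g : R -> C) (l : C) : (forall t, 0 < t -> f t = g t) -> chalf_int f l -> chalf_int g l.
Proof.
  intros E [A B]; split; [revert A|revert B]; apply half_int_ext; intros t Ht; now rewrite E.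
Qed.

Lemma chalf_int_scal (f : R -> C) (l c : C) : chalf_int f l -> chalf_int (fun t => c * f t)%C (c * l)%C.
Proof.
  intros [A B]; split.
  - exact (is_RInt_gen_minus (V := R_NormedModule) _ _ _ _
      (is_RInt_gen_scal (V := R_NormedModule) _ (Re c) _ A)
      (is_RInt_gen_scal (V := R_NormedModule) _ (Im c) _ B)).
  - exact (is_RInt_gen_plus (V := R_NormedModule) _ _ _ _
      (is_RInt_gen_scal (V := R_NormedModule) _ (Re c) _ B)
      (is_RInt_gen_scal (V := R_NormedModule) _ (Im c) _ A)).
Qed.

Lemma chalf_int_conj (f : R -> C) (l : C) : chalf_int f l -> chalf_int (fun t => Cconj (f t)) (Cconj l).
Proof.
  intros [A B]; split; [exact A|].
  exact (is_RInt_gen_opp (V := R_NormedModule) _ _ B).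
Qed.

Lemma re_le_Cmod (z : C) : Rabs (Re z) <= Cmod z.
Proof.
  apply Rle_trans with (2 := Rmax_Cmod z), Rmax_l.
Qed.

Lemma im_le_Cmod (z : C) : Rabs (Im z) <= Cmod z.
Proof. apply Rle_trans with (2 := Rmax_Cmod z), Rmax_r. Qed.

Lemma chalf_int_exists (f : R -> C) (K a b : R) :
  0 < a < b ->
  (forall t, 0 < t -> ccont f t) ->
  (forall t, 0 < t -> Cmod (f t) <= K * (Rpower t (a - 1) * Rpower (1 + t) (- b))) ->
  exists l, chalf_int f l.
Proof.
  intros Hab Hf Hle.
  destruct (half_int_pos (W := R_CompleteNormedModule) (fun t => Re (f t)) K a b Hab)
    as [l1 [H1 _]].
  - intros t Ht; exact (proj1 (Hf t Ht)).
  - intros t Ht; apply Rle_trans with (2 := Hle t Ht), re_le_Cmod.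
  - destruct (half_int_pos (W := R_CompleteNormedModule) (fun t => Im (f t)) K a b Hab)
      as [l2 [H2 _]].
    + intros t Ht; exact (proj2 (Hf t Ht)).
    + intros t Ht; apply Rle_trans with (2 := Hle t Ht), im_le_Cmod.
    + now exists (l1, l2).
Qed.

(** * Power functions and their integrals along rays *)

Definition cis (x : R) : C := (cos x, sin x).
Definition ray (th r : R) : C := (r * cos th, r * sin th).

(** [ray_fun e a p l t th r] is [r^(e-a) s^a (s+t)^(-p) (s+1)^(-l)] at [s = r e^(i th)];
    the two exponents allow to switch between [f(s)] and [s f(s)]. *)
Definition ray_fun (e a : R) (p l : nat) (t th r : R) : C :=
  (RtoC (Rpower r e) * cis (a * th) * (/ ((ray th r + RtoC t) ^ p) * / ((ray th r + 1) ^ l)))%C.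

(** This is [s f'(s) / f(s)] for [f(s) = s^a (s+t)^(-p) (s+1)^(-l)]. Multiplied by [i] it is the
    angular logarithmic derivative, divided by [r] the radial one: the Cauchy-Riemann equation in
    polar coordinates. *)
Definition ray_logder (a : R) (p l : nat) (t th r : R) : C :=
  (RtoC a - INR p * (ray th r / (ray th r + RtoC t)) - INR l * (ray th r / (ray th r + 1)))%C.

Lemma Cmod_ray_plus (th r t : R) : Cmod (ray th r + RtoC t) ^ 2 =
  r ^ 2 + 2 * r * t * cos th + t ^ 2.
Proof.
  rewrite <- Cmod_sq; simpl; assert (H := sin2_cos2 th); unfold Rsqr in H; nra.
Qed.

(** Since [r^2 + 2 r t c + t^2 - (1+c)/2 (r+t)^2 = (1-c)/2 (r-t)^2 >= 0]. For [c = cos th] the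
    constant is [|cos (th/2)|]; a smaller [c] makes the bound uniform over a sector. *)
Lemma Cmod_ray_plus_ge (c th r t : R) : 0 <= r -> 0 <= t -> -1 <= c <= cos th ->
  sqrt ((1 + c) / 2) * (r + t) <= Cmod (ray th r + RtoC t).
Proof.
  intros Hr Ht Hc; assert (Hc2 := COS_bound th).
  apply Rsqr_incr_0_var; [rewrite !Rsqr_pow2|apply Cmod_ge_0].
  rewrite Cmod_ray_plus, Rpow_mult_distr, pow2_sqrt by lra.
  assert (0 <= (r - t) ^ 2 * (1 - c)) by (apply Rmult_le_pos; [apply pow2_ge_0|lra]).
  assert (0 <= r * t * (cos th - c)) by (apply Rmult_le_pos; [now apply Rmult_le_pos|lra]).
  nra.
Qed.

Lemma cos_gt_m1 th : - PI < th < PI -> -1 < cos th.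
Proof.
  intros H; assert (Hp := PI_RGT_0); rewrite <- cos_PI.
  unfold Rabs; destruct (Rle_lt_dec 0 th).
  - apply cos_decreasing_1; lra.
  - rewrite <- (cos_neg th); apply cos_decreasing_1; lra.
Qed.

Lemma ray_plus_neq_0 th r t : - PI < th < PI -> 0 < r -> 0 < t -> (ray th r + RtoC t)%C <> 0%C.
Proof.
  intros Hth Hr Ht E.
  assert (H := Cmod_ray_plus_ge (cos th) th r t ltac:(lra) ltac:(lra)
    ltac:(assert (A := COS_bound th); lra)).
  rewrite E, Cmod_0 in H.
  assert (P := cos_gt_m1 th Hth).
  assert (P2 : 0 < sqrt ((1 + cos th) / 2)) by (apply sqrt_lt_R0; lra).
  nra.
Qed.

Lemma cder_eq (f : R -> C) x d d' : cder f x d -> d = d' -> cder f x d'.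
Proof. now intros H <-. Qed.

Lemma logder_ray_plus_angle th r t : (ray th r + RtoC t)%C <> 0%C ->
  logder (fun th => ray th r + RtoC t)%C th (Ci * (ray th r / (ray th r + RtoC t)))%C.
Proof.
  intros H; unfold logder.
  apply (cder_eq _ _ (Ci * ray th r)%C); [|field; easy].
  split; simpl; auto_derive; try easy; ring.
Qed.

Lemma logder_ray_plus_radius th r t : (ray th r + RtoC t)%C <> 0%C -> 0 < r ->
  logder (fun r => ray th r + RtoC t)%C r (/ RtoC r * (ray th r / (ray th r + RtoC t)))%C.
Proof.
  intros H Hr; unfold logder.
  assert (Hr' : RtoC r <> 0%C) by (intros E; apply RtoC_inj in E; lra).
  apply (cder_eq _ _ (/ RtoC r * ray th r)%C); [|field; easy].
  replace (/ RtoC r * ray th r)%C with (cis th).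
  - split; simpl; auto_derive; try easy; ring.
  - rewrite <- RtoC_inv by lra; apply Ceq; simpl; field; lra.
Qed.

Lemma logder_cis a th : logder (fun th => cis (a * th)) th (Ci * RtoC a)%C.
Proof. split; simpl; auto_derive; try easy; ring. Qed.

Lemma logder_Rpower e r : 0 < r -> logder (fun r => RtoC (Rpower r e)) r (/ RtoC r * RtoC e)%C.
Proof.
  intros Hr; unfold logder; rewrite <- RtoC_inv by lra; split; simpl.
  - eapply is_derive_eq; [now apply is_derive_Rpower|].
    unfold Rminus; rewrite Rpower_plus, Rpower_Ropp, Rpower_1 by easy; ring.
  - eapply is_derive_eq;
      [exact (is_derive_const (K := R_AbsRing) (V := R_NormedModule) 0 r)|].
    change (zero : R) with 0; ring.
Qed.

Lemma logder_ray_fun_angle e a p l t th r : - PI < th < PI -> 0 < r -> 0 < t ->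
  logder (fun th => ray_fun e a p l t th r) th (Ci * ray_logder a p l t th r)%C.
Proof.
  intros Hth Hr Ht.
  assert (N1 := ray_plus_neq_0 th r t Hth Hr Ht).
  assert (N2 := ray_plus_neq_0 th r 1 Hth Hr Rlt_0_1).
  eapply logder_ext; cycle 1.
  - unfold ray_fun; apply logder_mult; [apply logder_mult|apply logder_mult].
    + apply logder_const.
    + apply logder_cis.
    + apply logder_inv; [now apply Cpow_nz|now apply logder_pow, logder_ray_plus_angle].
    + apply logder_inv; [now apply Cpow_nz|].
      now apply logder_pow, logder_ray_plus_angle.
  - unfold ray_logder; ring.
Qed.

Lemma logder_ray_fun_radius e a p l t th r : - PI < th < PI -> 0 < r -> 0 < t ->
  logder (fun r => ray_fun e a p l t th r) r (/ RtoC r * ray_logder e p l t th r)%C.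
Proof.
  intros Hth Hr Ht.
  assert (N1 := ray_plus_neq_0 th r t Hth Hr Ht).
  assert (N2 := ray_plus_neq_0 th r 1 Hth Hr Rlt_0_1).
  eapply logder_ext; cycle 1.
  - unfold ray_fun; apply logder_mult; [apply logder_mult|apply logder_mult].
    + now apply logder_Rpower.
    + apply logder_const.
    + apply logder_inv; [now apply Cpow_nz|now apply logder_pow, logder_ray_plus_radius].
    + apply logder_inv; [now apply Cpow_nz|].
      now apply logder_pow, logder_ray_plus_radius.
  - unfold ray_logder; ring.
Qed.

Lemma continuous_comp_fst (f : R -> R) (x : R * R) :
  continuous f (fst x) -> continuous (fun q : R * R => f (fst q)) x.
Proof. intros H; apply (continuous_comp fst f); [apply continuous_fst|easy]. Qed.

Lemma continuous_comp_snd (f : R -> R) (x : R * R) :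
  continuous f (snd x) -> continuous (fun q : R * R => f (snd q)) x.
Proof. intros H; apply (continuous_comp snd f); [apply continuous_snd|easy]. Qed.

Lemma ccont_ray (x : R * R) : ccont (fun q : R * R => ray (fst q) (snd q)) x.
Proof.
  split; apply (continuous_mult (K := R_AbsRing) (fun q : R * R => snd q));
    try apply continuous_snd; apply continuous_comp_fst.
  - apply continuous_cos.
  - apply continuous_sin.
Qed.

Lemma ccont_ray_fun e a p l t th r : - PI < th < PI -> 0 < r -> 0 < t ->
  ccont (fun q : R * R => ray_fun e a p l t (fst q) (snd q)) (th, r).
Proof.
  intros Hth Hr Ht.
  assert (N1 := ray_plus_neq_0 th r t Hth Hr Ht).
  assert (N2 := ray_plus_neq_0 th r 1 Hth Hr Rlt_0_1).
  unfold ray_fun; apply ccont_mult; apply ccont_mult.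
  - apply ccont_RtoC, (continuous_comp_snd (fun r => Rpower r e)); now apply continuous_Rpower.
  - split; [apply (continuous_comp_fst (fun x => cos (a * x)))|apply (continuous_comp_fst (fun x => sin (a * x)))];
      apply (ex_derive_continuous (V := R_NormedModule)); auto_derive; easy.
  - apply ccont_inv; [now apply Cpow_nz|].
    apply ccont_pow, ccont_plus; [apply ccont_ray|apply ccont_const].
  - apply ccont_inv; [now apply Cpow_nz|].
    apply ccont_pow, ccont_plus; [apply ccont_ray|apply ccont_const].
Qed.

Lemma ccont_ray_logder a p l t th r : - PI < th < PI -> 0 < r -> 0 < t ->
  ccont (fun q : R * R => ray_logder a p l t (fst q) (snd q)) (th, r).
Proof.
  intros Hth Hr Ht.
  assert (N1 := ray_plus_neq_0 th r t Hth Hr Ht).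
  assert (N2 := ray_plus_neq_0 th r 1 Hth Hr Rlt_0_1).
  assert (H : forall u, (ray th r + RtoC u)%C <> 0%C ->
    ccont (fun q : R * R => ray (fst q) (snd q) / (ray (fst q) (snd q) + RtoC u))%C (th, r)).
  { intros u Hu; apply ccont_mult; [apply ccont_ray|apply ccont_inv; [easy|]].
    apply ccont_plus; [apply ccont_ray|apply ccont_const]. }
  unfold ray_logder; apply ccont_plus; [apply ccont_plus|].
  - apply ccont_const.
  - apply ccont_opp, ccont_mult; [apply ccont_const|now apply H].
  - apply ccont_opp, ccont_mult; [apply ccont_const|now apply H].
Qed.

Lemma ray_fun_shift a p l t th r : 0 < r ->
  ray_fun a a p l t th r = (RtoC r * ray_fun (a - 1) a p l t th r)%C.
Proof.
  intros Hr; unfold ray_fun.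
  replace (Rpower r a) with (r * Rpower r (a - 1)).
  - rewrite RtoC_mult; ring.
  - rewrite <- (Rpower_1 r) at 1 by easy; rewrite <- Rpower_plus; f_equal; ring.
Qed.

Lemma Cmod_inv_le (z : C) x : 0 < x -> x <= Cmod z -> Cmod (/ z) <= / x.
Proof.
  intros Hx H; rewrite Cmod_inv; [now apply Rinv_le_contravar|].
  intros ->; rewrite Cmod_0 in H; lra.
Qed.

Lemma Cmod_pow_inv_le (z : C) x n : 0 < x -> x <= Cmod z -> Cmod (/ z ^ n) <= / x ^ n.
Proof.
  intros Hx H; apply Cmod_inv_le; [now apply pow_lt|].
  rewrite Cmod_pow; now apply pow_incr; split; [apply Rlt_le|].
Qed.

Lemma Cmod_cis x : Cmod (cis x) = 1.
Proof.
  transitivity (sqrt 1); [unfold Cmod; f_equal; simpl|apply sqrt_1].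
  assert (H := sin2_cos2 x); unfold Rsqr in H; lra.
Qed.

Lemma pow_inv_Rpower x n : 0 < x -> / x ^ n = Rpower x (- INR n).
Proof. intros Hx; rewrite Rpower_Ropp, Rpower_pow; easy. Qed.

Lemma Cmod_ray_fun_le e a p l t c : 0 < t -> -1 < c <= 1 -> exists K, 0 < K /\
  forall th r, 0 < r -> c <= cos th ->
    Cmod (ray_fun e a p l t th r) <= K * (Rpower r e * Rpower (1 + r) (- INR (p + l))).
Proof.
  intros Ht Hc; set (k := sqrt ((1 + c) / 2)).
  assert (Hk : 0 < k) by (apply sqrt_lt_R0; lra).
  (* [r + t >= m (1 + r)] replaces the pole at [- t] by the one at [-1], so that both factors are
     measured by powers of [1 + r]. *)
  set (m := Rmin 1 t); assert (Hm : 0 < m) by (apply Rmin_pos; lra).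
  assert (Hm1 : m <= 1) by apply Rmin_l; assert (Hm2 : m <= t) by apply Rmin_r.
  assert (Hkm : 0 < k * m) by now apply Rmult_lt_0_compat.
  exists (/ (k * m) ^ p * / k ^ l); split.
  { apply Rmult_lt_0_compat; apply Rinv_0_lt_compat; now apply pow_lt. }
  intros th r Hr Hth; unfold ray_fun.
  rewrite !Cmod_mult, Cmod_cis, Cmod_R, Rabs_pos_eq, Rmult_1_r by apply Rlt_le, Rpower_pos.
  replace (/ (k * m) ^ p * / k ^ l * (Rpower r e * Rpower (1 + r) (- INR (p + l)))) with
    (Rpower r e * (/ ((k * m) * (1 + r)) ^ p * / (k * (1 + r)) ^ l)).
  2: { rewrite plus_INR, Ropp_plus_distr, Rpower_plus, <- !pow_inv_Rpower by lra.
       rewrite !Rpow_mult_distr, !Rinv_mult; ring. }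
  apply Rmult_le_compat_l; [apply Rlt_le, Rpower_pos|].
  assert (G1 := Cmod_ray_plus_ge c th r t ltac:(lra) ltac:(lra) ltac:(lra)).
  assert (G2 := Cmod_ray_plus_ge c th r 1 ltac:(lra) ltac:(lra) ltac:(lra)).
  fold k in G1, G2.
  apply Rmult_le_compat; try apply Cmod_ge_0; apply Cmod_pow_inv_le.
  - nra.
  - apply Rle_trans with (2 := G1); rewrite Rmult_assoc.
    apply Rmult_le_compat_l; [lra|]; nra.
  - nra.
  - lra.
Qed.

(** Up to [d^2], [r kap d r] is the product of the two tails of [kap d], so it is small at both
    ends. This turns integrability bounds into bounds on arcs. *)
Lemma mult_kap d r : 0 < d -> 0 < r ->
  r * kap d r = d ^ 2 * (kap_prim d r + / d) * (- kap_prim d r).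
Proof.
  intros Hd Hr; unfold kap, kap_prim, Rminus.
  rewrite Rpower_plus, Rpower_Ropp, Rpower_1 by easy.
  assert (H := Rpower_pos r d); field; repeat split; lra.
Qed.

Lemma ends_bound_small (f : R -> R -> C) (Q : R -> Prop) K a b :
  0 < a < b -> 0 < K ->
  (forall th r, 0 < r -> Q th -> Cmod (f th r) <= K * (Rpower r a * Rpower (1 + r) (- b))) ->
  forall eps, 0 < eps -> ends (fun x y => forall th, Q th ->
    Cmod (f th x) <= eps /\ Cmod (f th y) <= eps).
Proof.
  intros Hab HK Hle eps He.
  set (d := Rmin a (b - a)); assert (Hd : 0 < d) by (apply Rmin_pos; lra).
  (* At either end one tail is below this number and the other below [1 / d]; multiplied by
     [4 K d^2] the product is at most [eps]. *)
  assert (He' : 0 < eps / (4 * K * d)) by (apply Rdiv_lt_0_compat; [easy|nra]).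
  generalize (kap_tails d _ Hd He'); apply ends_imp; intros x y Hx Hxy [T1 T2] th Hth.
  assert (B : forall r, 0 < r -> Cmod (f th r) <=
    4 * K * (d ^ 2 * (kap_prim d r + / d) * (- kap_prim d r))).
  { intros r Hr; apply Rle_trans with (1 := Hle th r Hr Hth).
    rewrite <- mult_kap by easy.
    replace (Rpower r a) with (r * Rpower r (a - 1)).
    - assert (H := kap_dominates a b r Hr Hab).
      replace (K * (r * Rpower r (a - 1) * Rpower (1 + r) (- b))) with
        (K * r * (Rpower r (a - 1) * Rpower (1 + r) (- b))) by ring.
      replace (4 * K * (r * kap d r)) with (K * r * (4 * kap d r)) by ring.
      apply Rmult_le_compat_l; [nra|easy].
    - rewrite <- (Rpower_1 r) at 1 by easy; rewrite <- Rpower_plus; f_equal; ring. }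
  assert (Hdi := Rinv_0_lt_compat _ Hd).
  set (e := eps / (4 * K * d)) in *.
  assert (E : eps = 4 * K * (d ^ 2 * (e * / d))) by (unfold e; field; lra).
  clearbody e.
  assert (Hy : 0 < y) by lra.
  assert (Bx := kap_prim_bounds d x Hd); assert (By := kap_prim_bounds d y Hd).
  assert (N : forall u v, 0 <= u -> 0 <= v -> u * v <= e * / d ->
    4 * K * (d ^ 2 * u * v) <= eps).
  { intros u v Hu Hv Huv; rewrite E, (Rmult_assoc (d ^ 2)).
    apply Rmult_le_compat_l; [nra|]; apply Rmult_le_compat_l; [nra|easy]. }
  split; [apply Rle_trans with (1 := B x Hx)|apply Rle_trans with (1 := B y Hy)];
    apply N; try lra.
  - apply Rmult_le_compat; lra.
  - rewrite Rmult_comm; apply Rmult_le_compat; lra.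
Qed.

Ltac real_eq := match goal with |- @eq _ ?a ?b => change (@eq R a b) end.

Lemma ccont_curry_2 (f : R -> R -> C) x y :
  ccont (fun q : R * R => f (fst q) (snd q)) (x, y) -> ccont (f x) y.
Proof.
  intros [A B]; split; [exact (jointly_continuous_2 (fun x y => Re (f x y)) x y A)|
    exact (jointly_continuous_2 (fun x y => Im (f x y)) x y B)].
Qed.

(** * Integrals of a power times a rational function along different rays *)

Lemma ray_fun_radius_0 e a p l t r : 0 < r -> 0 < t ->
  ray_fun e a p l t 0 r = RtoC (Rpower r e * (/ (r + t) ^ p * / (r + 1) ^ l)).
Proof.
  intros Hr Ht; unfold ray_fun.
  assert (E : forall u, (ray 0 r + RtoC u)%C = RtoC (r + u)).
  { intros u; apply Ceq; simpl; rewrite ?cos_0, ?sin_0; ring. }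
  assert (Ec : cis (a * 0) = RtoC 1).
  { apply Ceq; simpl; rewrite Rmult_0_r, ?cos_0, ?sin_0; ring. }
  assert (H : forall u n, 0 < u -> (/ RtoC (r + u) ^ n)%C = RtoC (/ (r + u) ^ n)).
  { intros u n Hu; rewrite RtoC_inv, RtoC_pow; [easy|apply pow_nonzero; lra]. }
  rewrite !E, Ec, !H, <- !RtoC_mult by lra; f_equal; ring.
Qed.

Lemma sector_cos th0 th : 0 <= th0 < PI -> 0 <= th <= th0 -> cos th0 <= cos th.
Proof. intros H1 H2; apply cos_decr_1; lra. Qed.

(** Rotation of the real part: because [Re (i z) = - Im z], the conjugate function [- Im] supplies
    the arc terms. *)
Lemma ray_rotation_Re a p l t th (I0 I1 F0 F1 : R) : 0 < t -> 0 <= th < PI ->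
  (forall eps, 0 < eps -> ends (fun x y => forall th', 0 <= th' <= th ->
     Rabs (- Im (ray_fun a a p l t th' x) - F0) <= eps /\
     Rabs (- Im (ray_fun a a p l t th' y) - F1) <= eps)) ->
  half_int (fun r => Re (ray_fun (a - 1) a p l t 0 r)) I0 ->
  half_int (fun r => Re (ray_fun (a - 1) a p l t th r)) I1 ->
  I1 - I0 = th * (F1 - F0).
Proof.
  intros Ht Hth Hlim H0 H1; assert (Hpi := PI_RGT_0).
  replace (th * (F1 - F0)) with ((th - 0) * (F1 - F0)) by ring.
  apply (rotation_half_int (W := R_CompleteNormedModule)
    (fun th r => Re (ray_fun (a - 1) a p l t th r))
    (fun th r => Re (Ci * (ray_logder a p l t th r * ray_fun (a - 1) a p l t th r))%C)
    (fun th r => - Im (ray_fun a a p l t th r)) (- PI) PI 0 th I0 I1 F0 F1); try easy; try lra.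
  - intros th' r Hth' Hr.
    eapply is_derive_eq; [exact (proj1 (logder_ray_fun_angle (a - 1) a p l t th' r Hth' Hr Ht))|].
    rewrite Cmult_assoc; reflexivity.
  - intros th' r Hth' Hr.
    eapply is_derive_eq.
    { exact (is_derive_opp (V := R_NormedModule) _ _ _
        (proj2 (logder_ray_fun_radius a a p l t th' r Hth' Hr Ht))). }
    cbv beta; rewrite ray_fun_shift by easy.
    replace (/ RtoC r * ray_logder a p l t th' r *
      (RtoC r * ray_fun (a - 1) a p l t th' r))%C
      with (ray_logder a p l t th' r * ray_fun (a - 1) a p l t th' r)%C.
    + simpl; change (opp : R -> R) with Ropp; ring.
    + field; intros E; apply RtoC_inj in E; lra.
  - intros th' r Hth' Hr.
    refine (proj1 (ccont_mult (fun _ => Ci) (fun q : R * R => ray_logder a p l t (fst q) (snd q) *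
      ray_fun (a - 1) a p l t (fst q) (snd q))%C (th', r) (ccont_const _ _) _)).
    apply ccont_mult; [now apply ccont_ray_logder|now apply ccont_ray_fun].
Qed.

(** Kept separate from the real part, and with free arc limits, for the borderline integrand
    [1/(s+1)], where only the imaginary part converges and the arc at infinity contributes. *)
Lemma ray_rotation_Im a p l t th (I0 I1 F0 F1 : R) : 0 < t -> 0 <= th < PI ->
  (forall eps, 0 < eps -> ends (fun x y => forall th', 0 <= th' <= th ->
     Rabs (Re (ray_fun a a p l t th' x) - F0) <= eps /\
     Rabs (Re (ray_fun a a p l t th' y) - F1) <= eps)) ->
  half_int (fun r => Im (ray_fun (a - 1) a p l t 0 r)) I0 ->
  half_int (fun r => Im (ray_fun (a - 1) a p l t th r)) I1 ->
  I1 - I0 = th * (F1 - F0).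
Proof.
  intros Ht Hth Hlim H0 H1; assert (Hpi := PI_RGT_0).
  replace (th * (F1 - F0)) with ((th - 0) * (F1 - F0)) by ring.
  apply (rotation_half_int (W := R_CompleteNormedModule)
    (fun th r => Im (ray_fun (a - 1) a p l t th r))
    (fun th r => Im (Ci * (ray_logder a p l t th r * ray_fun (a - 1) a p l t th r))%C)
    (fun th r => Re (ray_fun a a p l t th r)) (- PI) PI 0 th I0 I1 F0 F1); try easy; try lra.
  - intros th' r Hth' Hr.
    eapply is_derive_eq; [exact (proj2 (logder_ray_fun_angle (a - 1) a p l t th' r Hth' Hr Ht))|].
    rewrite Cmult_assoc; reflexivity.
  - intros th' r Hth' Hr.
    eapply is_derive_eq.
    { exact (proj1 (logder_ray_fun_radius a a p l t th' r Hth' Hr Ht)). }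
    cbv beta; rewrite ray_fun_shift by easy.
    replace (/ RtoC r * ray_logder a p l t th' r *
      (RtoC r * ray_fun (a - 1) a p l t th' r))%C
      with (ray_logder a p l t th' r * ray_fun (a - 1) a p l t th' r)%C.
    + simpl; ring.
    + field; intros E; apply RtoC_inj in E; lra.
  - intros th' r Hth' Hr.
    refine (proj2 (ccont_mult (fun _ => Ci) (fun q : R * R => ray_logder a p l t (fst q) (snd q) *
      ray_fun (a - 1) a p l t (fst q) (snd q))%C (th', r) (ccont_const _ _) _)).
    apply ccont_mult; [now apply ccont_ray_logder|now apply ccont_ray_fun].
Qed.

Lemma ray_fun_integrable a p l t th : 0 < t -> 0 <= th < PI -> 0 < a < INR (p + l) ->
  exists I, chalf_int (ray_fun (a - 1) a p l t th) I.
Proof.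
  intros Ht Hth Ha; assert (Hpi := PI_RGT_0).
  assert (Hc := cos_gt_m1 th ltac:(lra)); assert (Hc2 := COS_bound th).
  destruct (Cmod_ray_fun_le (a - 1) a p l t (cos th) Ht ltac:(lra)) as (K & HK & Hle).
  apply (chalf_int_exists _ K a (INR (p + l)) Ha).
  - intros r Hr; apply ccont_curry_2, ccont_ray_fun; lra.
  - intros r Hr; apply Hle; [easy|lra].
Qed.

(** Under [0 < a < p + l] the product of [s] and the integrand tends to [0] on both arcs, uniformly
    in the sector, so no boundary term survives. *)
Lemma ray_fun_rotation a p l t th I : 0 < t -> 0 <= th < PI -> 0 < a < INR (p + l) ->
  chalf_int (ray_fun (a - 1) a p l t 0) I -> chalf_int (ray_fun (a - 1) a p l t th) I.
Proof.
  intros Ht Hth Ha HI; assert (Hpi := PI_RGT_0).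
  destruct (ray_fun_integrable a p l t th Ht Hth Ha) as [I1 HI1].
  assert (Hc := cos_gt_m1 th ltac:(lra)); assert (Hc2 := COS_bound th).
  destruct (Cmod_ray_fun_le a a p l t (cos th) Ht ltac:(lra)) as (K & HK & Hle).
  assert (Hs : forall eps, 0 < eps -> ends (fun x y => forall th', 0 <= th' <= th ->
    Cmod (ray_fun a a p l t th' x) <= eps /\ Cmod (ray_fun a a p l t th' y) <= eps)).
  { apply (ends_bound_small _ (fun th' => 0 <= th' <= th) K a (INR (p + l)) Ha HK).
    intros th' r Hr Hth'; apply Hle; [easy|now apply sector_cos]. }
  replace I with I1; [easy|apply Ceq].
  - apply Rminus_diag_uniq; transitivity (th * (0 - 0)); [|ring].
    apply (ray_rotation_Re a p l t th (Re I) (Re I1) 0 0 Ht Hth); [|apply HI|apply HI1].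
    intros eps He; generalize (Hs eps He); apply ends_imp; intros x y _ _ H th' Hth'.
    rewrite !Rminus_0_r, !Rabs_Ropp; destruct (H th' Hth') as [A B].
    split; eapply Rle_trans; try apply im_le_Cmod; easy.
  - apply Rminus_diag_uniq; transitivity (th * (0 - 0)); [|ring].
    apply (ray_rotation_Im a p l t th (Im I) (Im I1) 0 0 Ht Hth); [|apply HI|apply HI1].
    intros eps He; generalize (Hs eps He); apply ends_imp; intros x y _ _ H th' Hth'.
    rewrite !Rminus_0_r; destruct (H th' Hth') as [A B].
    split; eapply Rle_trans; try apply re_le_Cmod; easy.
Qed.

Lemma half_int_zero {W : CompleteNormedModule R_AbsRing} :
  half_int (fun _ : R => zero : W) zero.
Proof.
  apply half_int_char; intros eps He; apply ends_char; exists 1, 1.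
  repeat split; try lra; intros a b Ha Ha1 Hb; exists zero; split.
  - assert (E : scal (b - a) (zero : W) = zero) by vring.
    exact (eq_rect _ (is_RInt (fun _ => zero : W) a b) (is_RInt_const a b (zero : W)) _ E).
  - assert (E : minus (zero : W) zero = zero) by vring.
    apply Rle_lt_trans with 0; [apply (norm_le_eq (W := W) _ _ _ E)|easy].
    right; apply (norm_zero (V := W)).
Qed.

(** On the positive half-line the integrand is real; turning the ray does not change the
    integral. *)
Lemma ray_fun_Im_integral a p l t th : 0 < t -> 0 <= th < PI -> 0 < a < INR (p + l) ->
  half_int (fun r => Im (ray_fun (a - 1) a p l t th r)) 0.
Proof.
  intros Ht Hth Ha; assert (Hpi := PI_RGT_0).
  destruct (ray_fun_integrable a p l t 0 Ht ltac:(lra) Ha) as [I HI].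
  assert (E : Im I = 0).
  { apply (half_int_unique (W := R_CompleteNormedModule)
      (fun r => Im (ray_fun (a - 1) a p l t 0 r))); [apply HI|].
    apply (half_int_ext (W := R_NormedModule) (fun _ => 0)).
    - intros r Hr; now rewrite ray_fun_radius_0.
    - exact (half_int_zero (W := R_CompleteNormedModule)). }
  assert (H := proj2 (ray_fun_rotation a p l t th I Ht Hth Ha HI)).
  rewrite E in H; exact H.
Qed.

Lemma half_int_scale {W : NormedModule R_AbsRing} (f : R -> W) (l : W) (c : R) :
  0 < c -> half_int f l -> half_int (fun t => scal c (f (c * t))) l.
Proof.
  intros Hc H; apply half_int_char; intros eps He.
  assert (H1 := proj1 (half_int_char f l) H eps He); apply ends_char in H1; apply ends_char.
  destruct H1 as (a0 & b0 & Ha0 & Hab & H1).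
  exists (a0 / c), (b0 / c); repeat split.
  - now apply Rdiv_lt_0_compat.
  - apply Rmult_le_compat_r; [now apply Rlt_le, Rinv_0_lt_compat|easy].
  - intros a b Ha Ha1 Hb.
    assert (Ea : a0 = c * (a0 / c)) by (field; lra).
    assert (Eb : b0 = c * (b0 / c)) by (field; lra).
    destruct (H1 (c * a) (c * b)) as (y & Hy & Hy'); [nra|rewrite Ea; nra|rewrite Eb; nra|].
    exists y; split; [|easy].
    apply (is_RInt_ext (fun t => scal c (f (c * t + 0)))).
    + intros; now rewrite Rplus_0_r.
    + apply is_RInt_comp_lin; now rewrite !Rplus_0_r.
Qed.

(** [int_0^oo t^(a-1) (s/(t+s))^m dt = K s^a] on the ray of argument [th]. *)
Lemma Stieltjes_power (a : R) (m : nat) (th r K : R) : 0 < a < INR m -> 0 <= th < PI -> 0 < r ->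
  half_int (fun t => Rpower t (a - 1) * / (t + 1) ^ m) K ->
  chalf_int (fun t => RtoC (Rpower t (a - 1)) * (ray th r / (ray th r + RtoC t)) ^ m)%C
    (RtoC K * (RtoC (Rpower r a) * cis (a * th)))%C.
Proof.
  intros Ha Hth Hr HK; assert (Hpi := PI_RGT_0).
  assert (H0 : chalf_int (ray_fun (a - 1) a m 0 1 0) (RtoC K)).
  { apply (chalf_int_ext (fun t => RtoC (Rpower t (a - 1) * / (t + 1) ^ m))).
    - intros t Ht; rewrite ray_fun_radius_0 by lra; f_equal; simpl; field.
      apply pow_nonzero; lra.
    - split; [exact HK|exact (half_int_zero (W := R_CompleteNormedModule))]. }
  apply (ray_fun_rotation a m 0 1 th) in H0; try easy; try lra.
  2: now rewrite Nat.add_0_r.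
  (* The ray integral runs over [1 + u e^(i th)], while here [s] is fixed and [t] varies. With
     [u = t / r] the conjugate of [1 + u e^(i th)] is [(s + t) / s], so conjugation, multiplication
     by [s^a] and the rescaling [u = t / r] give the claim. *)
  apply chalf_int_conj in H0.
  apply (chalf_int_scal _ _ (RtoC (Rpower r a) * cis (a * th))%C) in H0.
  replace (RtoC K * (RtoC (Rpower r a) * cis (a * th)))%C with
    (RtoC (Rpower r a) * cis (a * th) * Cconj (RtoC K))%C.
  2: { replace (Cconj (RtoC K)) with (RtoC K) by (apply Ceq; simpl; ring); ring. }
  assert (H1 : forall f l, chalf_int f l -> chalf_int (fun t => RtoC (/ r) * f (/ r * t)%R)%C l).
  { assert (Hi := Rinv_0_lt_compat _ Hr).
    intros f l [A B]; split.
    - apply (half_int_ext (W := R_NormedModule) (fun t => scal (/ r) (Re (f (/ r * t))))).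
      + intros t _; unfold scal, mult; simpl; unfold Re, Im, mult; simpl; real_eq; ring.
      + now apply (half_int_scale (W := R_NormedModule) (fun t => Re (f t))).
    - apply (half_int_ext (W := R_NormedModule) (fun t => scal (/ r) (Im (f (/ r * t))))).
      + intros t _; unfold scal, mult; simpl; unfold Re, Im, mult; simpl; real_eq; ring.
      + now apply (half_int_scale (W := R_NormedModule) (fun t => Im (f t))). }
  apply H1 in H0; clear H1.
  revert H0; apply chalf_int_ext; intros t Ht.
  assert (Hrt : 0 < / r * t) by (apply Rmult_lt_0_compat; [now apply Rinv_0_lt_compat|easy]).
  assert (N1 := ray_plus_neq_0 th (/ r * t) 1 ltac:(lra) Hrt Rlt_0_1).
  assert (N2 := ray_plus_neq_0 th r t ltac:(lra) Hr Ht).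
  assert (Hcc : (cis (a * th) * Cconj (cis (a * th)) = 1)%C).
  { assert (H := sin2_cos2 (a * th)); unfold Rsqr in H.
    apply Ceq; simpl; lra. }
  assert (Hray : ray th r <> 0%C).
  { intros E; apply (f_equal Cmod) in E; rewrite Cmod_0 in E.
    replace (ray th r) with (RtoC r * cis th)%C in E by (apply Ceq; simpl; ring).
    rewrite Cmod_mult, Cmod_cis, Cmod_R, Rabs_pos_eq in E by lra; lra. }
  assert (E : Cconj (ray th (/ r * t) + 1)%C = ((ray th r + RtoC t) / ray th r)%C).
  { replace (Cconj (ray th (/ r * t) + 1)%C) with
      ((Cconj (ray th (/ r * t) + 1)%C * ray th r) / ray th r)%C by (field; easy).
    f_equal; assert (H := sin2_cos2 th); unfold Rsqr in H.
    apply Ceq; simpl.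
    - replace (cos th * cos th) with (1 - sin th * sin th) by lra.
      transitivity (r * cos th + (/ r * r) * t * (sin th * sin th + cos th * cos th)); [ring|].
      rewrite H, Rinv_l by lra; ring.
    - ring. }
  assert (Hcf : Cconj (ray_fun (a - 1) a m 0 1 th (/ r * t)) =
    (RtoC (Rpower (/ r * t) (a - 1)) * Cconj (cis (a * th)) *
      (ray th r / (ray th r + RtoC t)) ^ m)%C).
  { unfold ray_fun; rewrite Cmult_conj, !Cmult_conj.
    assert (N3 : ((ray th (/ r * t) + 1) ^ m)%C <> 0%C) by now apply Cpow_nz.
    rewrite !Cinv_conj, Cpow_conj, E by (try easy; simpl; intros A; injection A; lra).
    replace (Cconj (RtoC (Rpower (/ r * t) (a - 1)))) with (RtoC (Rpower (/ r * t) (a - 1)))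
      by (apply Ceq; simpl; ring).
    rewrite <- Cpow_inv.
    + replace (/ ((ray th r + RtoC t) / ray th r))%C with (ray th r / (ray th r + RtoC t))%C
        by (field; easy).
      replace (Cconj ((ray th (/ r * t) + 1) ^ 0))%C with (RtoC 1) by (apply Ceq; simpl; ring).
      field.
    + intros A; apply N2; transitivity ((ray th r + RtoC t) / ray th r * ray th r)%C;
        [field; easy|rewrite A; ring]. }
  rewrite Hcf; clear Hcf.
  transitivity ((RtoC (/ r) * RtoC (Rpower r a) * RtoC (Rpower (/ r * t) (a - 1))) *
    (cis (a * th) * Cconj (cis (a * th))) * (ray th r / (ray th r + RtoC t)) ^ m)%C; [ring|].
  rewrite <- !RtoC_mult, Hcc.
  replace (/ r * Rpower r a * Rpower (/ r * t) (a - 1)) with (Rpower t (a - 1)); [ring|].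
  rewrite <- Rpower_mult_distr by (try easy; now apply Rinv_0_lt_compat).
  replace (/ r) with (Rpower r (- (1))) by (rewrite Rpower_Ropp, Rpower_1; easy).
  rewrite Rpower_mult, <- Rmult_assoc, <- !Rpower_plus.
  replace (- (1) + a + - (1) * (a - 1)) with 0 by ring.
  rewrite Rpower_O by easy; ring.
Qed.

Lemma half_int_const_mult (f : R -> R) (l c : R) :
  half_int f l -> half_int (fun t => c * f t) (c * l).
Proof. exact (is_RInt_gen_scal (V := R_NormedModule) f c l). Qed.

Lemma half_int_plus_R (f g : R -> R) (l k : R) :
  half_int f l -> half_int g k -> half_int (fun t => f t + g t) (l + k).
Proof. exact (is_RInt_gen_plus (V := R_NormedModule) f g l k). Qed.

Lemma half_int_eq (f : R -> R) (l l' : R) : half_int f l -> l = l' -> half_int f l'.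
Proof. now intros H <-. Qed.

Lemma half_int_ext_R (f g : R -> R) (l : R) :
  (forall t, 0 < t -> f t = g t) -> half_int f l -> half_int g l.
Proof. exact (half_int_ext (W := R_NormedModule) f g l). Qed.

Lemma half_int_exists_R (f : R -> R) (C a b : R) :
  0 < a < b -> (forall t, 0 < t -> continuous f t) ->
  (forall t, 0 < t -> Rabs (f t) <= C * (Rpower t (a - 1) * Rpower (1 + t) (- b))) ->
  exists l, half_int f l.
Proof.
  intros Hab Hf Hle.
  destruct (half_int_pos (W := R_CompleteNormedModule) f C a b Hab Hf Hle) as [l [H _]].
  now exists l.
Qed.

Lemma half_int_norm_le (f g : R -> R) (l k : R) :
  (forall t, 0 < t -> Rabs (f t) <= g t) -> half_int f l -> half_int g k -> Rabs l <= k.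
Proof.
  intros H Hf Hg.
  apply (RInt_gen_norm (V := R_CompleteNormedModule) f g l k) with (3 := Hf) (4 := Hg).
  - change (ends (fun a b => a <= b)); apply ends_char; exists 1, 1; repeat split; intros; lra.
  - change (ends (fun a b => forall x, a <= x <= b -> Rabs (f x) <= g x)).
    apply ends_char; exists 1, 1; repeat split; try lra; intros a b Ha Ha1 Hb x Hx.
    apply H; lra.
Qed.

(** * The integral of the resolvent of a positive number *)

Lemma Im_inv (z : C) : z <> 0%C -> Im (/ z)%C = - Im z / Cmod z ^ 2.
Proof. intros Hz; rewrite <- Cmod_sq; easy. Qed.

Lemma Re_inv (z : C) : z <> 0%C -> Re (/ z)%C = Re z / Cmod z ^ 2.
Proof. intros Hz; rewrite <- Cmod_sq; easy. Qed.

Lemma Im_cis_resolvent th r : - PI < th < PI -> 0 < r ->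
  Im (cis th * / (ray th r + 1))%C = sin th / (r ^ 2 + 2 * r * cos th + 1).
Proof.
  intros Hth Hr; assert (N := ray_plus_neq_0 th r 1 Hth Hr Rlt_0_1).
  change (cos th * Im (/ (ray th r + 1))%C + sin th * Re (/ (ray th r + 1))%C =
    sin th / (r ^ 2 + 2 * r * cos th + 1)).
  rewrite Im_inv, Re_inv by easy.
  assert (P : 0 < Cmod (ray th r + 1) ^ 2) by now apply pow_lt, Cmod_gt_0.
  rewrite Cmod_ray_plus in P |- *; simpl.
  field; nra.
Qed.

Lemma Im_resolvent th r : - PI < th < PI -> 0 < r ->
  Im (/ (ray th r + 1))%C = - (r * (sin th / (r ^ 2 + 2 * r * cos th + 1))).
Proof.
  intros Hth Hr; assert (N := ray_plus_neq_0 th r 1 Hth Hr Rlt_0_1).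
  rewrite Im_inv by easy.
  assert (P : 0 < Cmod (ray th r + 1) ^ 2) by now apply pow_lt, Cmod_gt_0.
  rewrite Cmod_ray_plus in P |- *; simpl; field; nra.
Qed.

Lemma ray_fun_simple e a th r : 0 < r -> - PI < th < PI ->
  ray_fun e a 0 1 1 th r = (RtoC (Rpower r e) * cis (a * th) * / (ray th r + 1))%C.
Proof.
  intros Hr Hth; assert (N := ray_plus_neq_0 th r 1 Hth Hr Rlt_0_1).
  unfold ray_fun; simpl; field; easy.
Qed.

(** The borderline case of the rotation: [s/(s+1)] tends to [0] at the origin and to [1] at
    infinity, so the arc at infinity contributes [th * 1], while the integrand on the positive
    half-line is real. Only the imaginary part [sin th / |s+1|^2] is integrable. *)
Lemma integral_resolvent_Im th : 0 <= th < PI ->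
  half_int (fun r => Im (cis th * / (ray th r + 1))%C) th.
Proof.
  intros Hth; assert (Hpi := PI_RGT_0).
  assert (Hc := cos_gt_m1 th ltac:(lra)); assert (Hc2 := COS_bound th).
  destruct (Cmod_ray_fun_le 0 0 0 1 1 (cos th) Rlt_0_1 ltac:(lra)) as (K & HK & Hle).
  assert (Hres : forall th' r, 0 <= th' <= th -> 0 < r ->
    Cmod (/ (ray th' r + 1)) <= K * / (1 + r)).
  { intros th' r Hth' Hr.
    assert (B := Hle th' r Hr (sector_cos th th' Hth Hth')).
    rewrite ray_fun_simple, Rpower_O, Rmult_0_l in B by lra.
    replace (RtoC 1 * cis 0 * / (ray th' r + 1))%C with (/ (ray th' r + 1))%C in B.
    - apply Rle_trans with (1 := B); rewrite Rmult_1_l, <- pow_inv_Rpower by lra.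
      simpl; rewrite Rmult_1_r; lra.
    - replace (cis 0) with (RtoC 1) by (apply Ceq; simpl; rewrite ?cos_0, ?sin_0; easy); ring. }
  destruct (half_int_exists_R (fun r => Im (cis th * / (ray th r + 1))%C) (K ^ 2) 1 2 ltac:(lra))
    as [l Hl].
  - intros r Hr.
    apply (continuous_ext_loc _ (fun r => Im (ray_fun 0 1 0 1 1 th r))).
    + apply (locally_interval _ r 0 (r + 1)); [exact Hr|simpl; lra|intros y Hy _].
      simpl in Hy; rewrite ray_fun_simple, Rpower_O, Rmult_1_l by lra; f_equal; ring.
    + apply (ccont_curry_2 (ray_fun 0 1 0 1 1)), ccont_ray_fun; lra.
  - intros r Hr; rewrite Im_cis_resolvent by lra.
    assert (B := Hres th r ltac:(lra) Hr).
    assert (N := ray_plus_neq_0 th r 1 ltac:(lra) Hr Rlt_0_1).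
    assert (P : 0 < Cmod (ray th r + 1) ^ 2) by now apply pow_lt, Cmod_gt_0.
    rewrite Cmod_inv in B by easy.
    rewrite Cmod_ray_plus, Rmult_1_r, pow1 in P.
    assert (E := Cmod_ray_plus th r 1); rewrite Rmult_1_r, pow1 in E; rewrite <- E in *.
    replace (1 - 1) with 0 by ring; rewrite Rpower_O, Rmult_1_l by easy.
    replace (- (2)) with (- INR 2) by (simpl; ring).
    rewrite <- pow_inv_Rpower, <- pow_inv, <- Rpow_mult_distr by lra.
    unfold Rdiv; rewrite Rabs_mult, (Rabs_pos_eq (/ _)) by now apply Rlt_le, Rinv_0_lt_compat.
    apply Rle_trans with (1 * / Cmod (ray th r + 1) ^ 2).
    + apply Rmult_le_compat_r; [now apply Rlt_le, Rinv_0_lt_compat|].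
      apply Rabs_le, SIN_bound.
    + rewrite Rmult_1_l, <- pow_inv; apply pow_incr; split; [|easy].
      apply Rlt_le, Rinv_0_lt_compat; now apply Cmod_gt_0.
  - assert (E : l - 0 = th * (1 - 0)).
    + apply (ray_rotation_Im 1 0 1 1 th 0 l 0 1 Rlt_0_1 Hth).
      * intros eps He; apply ends_char.
        (* [|s/(s+1)| <= K r] near [0], and [|s/(s+1) - 1| = |1/(s+1)| <= K / (1+r)] near
           infinity. *)
        exists (Rmin 1 (eps / K)), (Rmax 1 (K / eps)); repeat split.
        { apply Rmin_pos; [lra|now apply Rdiv_lt_0_compat]. }
        { apply Rle_trans with 1; [apply Rmin_l|apply Rmax_l]. }
        { rewrite Rminus_0_r; apply Rle_trans with (1 := re_le_Cmod _).
          rewrite ray_fun_simple, Rpower_1 by lra.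
          rewrite !Cmod_mult, Cmod_cis, Cmod_R, Rabs_pos_eq by lra.
          assert (B := Hres th' a H2 ltac:(lra)).
          apply Rle_trans with (a * 1 * (K * / (1 + a))).
          - apply Rmult_le_compat_l; lra.
          - assert (a < eps / K) by (apply Rlt_le_trans with (1 := H0), Rmin_r).
            assert (Hi : / (1 + a) <= 1) by (rewrite <- Rinv_1; apply Rinv_le_contravar; lra).
            apply Rle_trans with (a * K * 1); [|].
            + rewrite Rmult_1_r, <- Rmult_assoc; apply Rmult_le_compat_l; nra.
            + replace eps with (eps / K * K) by (field; lra); nra. }
        { assert (Hb : K / eps < b) by (apply Rle_lt_trans with (2 := H1), Rmax_r).
          assert (Hb0 : 0 < b) by (apply Rlt_trans with (2 := Hb); now apply Rdiv_lt_0_compat).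
          assert (N := ray_plus_neq_0 th' b 1 ltac:(lra) Hb0 Rlt_0_1).
          rewrite ray_fun_simple, Rpower_1, Rmult_1_l by lra.
          replace (Re (RtoC b * cis th' * / (ray th' b + 1))%C - 1) with
            (Re (- / (ray th' b + 1))%C).
          - apply Rle_trans with (1 := re_le_Cmod _); rewrite Cmod_opp.
            apply Rle_trans with (1 := Hres th' b H2 Hb0).
            apply Rmult_lt_compat_l with (r := eps) in Hb; [|easy].
            replace (eps * (K / eps)) with K in Hb by (field; lra).
            apply Rmult_le_reg_r with (1 + b); [lra|].
            rewrite Rmult_assoc, Rinv_l by lra; nra.
          - change 1 with (Re (RtoC 1)) at 2.
            change (Re (- / (ray th' b + 1))%C = Re (RtoC b * cis th' * / (ray th' b + 1) - 1)%C).
            f_equal; replace (RtoC b * cis th')%C with (ray th' b) by (apply Ceq; simpl; ring).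
            field; easy. }
      * apply (half_int_ext_R (fun _ => 0)).
        { intros r Hr; rewrite ray_fun_radius_0; easy || lra. }
        { exact (half_int_zero (W := R_CompleteNormedModule)). }
      * revert Hl; apply half_int_ext_R; intros r Hr.
        rewrite ray_fun_simple by lra; replace (1 - 1) with 0 by ring.
        rewrite Rpower_O, Rmult_1_l by easy; f_equal; ring.
    + assert (El : l = th) by lra; rewrite El in Hl; exact Hl.
Qed.

(** * The Gamma function *)

Lemma exp_increasing_le x y : x <= y -> exp x <= exp y.
Proof. intros [H| ->]; [now apply Rlt_le, exp_increasing|lra]. Qed.

(** The constant is the maximum [b^b e^(1-b)] of [(1+x)^b e^(-x)], attained at [x = b - 1]; the
    inequality is [ln y <= y - 1] for [y = (1+x)/b]. *)
Lemma exp_neg_le b x : 0 < b -> 0 <= x ->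
  exp (- x) <= exp (1 - b + b * ln b) * Rpower (1 + x) (- b).
Proof.
  intros Hb Hx; unfold Rpower; rewrite <- exp_plus; apply exp_increasing_le.
  assert (H : ln ((1 + x) / b) <= (1 + x) / b - 1).
  { assert (Hq : 0 < (1 + x) / b) by (apply Rdiv_lt_0_compat; lra).
    assert (H := exp_ineq1_le (ln ((1 + x) / b))); rewrite exp_ln in H by easy; lra. }
  rewrite ln_div in H by lra.
  apply Rmult_le_compat_l with (r := b) in H; [|lra].
  replace (b * ((1 + x) / b - 1)) with (1 + x - b) in H by (field; lra); lra.
Qed.

Lemma half_int_Gamma x : 0 < x ->
  half_int (fun t => Rpower t (x - 1) * exp (- t)) (Gamma x) /\ 0 < Gamma x.
Proof.
  intros Hx.
  assert (Hc : forall t, 0 < t -> continuous (fun t => Rpower t (x - 1) * exp (- t)) t).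
  { intros t Ht; apply (ex_derive_continuous (V := R_NormedModule)).
    unfold Rpower; auto_derive; easy. }
  assert (Hp : forall t, 0 < Rpower t (x - 1) * exp (- t)).
  { intros t; apply Rmult_lt_0_compat; apply exp_pos. }
  destruct (half_int_exists_R (fun t => Rpower t (x - 1) * exp (- t))
    (exp (1 - (x + 1) + (x + 1) * ln (x + 1))) x (x + 1) ltac:(lra) Hc) as [l Hl].
  - intros t Ht; rewrite Rabs_pos_eq by now apply Rlt_le.
    rewrite (Rmult_comm (exp _)), Rmult_assoc; apply Rmult_le_compat_l;
      [apply Rlt_le, Rpower_pos|].
    rewrite Rmult_comm; apply exp_neg_le; lra.
  - assert (E : Gamma x = l).
    { exact (is_RInt_gen_unique (V := R_CompleteNormedModule) _ _ Hl). }
    rewrite E; split; [easy|].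
    (* The integrand is positive, so every large truncation is at least the integral over [[1, 2]],
       and so is the limit. *)
    assert (H12 : 0 < RInt (fun t => Rpower t (x - 1) * exp (- t)) 1 2).
    { apply RInt_gt_0; [lra|intros; apply Hp|intros; apply Hc; lra]. }
    apply Rlt_le_trans with (1 := H12); apply Rnot_lt_le; intros Hlt.
    assert (Hsub : ends (fun a b => a < 1 /\ 2 < b)).
    { apply ends_char; exists 1, 2; repeat split; lra. }
    destruct (ends_ex _ (ends_and _ _ (proj1 (half_int_char _ _) Hl _
      (proj2 (Rlt_0_minus _ _) Hlt)) Hsub)) as (a & b & Ha & Hab & (y & Hy & Hy') & Ha1 & Hb2).
    apply (is_RInt_unique (V := R_CompleteNormedModule)) in Hy; subst y.
    assert (Hex : forall u v, 0 < u -> u <= v ->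
      ex_RInt (fun t => Rpower t (x - 1) * exp (- t)) u v).
    { intros u v Hu Huv; apply (ex_RInt_continuous (V := R_CompleteNormedModule)).
      rewrite Rmin_left, Rmax_right by easy; intros; apply Hc; lra. }
    assert (Hge : forall u v, 0 < u -> u <= v ->
      0 <= RInt (fun t => Rpower t (x - 1) * exp (- t)) u v).
    { intros u v Hu Huv; apply RInt_ge_0; [easy|now apply Hex|].
      intros; now apply Rlt_le. }
    assert (C1 := RInt_Chasles (V := R_CompleteNormedModule) _ a 1 b
      (Hex a 1 ltac:(lra) ltac:(lra)) (Hex 1 b ltac:(lra) ltac:(lra))).
    assert (C2 := RInt_Chasles (V := R_CompleteNormedModule) _ 1 2 b
      (Hex 1 2 ltac:(lra) ltac:(lra)) (Hex 2 b ltac:(lra) ltac:(lra))).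
    rewrite <- C1, <- C2 in Hy'.
    assert (G1 := Hge a 1 Ha ltac:(lra)); assert (G2 := Hge 2 b ltac:(lra) ltac:(lra)).
    set (u := RInt _ a 1) in *; set (v := RInt _ 1 2) in *; set (w := RInt _ 2 b) in *.
    change (Rabs ((u + (v + w)) - l) < v - l) in Hy'.
    rewrite Rabs_pos_eq in Hy' by lra; lra.
Qed.

Lemma half_int_exp_scale x c : 0 < x -> 0 < c ->
  half_int (fun t => Rpower t (x - 1) * exp (- (c * t))) (Gamma x * Rpower c (- x)).
Proof.
  intros Hx Hc; destruct (half_int_Gamma x Hx) as [H _].
  apply (half_int_scale (W := R_NormedModule) _ _ c Hc) in H.
  apply (half_int_const_mult _ _ (Rpower c (- x))) in H.
  rewrite Rmult_comm; revert H; apply half_int_ext_R; intros t Ht.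
  change (Rpower c (- x) * (c * (Rpower (c * t) (x - 1) * exp (- (c * t)))) =
    Rpower t (x - 1) * exp (- (c * t))).
  rewrite <- Rpower_mult_distr by easy.
  transitivity ((Rpower c (- x) * Rpower c 1 * Rpower c (x - 1)) * Rpower t (x - 1) * exp (- (c * t))).
  - rewrite Rpower_1 by easy; ring.
  - rewrite <- !Rpower_plus; replace (- x + 1 + (x - 1)) with 0 by ring.
    rewrite Rpower_O by easy; ring.
Qed.

(** Fubini for [t^(a-1) u^(s-1) e^(-(1+t) u)]: integrating first in [u] gives [Gamma s (1+t)^(-s)],
    first in [t] gives [Gamma a u^(-a)]. *)
Lemma Beta_Gamma (a s K : R) : 0 < a < s ->
  half_int (fun t => Rpower t (a - 1) * Rpower (1 + t) (- s)) K ->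
  Gamma s * K = Gamma a * Gamma (s - a).
Proof.
  (* Any [b] strictly between [a] and [s] separates the variables: [b > a] makes the majorant
     integrable in [t] at infinity, [b < s] in [u] at [0]. *)
  intros Ha HK; set (b := (a + s) / 2); assert (Hb : a < b < s) by (unfold b; lra).
  clearbody b; set (f := fun t u => Rpower t (a - 1) * (Rpower u (s - 1) * exp (- ((1 + t) * u)))).
  set (C1 := exp (1 - b + b * ln b)).
  set (C2 := exp (1 - (s + 1) + (s + 1) * ln (s + 1))).
  assert (HC1 : 0 < C1) by apply exp_pos; assert (HC2 : 0 < C2) by apply exp_pos.
  apply (Fubini_half_int (W := R_CompleteNormedModule) f (2 * C1 * C2 * 4 * 4)
    (Rmin a (b - a)) (Rmin (s - b) (s + 1 - b - (s - b)))
    (fun t => Gamma s * (Rpower t (a - 1) * Rpower (1 + t) (- s)))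
    (fun u => Gamma a * (Rpower u (s - a - 1) * exp (- u)))).
  - apply Rmin_pos; lra.
  - apply Rmin_pos; lra.
  - intros t u Ht Hu; unfold f.
    apply (continuous_mult (K := R_AbsRing) (fun q : R * R => Rpower (fst q) (a - 1))).
    + apply (continuous_comp_fst (fun t => Rpower t (a - 1))); now apply continuous_Rpower.
    + apply (continuous_mult (K := R_AbsRing) (fun q : R * R => Rpower (snd q) (s - 1))).
      * apply (continuous_comp_snd (fun t => Rpower t (s - 1))); now apply continuous_Rpower.
      * apply (continuous_comp (fun q : R * R => - ((1 + fst q) * snd q)) exp).
        -- apply (continuous_opp (V := R_NormedModule)), (continuous_mult (K := R_AbsRing));
             [|apply continuous_snd].
           apply (continuous_plus (V := R_NormedModule)); [apply continuous_const|apply continuous_fst].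
        -- apply (ex_derive_continuous (V := R_NormedModule)); auto_derive; easy.
  - intros t u Ht Hu.
    change (Rabs (f t u) <= 2 * C1 * C2 * 4 * 4 * kap (Rmin a (b - a)) t *
      kap (Rmin (s - b) (s + 1 - b - (s - b))) u).
    assert (P1 := Rpower_pos t (a - 1)); assert (P2 := Rpower_pos u (s - 1)).
    rewrite Rabs_pos_eq.
    2: { unfold f; repeat apply Rmult_le_pos; try lra; apply Rlt_le, exp_pos. }
    assert (D1 := kap_dominates a b t Ht ltac:(lra)).
    assert (D2 := kap_dominates (s - b) (s + 1 - b) u Hu ltac:(lra)).
    apply Rle_trans with (2 * C1 * C2 * (Rpower t (a - 1) * Rpower (1 + t) (- b)) *
      (Rpower u (s - b - 1) * Rpower (1 + u) (- (s + 1 - b)))).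
    2: { set (k1 := kap (Rmin a _) t) in *; set (k2 := kap (Rmin (s - b) _) u) in *.
         replace (2 * C1 * C2 * 4 * 4 * k1 * k2) with (2 * C1 * C2 * (4 * k1) * (4 * k2)) by ring.
         assert (Q1 := Rpower_pos (1 + t) (- b)); assert (Q2 := Rpower_pos (1 + u) (- (s + 1 - b))).
         assert (Q3 := Rpower_pos u (s - b - 1)).
         apply Rmult_le_compat; try easy.
         - repeat apply Rmult_le_pos; lra.
         - apply Rmult_le_pos; lra.
         - apply Rmult_le_compat_l; [|easy]; repeat apply Rmult_le_pos; lra. }
    assert (E1 : exp (- ((1 + t) * u)) = exp (- (t * u)) * exp (- u)).
    { rewrite <- exp_plus; f_equal; ring. }
    assert (B1 : exp (- (t * u)) <= C1 * Rpower (1 + t * u) (- b))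
      by (apply exp_neg_le; [lra|apply Rmult_le_pos; lra]).
    assert (B2 : exp (- u) <= C2 * Rpower (1 + u) (- (s + 1))) by (apply exp_neg_le; lra).
    (* From [(1 + t) u <= (1 + t u) (1 + u)]; this is where the mixed term [t u] splits into a
       product. *)
    assert (B3 : Rpower (1 + t * u) (- b) <=
      Rpower (1 + t) (- b) * (Rpower u (- b) * Rpower (1 + u) b)).
    { assert (Hge : Rpower ((1 + t) * u) b <= Rpower ((1 + t * u) * (1 + u)) b).
      { apply Rle_Rpower_l; [lra|split; nra]. }
      rewrite <- !Rpower_mult_distr in Hge by nra.
      rewrite !Rpower_Ropp.
      assert (R1 := Rpower_pos (1 + t) b); assert (R2 := Rpower_pos u b).
      assert (R3 := Rpower_pos (1 + t * u) b).
      apply Rmult_le_reg_r with (Rpower (1 + t) b * Rpower u b * Rpower (1 + t * u) b).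
      { repeat apply Rmult_lt_0_compat; lra. }
      replace (/ Rpower (1 + t * u) b * (Rpower (1 + t) b * Rpower u b * Rpower (1 + t * u) b))
        with (Rpower (1 + t) b * Rpower u b) by (field; lra).
      replace (/ Rpower (1 + t) b * (/ Rpower u b * Rpower (1 + u) b) *
        (Rpower (1 + t) b * Rpower u b * Rpower (1 + t * u) b))
        with (Rpower (1 + t * u) b * Rpower (1 + u) b) by (field; lra).
      easy. }
    unfold f; rewrite E1.
    assert (R1 := Rpower_pos (1 + t) (- b)); assert (R2 := Rpower_pos u (- b)).
    assert (R3 := Rpower_pos (1 + u) b); assert (R4 := Rpower_pos (1 + u) (- (s + 1))).
    assert (R5 := exp_pos (- (t * u))); assert (R6 := exp_pos (- u)).
    replace (s - b - 1) with ((s - 1) + - b) by ring.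
    replace (- (s + 1 - b)) with (b + - (s + 1)) by ring.
    rewrite !Rpower_plus.
    apply Rle_trans with (Rpower t (a - 1) * Rpower u (s - 1) *
      (C1 * (Rpower (1 + t) (- b) * (Rpower u (- b) * Rpower (1 + u) b)) *
       (C2 * Rpower (1 + u) (- (s + 1))))).
    + rewrite <- Rmult_assoc; apply Rmult_le_compat_l; [nra|].
      apply Rmult_le_compat; try lra.
      apply Rle_trans with (1 := B1), Rmult_le_compat_l; lra.
    + set (X := Rpower t (a - 1) * Rpower u (s - 1) *
        (C1 * (Rpower (1 + t) (- b) * (Rpower u (- b) * Rpower (1 + u) b)) *
        (C2 * Rpower (1 + u) (- (s + 1))))).
      apply Rle_trans with (2 * X); [|right; unfold X; ring].
      assert (0 <= X); [|lra].
      unfold X; repeat apply Rmult_le_pos; lra.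
  - intros t Ht; assert (H := half_int_exp_scale s (1 + t) ltac:(lra) ltac:(lra)).
    apply (half_int_const_mult _ _ (Rpower t (a - 1))) in H.
    eapply half_int_eq; [exact H|ring].
  - intros u Hu; assert (H := half_int_exp_scale a u ltac:(lra) Hu).
    apply (half_int_const_mult _ _ (Rpower u (s - 1) * exp (- u))) in H.
    eapply half_int_eq; [eapply half_int_ext_R; [|exact H]|].
    + intros t Ht; unfold f; replace (- ((1 + t) * u)) with (- u + - (u * t)) by ring.
      rewrite exp_plus; ring.
    + replace (s - a - 1) with ((s - 1) + - a) by ring; rewrite Rpower_plus; ring.
  - now apply half_int_const_mult.
  - apply half_int_const_mult; apply half_int_Gamma; lra.
Qed.

(** * Euler's reflection formula *)

Lemma resolvent_power_integral (a th K : R) : 0 < a < 1 -> 0 <= th < PI ->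
  half_int (fun t => Rpower t (a - 1) * / (t + 1) ^ 1) K ->
  chalf_int (fun r => RtoC (Rpower r (a - 1)) * / (ray th r + 1))%C (RtoC K * Cconj (cis (a * th)))%C.
Proof.
  intros Ha Hth HK; assert (Hpi := PI_RGT_0).
  assert (H0 : chalf_int (ray_fun (a - 1) a 0 1 1 0) (RtoC K)).
  { apply (chalf_int_ext (fun t => RtoC (Rpower t (a - 1) * / (t + 1) ^ 1))).
    - intros t Ht; rewrite ray_fun_radius_0 by lra; f_equal; simpl; field; lra.
    - split; [exact HK|exact (half_int_zero (W := R_CompleteNormedModule))]. }
  apply (ray_fun_rotation a 0 1 1 th) in H0; [|lra|easy|simpl; lra].
  apply (chalf_int_scal _ _ (Cconj (cis (a * th)))) in H0.
  rewrite Cmult_comm; revert H0; apply chalf_int_ext; intros r Hr.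
  rewrite ray_fun_simple by lra.
  assert (Hcc : (cis (a * th) * Cconj (cis (a * th)) = 1)%C).
  { assert (H := sin2_cos2 (a * th)); unfold Rsqr in H; apply Ceq; simpl; lra. }
  transitivity (RtoC (Rpower r (a - 1)) * (cis (a * th) * Cconj (cis (a * th))) *
    / (ray th r + 1))%C; [ring|rewrite Hcc; ring].
Qed.

(** The kernel is [- Im (1/(s+1)) / r], so this is the imaginary part of [K e^(-i a th)] up to
    sign. *)
Lemma integral_power_quadratic (a th K : R) : 0 < a < 1 -> 0 <= th < PI ->
  half_int (fun t => Rpower t (a - 1) * / (t + 1) ^ 1) K ->
  half_int (fun r => Rpower r a * (sin th / (r ^ 2 + 2 * r * cos th + 1))) (K * sin (a * th)).
Proof.
  intros Ha Hth HK; assert (Hpi := PI_RGT_0).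
  destruct (resolvent_power_integral a th K Ha Hth HK) as [_ H].
  apply (half_int_const_mult _ _ (-1)) in H.
  eapply half_int_eq; [eapply half_int_ext_R; [|exact H]|].
  - intros r Hr; transitivity (-1 * (Rpower r (a - 1) * Im (/ (ray th r + 1))%C)).
    + simpl; ring.
    + rewrite Im_resolvent by lra.
      replace (Rpower r a) with (r * Rpower r (a - 1)); [ring|].
      rewrite <- (Rpower_1 r) at 1 by easy; rewrite <- Rpower_plus; f_equal; ring.
  - simpl; ring.
Qed.

(** The kernel is also [Im (e^(i th)/(s+1))]; with exponent [1 - a] the phase becomes
    [th - (1-a) th = a th], which matches the integral of [r^a]. *)
Lemma integral_neg_power_quadratic (a th K : R) : 0 < a < 1 -> 0 <= th < PI ->
  half_int (fun t => Rpower t ((1 - a) - 1) * / (t + 1) ^ 1) K ->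
  half_int (fun r => Rpower r (- a) * (sin th / (r ^ 2 + 2 * r * cos th + 1))) (K * sin (a * th)).
Proof.
  intros Ha Hth HK; assert (Hpi := PI_RGT_0).
  assert (H := resolvent_power_integral (1 - a) th K ltac:(lra) Hth HK).
  apply (chalf_int_scal _ _ (cis th)) in H; destruct H as [_ H].
  eapply half_int_eq; [eapply half_int_ext_R; [|exact H]|].
  - intros r Hr; rewrite <- Im_cis_resolvent by lra.
    replace (1 - a - 1) with (- a) by ring.
    transitivity (Im (RtoC (Rpower r (- a)) * (cis th * / (ray th r + 1)))%C).
    + f_equal; ring.
    + simpl; ring.
  - replace (a * th) with (th - (1 - a) * th) by ring; rewrite sin_minus; simpl; ring.
Qed.

(** [(r^a + r^(-a))/2 - 1 = (r^a - 1)^2 r^(-a) / 2] vanishes to second order at [r = 1], where the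
    denominator degenerates as [th] tends to [pi]. Since the denominator is at least [(r-1)^2], what
    remains besides the factor [sin th] is integrable and free of [th]. *)
Lemma power_defect_bound (a th r : R) : 0 < a < 1 -> 0 <= th < PI -> 0 < r ->
  Rabs (/ 2 * (Rpower r a * (sin th / (r ^ 2 + 2 * r * cos th + 1)) +
      Rpower r (- a) * (sin th / (r ^ 2 + 2 * r * cos th + 1))) +
      - 1 * (sin th / (r ^ 2 + 2 * r * cos th + 1))) <=
  sin th * (4 * (Rpower r (1 - a - 1) * Rpower (1 + r) (- (2 - 2 * a)))).
Proof.
  intros Ha Hth Hr; assert (Hpi := PI_RGT_0).
  assert (Hc := cos_gt_m1 th ltac:(lra)).
  assert (Hs : 0 <= sin th) by (apply sin_ge_0; lra).
  set (D := r ^ 2 + 2 * r * cos th + 1).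
  assert (Hrc : 0 < r * (1 + cos th)) by (apply Rmult_lt_0_compat; lra).
  assert (HD : (r - 1) ^ 2 <= D) by (unfold D; nra).
  assert (HD0 : 0 < D) by (unfold D; assert (H := pow2_ge_0 (r - 1)); nra).
  assert (E : Rpower r (- a) = / Rpower r a) by apply Rpower_Ropp.
  assert (P := Rpower_pos r a).
  assert (P1 := Rpower_pos (1 + r) (- (2 - 2 * a))).
  replace (/ 2 * (Rpower r a * (sin th / D) + Rpower r (- a) * (sin th / D)) + -1 * (sin th / D))
    with (sin th * (/ 2 * ((Rpower r a - 1) ^ 2 * Rpower r (- a) / D))) by (rewrite E; field; lra).
  rewrite Rabs_mult, Rabs_pos_eq by easy; apply Rmult_le_compat_l; [easy|].
  replace (1 - a - 1) with (- a) by ring.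
  assert (Pa := Rpower_pos r (- a)).
  rewrite Rabs_pos_eq.
  2: { apply Rmult_le_pos; [lra|]; apply Rmult_le_pos; [|now apply Rlt_le, Rinv_0_lt_compat].
       apply Rmult_le_pos; [apply pow2_ge_0|lra]. }
  assert (Hb : (Rpower r a - 1) ^ 2 <= D * (8 * Rpower (1 + r) (- (2 - 2 * a)))).
  { (* |r^a - 1| <= |r - 1| min(1, r^(a-1)) <= |r - 1| (2/(1+r))^(1-a) *)
    assert (Q : Rpower (1 + r) (- (2 - 2 * a)) = (Rpower (1 + r) (a - 1)) ^ 2).
    { replace (- (2 - 2 * a)) with ((a - 1) + (a - 1)) by ring; rewrite Rpower_plus; ring. }
    rewrite Q; assert (Qp := Rpower_pos (1 + r) (a - 1)).
    assert (H2 : Rpower 2 (1 - a) <= 2).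
    { rewrite <- (Rpower_1 2) at 2 by lra; apply Rle_Rpower; lra. }
    assert (Hlin : Rabs (Rpower r a - 1) <= Rabs (r - 1) * (2 * Rpower (1 + r) (a - 1))).
    { assert (Hm : forall x, 0 < x -> x <= 2 -> 1 <= 2 * Rpower x (a - 1)).
      { intros x Hx Hx2; replace (a - 1) with (- (1 - a)) by ring; rewrite Rpower_Ropp.
        assert (B : Rpower x (1 - a) <= Rpower 2 (1 - a)) by (apply Rle_Rpower_l; lra).
        assert (Bp := Rpower_pos x (1 - a)).
        apply Rmult_le_reg_r with (Rpower x (1 - a)); [easy|].
        rewrite Rmult_assoc, Rinv_l; lra. }
      assert (S1 : r = r * 1) by ring.
      destruct (Rle_lt_dec r 1) as [H|H].
      - assert (A1 : r <= Rpower r a).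
        { rewrite <- (Rpower_1 r) at 1 by easy; unfold Rpower.
          apply exp_increasing_le.
          assert (ln r <= 0) by (rewrite <- ln_1; destruct H as [H| ->];
            [now apply Rlt_le, ln_increasing|lra]); nra. }
        assert (A2 : Rpower r a <= 1).
        { replace 1 with (Rpower 1 a) at 1; [apply Rle_Rpower_l; lra|].
          unfold Rpower; rewrite ln_1, Rmult_0_r; apply exp_0. }
        rewrite !Rabs_left1 by lra.
        assert (A3 := Hm (1 + r) ltac:(lra) ltac:(lra)).
        apply Rle_trans with (- (r - 1) * 1); [lra|apply Rmult_le_compat_l; lra].
      - assert (A1 : 1 <= Rpower r a).
        { rewrite <- (Rpower_O r) by easy; apply Rle_Rpower; lra. }
        rewrite !Rabs_pos_eq by lra.
        assert (A2 : Rpower r a = r * Rpower r (a - 1)).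
        { rewrite <- (Rpower_1 r) at 2 by easy; rewrite <- Rpower_plus; f_equal; ring. }
        assert (A3 : Rpower r (a - 1) <= 1).
        { apply Rle_trans with (Rpower r 0); [apply Rle_Rpower; lra|].
          rewrite Rpower_O; lra. }
        assert (A4 : Rpower r (a - 1) <= 2 * Rpower (1 + r) (a - 1)).
        { assert (A5 := Hm ((1 + r) / r) ltac:(apply Rdiv_lt_0_compat; lra)
            ltac:(apply Rmult_le_reg_r with r; [lra|unfold Rdiv; rewrite Rmult_assoc, Rinv_l; lra])).
          assert (A6 : Rpower (1 + r) (a - 1) = Rpower ((1 + r) / r) (a - 1) * Rpower r (a - 1)).
          { rewrite Rpower_mult_distr; [f_equal; field; lra|apply Rdiv_lt_0_compat; lra|lra]. }
          rewrite A6, <- Rmult_assoc.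
          assert (A7 := Rpower_pos r (a - 1)).
          rewrite <- (Rmult_1_l (Rpower r (a - 1))) at 1; apply Rmult_le_compat_r; lra. }
        apply Rle_trans with ((r - 1) * Rpower r (a - 1)); [rewrite A2; nra|].
        apply Rmult_le_compat_l; lra. }
    rewrite <- (pow2_abs (Rpower r a - 1)).
    apply Rle_trans with ((Rabs (r - 1) * (2 * Rpower (1 + r) (a - 1))) ^ 2).
    - apply pow_incr; split; [apply Rabs_pos|easy].
    - rewrite Rpow_mult_distr, pow2_abs.
      apply Rle_trans with (D * (2 * Rpower (1 + r) (a - 1)) ^ 2).
      + apply Rmult_le_compat_r; [apply pow2_ge_0|easy].
      + apply Rmult_le_compat_l; [lra|]; nra. }
  apply Rle_trans with (/ 2 * (D * (8 * Rpower (1 + r) (- (2 - 2 * a))) * Rpower r (- a) / D)).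
  - apply Rmult_le_compat_l; [lra|]; apply Rmult_le_compat_r; [now apply Rlt_le, Rinv_0_lt_compat|].
    apply Rmult_le_compat_r; lra.
  - right; field; lra.
Qed.

(** The kernel [sin th / (r^2 + 2 r cos th + 1)] concentrates at [r = 1] with total mass [th]
    as [th -> pi]; averaging [r^a] with [r^(-a)] makes the error quadratic in [r - 1]. *)
Lemma Euler_reflection (a K : R) : 0 < a < 1 ->
  half_int (fun t => Rpower t (a - 1) * / (t + 1) ^ 1) K -> K * sin (a * PI) = PI.
Proof.
  intros Ha HK; assert (Hpi := PI_RGT_0).
  assert (HB : forall x k, half_int (fun t => Rpower t (x - 1) * / (t + 1) ^ 1) k ->
    half_int (fun t => Rpower t (x - 1) * Rpower (1 + t) (- (1))) k).
  { intros x k; apply half_int_ext_R; intros t Ht.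
    rewrite Rpower_Ropp, Rpower_1 by lra; simpl; f_equal; f_equal; ring. }
  destruct (half_int_exists_R (fun t => Rpower t ((1 - a) - 1) * / (t + 1) ^ 1) 1 (1 - a) 1
    ltac:(lra)) as [K' HK'].
  { intros t Ht; apply (ex_derive_continuous (V := R_NormedModule)).
    unfold Rpower; auto_derive; repeat split; simpl; lra. }
  { intros t Ht; rewrite Rmult_1_l, Rabs_pos_eq.
    - right; rewrite Rpower_Ropp, Rpower_1 by lra; simpl; f_equal; f_equal; ring.
    - apply Rlt_le, Rmult_lt_0_compat; [apply Rpower_pos|apply Rinv_0_lt_compat; simpl; lra]. }
  (* The Beta integral is symmetric under exchange of [a] and [1 - a], so one constant serves both
     powers. *)
  assert (EK : K' = K).
  { assert (B1 := Beta_Gamma a 1 K ltac:(lra) (HB _ _ HK)).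
    assert (B2 := Beta_Gamma (1 - a) 1 K' ltac:(lra) (HB _ _ HK')).
    replace (1 - (1 - a)) with a in B2 by ring.
    destruct (half_int_Gamma 1 Rlt_0_1) as [_ G1].
    apply Rmult_eq_reg_l with (Gamma 1); lra. }
  subst K'.
  destruct (half_int_exists_R (fun r => 4 * (Rpower r (1 - a - 1) * Rpower (1 + r) (- (2 - 2 * a))))
    4 (1 - a) (2 - 2 * a) ltac:(lra)) as [M HM].
  { intros t Ht; apply (ex_derive_continuous (V := R_NormedModule)).
    unfold Rpower; auto_derive; repeat split; lra. }
  { intros t Ht; rewrite Rabs_pos_eq; [lra|].
    assert (A := Rpower_pos t (1 - a - 1)); assert (B := Rpower_pos (1 + t) (- (2 - 2 * a))); nra. }
  assert (HM0 : 0 <= M).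
  { assert (H : Rabs 0 <= M); [|now rewrite Rabs_R0 in H].
    apply (half_int_norm_le (fun _ => 0) _ 0 M) with (3 := HM).
    - intros t Ht; rewrite Rabs_R0.
      assert (A := Rpower_pos t (1 - a - 1)); assert (B := Rpower_pos (1 + t) (- (2 - 2 * a))).
      assert (C := Rmult_lt_0_compat _ _ A B); lra.
    - exact (half_int_zero (W := R_CompleteNormedModule)). }
  (* [K sin (a th)] is the integral of either power and [th] that of the bare kernel; letting [th]
     tend to [pi] kills the right-hand side. *)
  assert (Hth : forall th, 0 <= th < PI -> Rabs (K * sin (a * th) - th) <= sin th * M).
  { intros th Hth.
    assert (H1 := integral_power_quadratic a th K Ha Hth HK).
    assert (H2 := integral_neg_power_quadratic a th K Ha Hth HK').
    assert (H3 : half_int (fun r => sin th / (r ^ 2 + 2 * r * cos th + 1)) th).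
    { eapply half_int_ext_R; [|exact (integral_resolvent_Im th Hth)].
      intros r Hr; apply Im_cis_resolvent; lra. }
    assert (H4 := half_int_plus_R _ _ _ _
      (half_int_const_mult _ _ (/ 2) (half_int_plus_R _ _ _ _ H1 H2))
      (half_int_const_mult _ _ (-1) H3)).
    replace (K * sin (a * th) - th) with
      (/ 2 * (K * sin (a * th) + K * sin (a * th)) + -1 * th) by field.
    apply (half_int_norm_le _ _ _ _ (fun r Hr => power_defect_bound a th r Ha Hth Hr) H4).
    now apply half_int_const_mult. }
  assert (Hlip : forall x y, Rabs (sin x - sin y) <= Rabs (x - y)).
  { intros x y; destruct (MVT_gen sin y x cos) as (c & _ & E).
    - intros z _; apply is_derive_Reals, derivable_pt_lim_sin.
    - intros z _; apply continuity_sin.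
    - rewrite E, Rabs_mult; rewrite <- (Rmult_1_l (Rabs (x - y))) at 2.
      apply Rmult_le_compat_r; [apply Rabs_pos|]; apply Rabs_le, COS_bound. }
  assert (Hall : forall eps, 0 < eps -> Rabs (K * sin (a * PI) - PI) <= 0 + eps).
  { intros eps He.
    set (B := M + Rabs K + 1); assert (HK0 := Rabs_pos K).
    assert (HB0 : 0 < B) by (unfold B; lra).
    (* At [th = PI - d] the errors are [M d] from the bound just proved, [|K| d] from the Lipschitz
       bound of the sine and [d] from [th] itself. *)
    set (d := Rmin PI (eps / B)).
    assert (Hd : 0 < d) by (apply Rmin_pos; [easy|now apply Rdiv_lt_0_compat]).
    assert (Hd1 : d <= PI) by apply Rmin_l.
    assert (Hd2 : B * d <= eps).
    { assert (A : d <= eps / B) by apply Rmin_r.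
      replace eps with (B * (eps / B)) by (field; lra); apply Rmult_le_compat_l; lra. }
    assert (H1 := Hth (PI - d) ltac:(lra)).
    assert (H2 := Hlip (a * PI) (a * (PI - d))).
    assert (H3 := Hlip (PI - d) PI); rewrite sin_PI, Rminus_0_r in H3.
    replace (PI - d - PI) with (- d) in H3 by ring; rewrite Rabs_Ropp, (Rabs_pos_eq d) in H3 by lra.
    replace (a * PI - a * (PI - d)) with (a * d) in H2 by ring.
    assert (Had : 0 <= a * d <= d) by nra.
    rewrite (Rabs_pos_eq (a * d)) in H2 by lra.
    assert (H4 : sin (PI - d) <= d) by (apply Rle_trans with (2 := H3), Rle_abs).
    replace (K * sin (a * PI) - PI) with
      ((K * sin (a * (PI - d)) - (PI - d)) + (K * (sin (a * PI) - sin (a * (PI - d))) - d)) by ring.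
    apply Rle_trans with (1 := Rabs_triang _ _).
    assert (H5 : Rabs (K * (sin (a * PI) - sin (a * (PI - d))) - d) <= Rabs K * d + d).
    { apply Rle_trans with (1 := Rabs_triang _ _).
      rewrite Rabs_Ropp, (Rabs_pos_eq d), Rabs_mult by lra.
      apply Rplus_le_compat_r, Rmult_le_compat_l; lra. }
    assert (H6 : sin (PI - d) * M <= d * M) by now apply Rmult_le_compat_r.
    unfold B in Hd2; lra. }
  assert (H0 := le_epsilon _ _ Hall).
  assert (H1 := Rle_abs (K * sin (a * PI) - PI)).
  assert (H2 := Rle_abs (- (K * sin (a * PI) - PI))); rewrite Rabs_Ropp in H2; lra.
Qed.

(** * Quadratic resolvents of a linear operator *)

Definition linear_graph {V : QBanach} (T : op V) : Prop :=
  (forall v w w', T v w -> T v w' -> w = w') /\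
  (forall v w v' w', T v w -> T v' w' -> T (plus v v') (plus w w')) /\
  (forall v w x, T v w -> T (scal x v) (scal x w)).

(** [q] is the inverse of [T^2 - x T + y] and [p = T q]. *)
Definition quad_inv {V : QBanach} (T : op V) (x y : R) (q p : Bop V) : Prop :=
  (forall v, T (q v) (p v)) /\
  (forall v, T (p v) (plus (minus v (scal y (q v))) (scal x (p v)))) /\
  (forall v u z, T v u -> T u z -> q (plus (minus z (scal x u)) (scal y v)) = v).

(** [S] is the inverse of [t + T]. *)
Definition lin_inv {V : QBanach} (T : op V) (t : R) (S : Bop V) : Prop :=
  (forall v, T (S v) (minus v (scal t (S v)))) /\
  (forall v u, T v u -> S (plus u (scal t v)) = v).

Lemma Bop_minus_apply {V : QBanach} (A : Bop V) u v : A (minus u v) = minus (A u) (A v).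
Proof.
  assert (E : minus u v = plus u (scal (-1) v)) by vring.
  rewrite E, bop_add, bop_scal; vring.
Qed.

Lemma graph_lin {V : QBanach} (T : op V) v w v' w' x y : linear_graph T ->
  T v w -> T v' w' -> T (plus (scal x v) (scal y v')) (plus (scal x w) (scal y w')).
Proof. intros (_ & A & S) H H'; apply A; now apply S. Qed.

Lemma graph_eq {V : QBanach} (T : op V) v w v' w' :
  T v w -> v = v' -> w = w' -> T v' w'.
Proof. now intros H <- <-. Qed.

Ltac bop_push := repeat first [rewrite bop_add|rewrite Bop_minus_apply|rewrite bop_scal].

(** [T q v = q T v] on the domain of [T]: the vector [p v] lies in the domain of [T^2], and
    [T^2 - x T + y] maps it to [T v = u], so the left inverse gives [p v = q u]. *)
Lemma quad_inv_commute {V : QBanach} (T : op V) x y q p v u : linear_graph T ->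
  quad_inv T x y q p -> T v u -> p v = q u.
Proof.
  intros L (H1 & H2 & H3) Hvu.
  assert (Hz : T (plus (minus v (scal y (q v))) (scal x (p v)))
    (plus (minus u (scal y (p v))) (scal x (plus (minus v (scal y (q v))) (scal x (p v)))))).
  { assert (A := graph_lin T _ _ _ _ 1 (- y) L Hvu (H1 v)).
    assert (B := graph_lin T _ _ _ _ 1 x L A (H2 v)).
    apply (graph_eq _ _ _ _ _ B); vring. }
  rewrite <- (H3 _ _ _ (H2 v) Hz) at 1; f_equal; vring.
Qed.

Lemma quad_inv_p_graph {V : QBanach} (T : op V) x y q p v u : linear_graph T ->
  quad_inv T x y q p -> T v u -> T (p v) (p u).
Proof.
  intros L H Hvu; rewrite (quad_inv_commute T x y q p v u L H Hvu); apply H.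
Qed.

Lemma quad_inv_pq {V : QBanach} (T : op V) x y q p x' y' q' p' v : linear_graph T ->
  quad_inv T x y q p -> quad_inv T x' y' q' p' -> p (q' v) = q (p' v).
Proof. intros L H H'; apply (quad_inv_commute T x y); [easy|easy|apply H']. Qed.

(** Resolvent identity [q - q' = q (Q' - Q) q'], where [Q' - Q = (x - x') T - (y - y')]. Continuity
    and all derivatives of the family come from it. *)
Lemma quad_inv_diff_q {V : QBanach} (T : op V) x y q p x' y' q' p' v : linear_graph T ->
  quad_inv T x y q p -> quad_inv T x' y' q' p' ->
  minus (q v) (q' v) = minus (scal (x - x') (q (p' v))) (scal (y - y') (q (q' v))).
Proof.
  intros L H H'; destruct H as (_ & _ & H3), H' as (H1' & H2' & _).
  rewrite <- (H3 _ _ _ (H1' v) (H2' v)) at 1; bop_push; vring.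
Qed.

Lemma quad_inv_diff_p {V : QBanach} (T : op V) x y q p x' y' q' p' v : linear_graph T ->
  quad_inv T x y q p -> quad_inv T x' y' q' p' ->
  minus (p v) (p' v) = minus (scal (x - x') (p (p' v))) (scal (y - y') (p (q' v))).
Proof.
  intros L H H'; apply (proj1 L (minus (q v) (q' v))).
  - assert (A := graph_lin T _ _ _ _ 1 (-1) L (proj1 H v) (proj1 H' v)).
    apply (graph_eq _ _ _ _ _ A); vring.
  - rewrite (quad_inv_diff_q T x y q p x' y' q' p' v L H H').
    assert (A := graph_lin T _ _ _ _ (x - x') (- (y - y')) L
      (proj1 H (p' v)) (proj1 H (q' v))).
    apply (graph_eq _ _ _ _ _ A); vring.
Qed.

(** The quadratic relation [T^2 q = 1 + x p - y q] applied to [q v]. *)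
Lemma quad_inv_pp {V : QBanach} (T : op V) x y q p v : linear_graph T ->
  quad_inv T x y q p ->
  p (p v) = plus (minus (q v) (scal y (q (q v)))) (scal x (p (q v))).
Proof.
  intros L H; apply (proj1 L (q (p v))); [apply H|].
  rewrite <- (quad_inv_pq T x y q p x y q p v L H H); apply H.
Qed.

(** [T^2 + 2 t T + t^2 = (t + T)^2], hence [(T + t) q] is the inverse of [t + T]. *)
Lemma lin_inv_of_quad {V : QBanach} (T : op V) (t : R) (q p S : Bop V) : linear_graph T ->
  quad_inv T (- (2 * t)) (t ^ 2) q p -> (forall v, S v = plus (p v) (scal t (q v))) ->
  lin_inv T t S.
Proof.
  intros L H HS; split.
  - intros v; rewrite HS.
    assert (A := graph_lin T _ _ _ _ 1 t L (proj1 (proj2 H) v) (proj1 H v)).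
    apply (graph_eq _ _ _ _ _ A); vring.
  - intros v u Hvu; rewrite HS; bop_push.
    assert (E1 := quad_inv_commute _ _ _ _ _ _ _ L H Hvu).
    assert (E2 : p u = plus (minus v (scal (t ^ 2) (q v))) (scal (- (2 * t)) (p v))).
    { apply (proj1 L (p v)); [|apply H].
      now apply (quad_inv_p_graph T _ _ q p v u L H). }
    rewrite E2, <- E1; vring.
Qed.

Lemma lin_inv_commute {V : QBanach} (T : op V) t (S A : Bop V) v : linear_graph T ->
  lin_inv T t S -> (forall v u, T v u -> T (A v) (A u)) -> S (A v) = A (S v).
Proof.
  intros L (H1 & H2) HA.
  assert (B := HA _ _ (H1 v)).
  rewrite <- (H2 _ _ B); f_equal; bop_push; vring.
Qed.

Lemma lin_inv_graph {V : QBanach} (T : op V) t (S : Bop V) v u : linear_graph T ->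
  lin_inv T t S -> T v u -> T (S v) (S u).
Proof.
  intros L (H1 & H2) Hvu.
  assert (E : S u = minus v (scal t (S v))).
  { rewrite <- (H2 v u Hvu) at 1; bop_push; vring. }
  rewrite E; apply H1.
Qed.

(** * Continuity of operator-valued functions *)

(** Joint continuity in operator norm, phrased through vectors so that the resolvent estimates apply
    directly. *)
Definition op_continuous {V : QBanach} (A : R -> R -> Bop V) (th r : R) : Prop :=
  forall eps, 0 < eps -> locally (th, r) (fun z : R * R => forall v,
    norm (minus (A (fst z) (snd z) v) (A th r v)) <= eps * norm v).

Lemma Bop_bound {V : QBanach} (A : Bop V) : exists C, 0 < C /\ forall v, norm (A v) <= C * norm v.
Proof.
  destruct (bop_bounded _ A) as [C HC]; exists (Rabs C + 1); split.
  - assert (H := Rabs_pos C); lra.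
  - intros v; apply Rle_trans with (1 := HC v); apply Rmult_le_compat_r; [apply norm_ge_0|].
    assert (H := Rle_abs C); lra.
Qed.

Lemma op_continuous_apply {V : QBanach} (A : R -> R -> Bop V) (B : R -> R -> V) th r :
  op_continuous A th r -> jointly_continuous B th r ->
  jointly_continuous (fun th r => A th r (B th r)) th r.
Proof.
  intros HA HB; refine (proj2 (continuous_norm_eps (U := prod_UniformSpace _ _) (W := V) _ _) _).
  assert (HB' := proj1 (continuous_norm_eps (U := prod_UniformSpace _ _) (W := V) _ _) HB).
  intros eps He; simpl in *.
  destruct (Bop_bound (A th r)) as (C & HC & HAb).
  set (n := norm (B th r)); assert (Hn : 0 <= n) by apply norm_ge_0.
  assert (H1 := HA (eps / (2 * (n + 1))) ltac:(apply Rdiv_lt_0_compat; lra)).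
  assert (H2 := HB' (Rmin 1 (eps / (2 * C))) ltac:(apply Rmin_pos; [lra|apply Rdiv_lt_0_compat; lra])).
  generalize (filter_and _ _ H1 H2); apply filter_imp; intros [th' r'] [G1 G2]; simpl in *.
  specialize (G1 (B th' r')).
  assert (G3 : norm (minus (B th' r') (B th r)) < 1) by (apply Rlt_le_trans with (1 := G2), Rmin_l).
  assert (G4 : norm (minus (B th' r') (B th r)) < eps / (2 * C))
    by (apply Rlt_le_trans with (1 := G2), Rmin_r).
  assert (G5 : norm (B th' r') <= n + 1).
  { apply Rle_trans with (norm (plus (minus (B th' r') (B th r)) (B th r))).
    - right; f_equal; vring.
    - eapply Rle_trans; [apply (norm_triangle (V := V))|]; fold n; lra. }
  eapply Rle_lt_trans; [exact (norm_minus_triangle (W := V) _ (A th r (B th' r')) _)|].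
  assert (E : minus (A th r (B th' r')) (A th r (B th r)) = A th r (minus (B th' r') (B th r)))
    by (symmetry; apply Bop_minus_apply).
  assert (N : norm (minus (A th r (B th' r')) (A th r (B th r))) < eps / 2).
  { rewrite E; apply Rle_lt_trans with (1 := HAb _).
    apply Rmult_lt_compat_l with (r := C) in G4; [|easy].
    replace (C * (eps / (2 * C))) with (eps / 2) in G4 by (field; lra); easy. }
  assert (N2 : norm (minus (A th' r' (B th' r')) (A th r (B th' r'))) <= eps / 2).
  { apply Rle_trans with (1 := G1).
    apply Rle_trans with (eps / (2 * (n + 1)) * (n + 1)).
    - apply Rmult_le_compat_l; [|easy]; apply Rlt_le, Rdiv_lt_0_compat; lra.
    - right; field; lra. }
  apply Rlt_le_trans with (eps / 2 + eps / 2); [|lra].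
  apply Rplus_le_lt_compat; [exact N2|exact N].
Qed.

Lemma op_continuous_const {V : QBanach} (A : R -> R -> Bop V) th r v :
  op_continuous A th r -> jointly_continuous (fun th r => A th r v) th r.
Proof.
  intros H; apply (op_continuous_apply A (fun _ _ => v)); [easy|].
  apply continuous_const.
Qed.

(** * The resolvents on the complement of a sector *)

(** The parameters [2 r cos th] and [r^2] are [2 Re s] and [|s|^2]. Angles extend beyond [PI],
    symmetrically, so that the negative half-line is interior and can be reached by differentiating
    in the angle. *)
Definition sector_family {V : QBanach} (T : op V) (C phi0 : R) (q p : R -> R -> Bop V) : Prop :=
  forall th r, phi0 < th < 2 * PI - phi0 -> 0 < r ->
    quad_inv T (2 * r * cos th) (r ^ 2) (q th r) (p th r) /\
    (forall v, norm (q th r v) <= C / r ^ 2 * norm v) /\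
    (forall v, norm (p th r v) <= C / r * norm v).

Lemma locally_quadrant (th r a b : R) : a < th < b -> 0 < r ->
  locally (th, r) (fun z : R * R => a < fst z < b /\ r / 2 < snd z < 2 * r).
Proof.
  intros Hth Hr.
  set (e := Rmin (Rmin (th - a) (b - th)) (r / 2)).
  assert (He : 0 < e) by (repeat apply Rmin_pos; lra).
  assert (E1 : e <= Rmin (th - a) (b - th)) by apply Rmin_l.
  assert (E2 : e <= r / 2) by apply Rmin_r.
  assert (E3 := Rmin_l (th - a) (b - th)); assert (E4 := Rmin_r (th - a) (b - th)).
  exists (mkposreal e He); intros [x y] [H1 H2]; simpl in *.
  change (Rabs (x - th) < e) in H1; change (Rabs (y - r) < e) in H2.
  apply Rabs_def2 in H1, H2; lra.
Qed.

Lemma op_continuous_of_difference {V : QBanach} (A : R -> R -> Bop V) (g : R * R -> R) (M th r : R) :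
  continuous g (th, r) -> g (th, r) = 0 ->
  locally (th, r) (fun z => forall v,
    norm (minus (A (fst z) (snd z) v) (A th r v)) <= M * Rabs (g z) * norm v) ->
  op_continuous A th r.
Proof.
  intros Hg H0 HA eps He.
  assert (HM : 0 < Rabs M + 1) by (assert (H := Rabs_pos M); lra).
  assert (H1 := proj1 (continuous_norm_eps (W := R_NormedModule) g (th, r)) Hg
    (eps / (Rabs M + 1)) ltac:(now apply Rdiv_lt_0_compat)).
  generalize (filter_and _ _ HA H1); apply filter_imp; intros z [G1 G2] v.
  apply Rle_trans with (1 := G1 v), Rmult_le_compat_r; [apply norm_ge_0|].
  change (Rabs (g z - g (th, r)) < eps / (Rabs M + 1)) in G2.
  rewrite H0, Rminus_0_r in G2.
  assert (HA' := Rabs_pos (g z)); assert (HB := Rle_abs M).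
  apply Rle_trans with ((Rabs M + 1) * (eps / (Rabs M + 1))).
  - apply Rle_trans with ((Rabs M + 1) * Rabs (g z)).
    + apply Rmult_le_compat_r; lra.
    + apply Rmult_le_compat_l; lra.
  - right; field; lra.
Qed.

(** The resolvent identities bound increments by [M^2] times the increments of the two parameters,
    with [M] a bound valid for all radii above [r / 2]. *)
Lemma sector_family_continuous {V : QBanach} (T : op V) C phi0 q p th r :
  linear_graph T -> 0 < C -> sector_family T C phi0 q p ->
  phi0 < th < 2 * PI - phi0 -> 0 < r ->
  op_continuous q th r /\ op_continuous p th r.
Proof.
  intros L HC Hf Hth Hr.
  set (g := fun z : R * R => Rabs (2 * snd z * cos (fst z) - 2 * r * cos th) +
    Rabs (snd z ^ 2 - r ^ 2)).
  assert (Hpow : forall z : R * R, continuous (fun z : R * R => snd z ^ 2) z).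
  { intros z; apply (continuous_comp_snd (fun x => x ^ 2)), (ex_derive_continuous (V := R_NormedModule)).
    auto_derive; easy. }
  assert (Hg : continuous g (th, r)).
  { apply (continuous_plus (V := R_NormedModule)).
    - apply (continuous_comp (fun z : R * R => 2 * snd z * cos (fst z) - 2 * r * cos th) Rabs);
        [|apply continuous_Rabs].
      apply (continuous_minus (V := R_NormedModule)); [|apply continuous_const].
      apply (continuous_mult (K := R_AbsRing) (fun z : R * R => 2 * snd z)).
      + apply (continuous_mult (K := R_AbsRing)); [apply continuous_const|apply continuous_snd].
      + apply continuous_comp_fst, continuous_cos.
    - apply (continuous_comp (fun z : R * R => snd z ^ 2 - r ^ 2) Rabs); [|apply continuous_Rabs].
      apply (continuous_minus (V := R_NormedModule)); [|apply continuous_const].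
      apply Hpow. }
  assert (H0 : g (th, r) = 0).
  { unfold g; simpl; rewrite !Rminus_diag, Rabs_R0; ring. }
  destruct (Hf th r Hth Hr) as (H & Hq & Hp).
  set (M := C / (r / 2) ^ 2 + C / (r / 2)).
  assert (HM1 : 0 <= C / (r / 2) ^ 2) by (apply Rlt_le, Rdiv_lt_0_compat; [easy|apply pow_lt; lra]).
  assert (HM2 : 0 <= C / (r / 2)) by (apply Rlt_le, Rdiv_lt_0_compat; lra).
  assert (Hloc : forall r', r / 2 < r' -> C / r' ^ 2 <= M /\ C / r' <= M).
  { intros r' Hr'; split; unfold M.
    - apply Rle_trans with (C / (r / 2) ^ 2); [|lra].
      apply Rmult_le_compat_l; [lra|]; apply Rinv_le_contravar; [apply pow_lt; lra|].
      apply pow_incr; lra.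
    - apply Rle_trans with (C / (r / 2)); [|lra].
      apply Rmult_le_compat_l; [lra|]; apply Rinv_le_contravar; lra. }
  assert (HM0 : 0 <= M) by (unfold M; lra).
  destruct (Hloc r ltac:(lra)) as [Hr1 Hr2].
  assert (Hqr : forall v, norm (q th r v) <= M * norm v).
  { intros v; apply Rle_trans with (1 := Hq v), Rmult_le_compat_r; [apply norm_ge_0|easy]. }
  assert (Hpr : forall v, norm (p th r v) <= M * norm v).
  { intros v; apply Rle_trans with (1 := Hp v), Rmult_le_compat_r; [apply norm_ge_0|easy]. }
  assert (Key : forall (A : Bop V) a b u w (v : V), (forall v, norm (A v) <= M * norm v) ->
    norm u <= M * norm v -> norm w <= M * norm v ->
    norm (minus (scal a (A u)) (scal b (A w))) <= M ^ 2 * Rabs (Rabs a + Rabs b) * norm v).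
  { intros A a b u w v HA Hu Hw.
    apply Rle_trans with (1 := norm_minus_le (W := V) _ _).
    rewrite !(norm_scal_real (W := V)).
    assert (Pa := Rabs_pos a); assert (Pb := Rabs_pos b).
    rewrite (Rabs_pos_eq (Rabs a + Rabs b)) by lra.
    assert (Nv := norm_ge_0 v).
    assert (Au : norm (A u) <= M ^ 2 * norm v).
    { apply Rle_trans with (1 := HA u).
      replace (M ^ 2 * norm v) with (M * (M * norm v)) by ring; now apply Rmult_le_compat_l. }
    assert (Aw : norm (A w) <= M ^ 2 * norm v).
    { apply Rle_trans with (1 := HA w).
      replace (M ^ 2 * norm v) with (M * (M * norm v)) by ring; now apply Rmult_le_compat_l. }
    replace (M ^ 2 * (Rabs a + Rabs b) * norm v) with
      (Rabs a * (M ^ 2 * norm v) + Rabs b * (M ^ 2 * norm v)) by ring.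
    apply Rplus_le_compat; apply Rmult_le_compat_l; easy. }
  assert (Hl := locally_quadrant th r phi0 (2 * PI - phi0) Hth Hr).
  split; apply (op_continuous_of_difference _ g (M ^ 2) th r Hg H0);
    revert Hl; apply filter_imp; intros [th' r'] [G1 G2] v; simpl in *;
    destruct (Hf th' r' G1 ltac:(lra)) as (H' & Hq' & Hp');
    destruct (Hloc r' ltac:(lra)) as [Hr1' Hr2'].
  - rewrite (quad_inv_diff_q T _ _ _ _ _ _ _ _ v L H' H); apply Key; [|apply Hpr|apply Hqr].
    intros u; apply Rle_trans with (1 := Hq' u), Rmult_le_compat_r; [apply norm_ge_0|easy].
  - rewrite (quad_inv_diff_p T _ _ _ _ _ _ _ _ v L H' H); apply Key; [|apply Hpr|apply Hqr].
    intros u; apply Rle_trans with (1 := Hp' u), Rmult_le_compat_r; [apply norm_ge_0|easy].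
Qed.

(** * Derivatives of the resolvents in polar coordinates *)

Lemma is_derive_vanishing {W : NormedModule R_AbsRing} (f : R -> R) (G : R -> W) (t f' : R) :
  f t = 0 -> is_derive f t f' -> continuous G t ->
  is_derive (fun s => scal (f s) (G s)) t (scal f' (G t)).
Proof.
  intros H0 [_ Hf] HG; apply is_derive_norm_eps; intros eps He.
  specialize (Hf t (fun P HP => HP)).
  set (n := norm (G t)); assert (Hn : 0 <= n) by apply norm_ge_0.
  assert (He1 : 0 < Rmin 1 (eps / (2 * (n + 1))))
    by (apply Rmin_pos; [lra|apply Rdiv_lt_0_compat; lra]).
  assert (Hf1 := Hf (mkposreal _ He1)).
  assert (Pf := Rabs_pos f').
  assert (HG1 := proj1 (continuous_norm_eps G t) HG (eps / (2 * (Rabs f' + 1)))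
    ltac:(apply Rdiv_lt_0_compat; lra)).
  generalize (filter_and _ _ Hf1 HG1); apply filter_imp; intros s [A B]; simpl in A.
  change (Rabs ((f s - f t) - (s - t) * f') <= Rmin 1 (eps / (2 * (n + 1))) * Rabs (s - t)) in A.
  rewrite H0, Rminus_0_r in A; rewrite H0.
  set (d := Rabs (s - t)) in *; assert (Hd : 0 <= d) by apply Rabs_pos.
  assert (A1 : Rabs (f s - (s - t) * f') <= 1 * d)
    by (apply Rle_trans with (1 := A), Rmult_le_compat_r; [easy|apply Rmin_l]).
  assert (A2 : Rabs (f s - (s - t) * f') <= eps / (2 * (n + 1)) * d)
    by (apply Rle_trans with (1 := A), Rmult_le_compat_r; [easy|apply Rmin_r]).
  assert (A3 : Rabs (f s) <= (Rabs f' + 1) * d).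
  { replace (f s) with ((f s - (s - t) * f') + (s - t) * f') by ring.
    apply Rle_trans with (1 := Rabs_triang _ _); rewrite Rabs_mult; fold d; lra. }
  assert (E : minus (minus (scal (f s) (G s)) (scal 0 (G t))) (scal (s - t) (scal f' (G t))) =
    plus (scal (f s) (minus (G s) (G t))) (scal (f s - (s - t) * f') (G t))) by vring.
  apply (norm_le_eq (W := W) _ _ _ E).
  apply Rle_trans with (1 := norm_triangle (V := W) _ _); rewrite !(norm_scal_real (W := W)).
  replace (eps * d) with (((Rabs f' + 1) * d) * (eps / (2 * (Rabs f' + 1))) +
    (eps / (2 * (n + 1)) * d) * (n + 1)) by (field; lra).
  apply Rplus_le_compat; apply Rmult_le_compat; try apply Rabs_pos; try apply norm_ge_0; try easy.
  - now apply Rlt_le.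
  - fold n; lra.
Qed.

(** The resolvent identity has exactly this shape: scalar increments times continuous vectors. At a
    zero of the scalar factor continuity of the vector factor gives the derivative, so no circular
    appeal to differentiability of the resolvent arises. *)
Lemma is_derive_of_difference {W : NormedModule R_AbsRing} (f : R -> W) (g h : R -> R)
    (G H : R -> W) (t g' h' : R) :
  is_derive g t g' -> is_derive h t h' -> continuous G t -> continuous H t ->
  locally t (fun s => minus (f s) (f t) =
    minus (scal (g s - g t) (G s)) (scal (h s - h t) (H s))) ->
  is_derive f t (minus (scal g' (G t)) (scal h' (H t))).
Proof.
  intros Hg Hh HG HH Hloc.
  apply (is_derive_ext_loc (fun s => plus (f t) (minus (scal (g s - g t) (G s))
    (scal (h s - h t) (H s))))).
  { revert Hloc; apply filter_imp; intros s E; rewrite <- E; vring. }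
  assert (Hm : forall (u : R -> R) u', is_derive u t u' -> is_derive (fun s => u s - u t) t u').
  { intros u u' Hu; replace u' with (minus u' 0) by apply Rminus_0_r.
    apply (is_derive_minus (V := R_NormedModule)); [easy|].
    exact (is_derive_const (K := R_AbsRing) (V := R_NormedModule) (u t) t). }
  replace (minus (scal g' (G t)) (scal h' (H t))) with
    (plus zero (minus (scal g' (G t)) (scal h' (H t)))) by vring.
  apply (is_derive_plus (V := W)); [exact (is_derive_const (K := R_AbsRing) (V := W) (f t) t)|].
  apply (is_derive_minus (V := W)); apply is_derive_vanishing; try easy; try apply Rminus_diag;
    now apply Hm.
Qed.

Lemma sector_family_derive_radius {V : QBanach} (T : op V) C phi0 q p th r (v : V) :
  linear_graph T -> 0 < C -> sector_family T C phi0 q p ->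
  phi0 < th < 2 * PI - phi0 -> 0 < r ->
  is_derive (fun r => q th r v : V) r
    (minus (scal (2 * cos th) (q th r (p th r v))) (scal (2 * r) (q th r (q th r v)))) /\
  is_derive (fun r => p th r v : V) r
    (minus (scal (2 * cos th) (p th r (p th r v))) (scal (2 * r) (p th r (q th r v)))).
Proof.
  intros L HC Hf Hth Hr.
  assert (Hx : is_derive (fun r => 2 * r * cos th) r (2 * cos th)) by (auto_derive; [easy|ring]).
  assert (Hy : is_derive (fun r => r ^ 2) r (2 * r)) by (auto_derive; [easy|ring]).
  destruct (sector_family_continuous T C phi0 q p th r L HC Hf Hth Hr) as [Cq Cp].
  assert (Hl : locally r (fun r' => 0 < r')).
  { apply (locally_interval _ r 0 (r + 1)); simpl; try lra; easy. }
  assert (Cr : forall (A : R -> R -> Bop V) u, op_continuous A th r ->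
    continuous (fun r' => A th r' u : V) r).
  { intros A u HA; apply (jointly_continuous_2 (fun th r => A th r u)); now apply op_continuous_const. }
  split.
  - apply (is_derive_of_difference (W := V) _ (fun r => 2 * r * cos th) (fun r => r ^ 2)
      (fun r' => q th r' (p th r v) : V) (fun r' => q th r' (q th r v) : V) r _ _ Hx Hy);
      try (now apply Cr).
    revert Hl; apply filter_imp; intros r' Hr';
      destruct (Hf th r Hth Hr) as [H _]; destruct (Hf th r' Hth Hr') as [H' _].
    (* The moving resolvent stands outside and acts on the fixed vectors [p th r v], [q th r v];
       pointwise continuity then suffices. *)
    exact (quad_inv_diff_q T _ _ _ _ _ _ _ _ v L H' H).
  - apply (is_derive_of_difference (W := V) _ (fun r => 2 * r * cos th) (fun r => r ^ 2)
      (fun r' => p th r' (p th r v) : V) (fun r' => p th r' (q th r v) : V) r _ _ Hx Hy);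
      try (now apply Cr).
    revert Hl; apply filter_imp; intros r' Hr';
      destruct (Hf th r Hth Hr) as [H _]; destruct (Hf th r' Hth Hr') as [H' _].
    exact (quad_inv_diff_p T _ _ _ _ _ _ _ _ v L H' H).
Qed.

Lemma sector_family_derive_angle {V : QBanach} (T : op V) C phi0 q p th r (v : V) :
  linear_graph T -> 0 < C -> sector_family T C phi0 q p ->
  phi0 < th < 2 * PI - phi0 -> 0 < r ->
  is_derive (fun th => p th r v : V) th (scal (- (2 * r * sin th)) (p th r (p th r v))).
Proof.
  intros L HC Hf Hth Hr.
  assert (Hx : is_derive (fun th => 2 * r * cos th) th (- (2 * r * sin th)))
    by (auto_derive; [easy|ring]).
  assert (Hy : is_derive (fun _ : R => r ^ 2) th 0) by (auto_derive; easy).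
  destruct (sector_family_continuous T C phi0 q p th r L HC Hf Hth Hr) as [Cq Cp].
  assert (Hl : locally th (fun th' => phi0 < th' < 2 * PI - phi0)).
  { apply (locally_interval _ th phi0 (2 * PI - phi0)); simpl; try lra; easy. }
  assert (Cr : forall (A : R -> R -> Bop V) u, op_continuous A th r ->
    continuous (fun th' => A th' r u : V) th).
  { intros A u HA; apply (jointly_continuous_1 (fun th r => A th r u)); now apply op_continuous_const. }
  assert (D : is_derive (fun th => p th r v : V) th
    (minus (scal (- (2 * r * sin th)) (p th r (p th r v))) (scal 0 (p th r (q th r v))))).
  { apply (is_derive_of_difference (W := V) _ (fun th => 2 * r * cos th) (fun _ => r ^ 2)
      (fun th' => p th' r (p th r v) : V) (fun th' => p th' r (q th r v) : V) th _ _ Hx Hy);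
      try (now apply Cr).
    revert Hl; apply filter_imp; intros th' Hth'.
    destruct (Hf th r Hth Hr) as [H _]; destruct (Hf th' r Hth' Hr) as [H' _].
    exact (quad_inv_diff_p T _ _ _ _ _ _ _ _ v L H' H). }
  assert (E : minus (scal (- (2 * r * sin th)) (p th r (p th r v))) (scal 0 (p th r (q th r v))) =
    scal (- (2 * r * sin th)) (p th r (p th r v))) by vring.
  exact (eq_rect _ (is_derive (fun th => p th r v : V) th) D _ E).
Qed.

Lemma is_derive_scal_fun {W : NormedModule R_AbsRing} (f : R -> R) (G : R -> W) (t f' : R) (G' : W) :
  is_derive f t f' -> is_derive G t G' ->
  is_derive (fun s => scal (f s) (G s)) t (plus (scal f' (G t)) (scal (f t) G')).
Proof.
  intros Hf HG.
  assert (Hm : is_derive (fun s => f s - f t) t f').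
  { replace f' with (minus f' 0) by apply Rminus_0_r.
    apply (is_derive_minus (V := R_NormedModule)); [easy|].
    exact (is_derive_const (K := R_AbsRing) (V := R_NormedModule) (f t) t). }
  apply (is_derive_ext (fun s => plus (scal (f s - f t) (G s)) (scal (f t) (G s)))).
  { intros s; vring. }
  apply (is_derive_plus (V := W)).
  - apply is_derive_vanishing; [apply Rminus_diag|easy|].
    apply ex_derive_continuous; now exists G'.
  - apply (filterdiff_ext_lin _ (fun y : R => scal (f t) (scal y G'))); [|intros y; vring].
    exact (filterdiff_scal_r_fct (K := R_AbsRing) (U := R_NormedModule) (V := W) (f t) G
      (fun y => scal y G') Rmult_comm HG).
Qed.

Lemma continuous_scal_fun {U : UniformSpace} {W : NormedModule R_AbsRing} (f : U -> R) (G : U -> W) x :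
  continuous f x -> continuous G x -> continuous (fun s => scal (f s) (G s)) x.
Proof. intros Hf HG; exact (continuous_scal (K := R_AbsRing) f G x Hf HG). Qed.

(** The general bound [C / r] on [p] fails to be integrable at both ends. For [Y = T w] one has
    [p Y = w - r^2 q w + 2 r cos th p w], bounded with constant [1 + C + 2 C]; for [Y] in the domain
    [p Y = q Y'] decays like [1 / r^2]. *)
Lemma quad_inv_p_bounds {V : QBanach} (T : op V) C phi0 q p th r (w Y Y' : V) :
  linear_graph T -> 0 < C -> sector_family T C phi0 q p ->
  phi0 < th < 2 * PI - phi0 -> 0 < r -> T w Y -> T Y Y' ->
  norm (p th r Y) <= (1 + 3 * C) * norm w /\ norm (p th r Y) <= C / r ^ 2 * norm Y'.
Proof.
  intros L HC Hf Hth Hr HwY HY.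
  destruct (Hf th r Hth Hr) as (H & Hq & Hp).
  rewrite (quad_inv_commute T _ _ _ _ _ _ L H HY); split; [|apply Hq].
  rewrite <- (quad_inv_commute T _ _ _ _ _ _ L H HY).
  assert (E : p th r Y = plus (minus w (scal (r ^ 2) (q th r w))) (scal (2 * r * cos th) (p th r w))).
  { apply (proj1 L (p th r w)); [|apply H].
    now apply (quad_inv_p_graph T _ _ (q th r) (p th r) w Y L H). }
  apply (norm_le_eq (W := V) _ _ _ E).
  eapply Rle_trans; [apply (norm_triangle (V := V))|].
  eapply Rle_trans; [apply Rplus_le_compat_r, (norm_minus_le (W := V))|].
  rewrite !(norm_scal_real (W := V)).
  assert (Nw := norm_ge_0 w); assert (Hc := COS_bound th).
  assert (B1 : Rabs (r ^ 2) * norm (q th r w) <= C * norm w).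
  { rewrite Rabs_pos_eq by apply pow2_ge_0.
    replace (C * norm w) with (r ^ 2 * (C / r ^ 2 * norm w)) by (field; lra).
    apply Rmult_le_compat_l; [apply pow2_ge_0|apply Hq]. }
  assert (B2 : Rabs (2 * r * cos th) * norm (p th r w) <= 2 * C * norm w).
  { replace (2 * C * norm w) with ((2 * r) * (C / r * norm w)) by (field; lra).
    apply Rmult_le_compat; [apply Rabs_pos|apply norm_ge_0| |apply Hp].
    rewrite Rabs_mult, (Rabs_pos_eq (2 * r)) by lra.
    rewrite <- (Rmult_1_r (2 * r)) at 2; apply Rmult_le_compat_l; [lra|].
    now apply Rabs_le. }
  lra.
Qed.

(** Cauchy's theorem for the resolvent itself: since
    [d_th (- sin th p) = d_r (r^2 q - r cos th p)], the ray of angle [phi] can be turned into the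
    negative half-line, where the integrand vanishes; only the arc at infinity contributes. *)
Lemma integral_p {V : QBanach} (T : op V) C phi0 phi q p (w Y Y' : V) :
  linear_graph T -> 0 < C -> sector_family T C phi0 q p ->
  0 <= phi0 < phi -> phi < PI -> T w Y -> T Y Y' ->
  half_int (fun r => scal (sin phi) (p phi r Y) : V) (scal (PI - phi) Y).
Proof.
  intros L HC Hf Hphi Hphi' HwY HY.
  assert (Hreg : phi0 < phi < 2 * PI - phi0) by lra.
  assert (HcP : forall th r v, phi0 < th < 2 * PI - phi0 -> 0 < r ->
    jointly_continuous (fun th r => p th r v : V) th r).
  { intros th r v Hth Hr; apply op_continuous_const.
    apply (sector_family_continuous T C phi0 q p th r L HC Hf Hth Hr). }
  assert (Hbd := fun th r Hth Hr =>
    quad_inv_p_bounds T C phi0 q p th r w Y Y' L HC Hf Hth Hr HwY HY).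
  set (M := (1 + 3 * C) * norm w + C * norm Y').
  assert (Nw := norm_ge_0 w); assert (NY := norm_ge_0 Y').
  assert (HM1 : 0 <= (1 + 3 * C) * norm w) by (apply Rmult_le_pos; lra).
  assert (HM2 : 0 <= C * norm Y') by (apply Rmult_le_pos; lra).
  destruct (half_int_pos (W := V) (fun r => scal (- sin phi) (p phi r Y) : V) (4 * M) 1 2
    ltac:(lra)) as [I [HI _]].
  - intros r Hr; apply (continuous_scal_r (V := V)).
    apply (jointly_continuous_2 (fun th r => p th r Y)), HcP; easy.
  - intros r Hr; rewrite (norm_scal_real (W := V)), Rabs_Ropp.
    replace (1 - 1) with 0 by ring; rewrite Rpower_O, Rmult_1_l by easy.
    replace (- (2)) with (- INR 2) by (simpl; ring).
    rewrite <- pow_inv_Rpower by lra.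
    apply Rle_trans with (1 * norm (p phi r Y)).
    + apply Rmult_le_compat_r; [apply norm_ge_0|apply Rabs_le, SIN_bound].
    + rewrite Rmult_1_l; destruct (Hbd phi r Hreg Hr) as [B1 B2].
      apply Rmult_le_reg_r with ((1 + r) ^ 2); [apply pow_lt; lra|].
      rewrite Rmult_assoc, Rinv_l, Rmult_1_r by (apply pow_nonzero; lra).
      destruct (Rle_lt_dec r 1) as [H1|H1].
      * apply Rle_trans with (M * (1 + r) ^ 2).
        -- apply Rmult_le_compat_r; [apply pow2_ge_0|unfold M; lra].
        -- rewrite (Rmult_comm 4); apply Rmult_le_compat_l; [unfold M; lra|nra].
      * apply Rle_trans with (C / r ^ 2 * norm Y' * (4 * r ^ 2)).
        -- apply Rmult_le_compat; [apply norm_ge_0|apply pow2_ge_0|easy|nra].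
        -- replace (C / r ^ 2 * norm Y' * (4 * r ^ 2)) with (4 * (C * norm Y')) by (field; lra).
           unfold M; lra.
  (* At the angle [PI] the factor [sin th] vanishes, so the integral there is zero; on arcs
     [r^2 q Y - r cos th p Y] tends to [0] at the origin and to [Y] at infinity. *)
  - assert (E : minus zero I = scal (PI - phi) (minus Y zero)).
    { apply (rotation_half_int (W := V) (fun th r => scal (- sin th) (p th r Y))
        (fun th r => plus (scal (- cos th) (p th r Y))
           (scal (2 * r * (sin th) ^ 2) (p th r (p th r Y))))
        (fun th r => minus (scal (r ^ 2) (q th r Y)) (scal (r * cos th) (p th r Y)))
        phi0 (2 * PI - phi0) phi PI I zero zero Y); try lra; try easy.
      - intros th r Hth Hr.
        assert (D1 : is_derive (fun th => - sin th) th (- cos th)) by (auto_derive; [easy|ring]).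
        assert (D := is_derive_scal_fun (W := V) _ _ _ _ _ D1
          (sector_family_derive_angle T C phi0 q p th r Y L HC Hf Hth Hr)).
        assert (E : plus (scal (- cos th) (p th r Y))
            (scal (- sin th) (scal (- (2 * r * sin th)) (p th r (p th r Y)))) =
          plus (scal (- cos th) (p th r Y)) (scal (2 * r * (sin th) ^ 2) (p th r (p th r Y))))
          by vring.
        exact (eq_rect _ (is_derive (fun th => scal (- sin th) (p th r Y) : V) th) D _ E).
      - intros th r Hth Hr.
        destruct (sector_family_derive_radius T C phi0 q p th r Y L HC Hf Hth Hr) as [Dq Dp].
        assert (D1 : is_derive (fun r => r ^ 2) r (2 * r)) by (auto_derive; [easy|ring]).
        assert (D2 : is_derive (fun r => r * cos th) r (cos th)) by (auto_derive; [easy|ring]).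
        assert (D := is_derive_minus (V := V) _ _ _ _ _ (is_derive_scal_fun (W := V) _ _ _ _ _ D1 Dq)
          (is_derive_scal_fun (W := V) _ _ _ _ _ D2 Dp)).
        destruct (Hf th r Hth Hr) as (H & _).
        assert (E1 := quad_inv_pp T _ _ _ _ Y L H).
        assert (E2 := quad_inv_pq T _ _ _ _ _ _ _ _ Y L H H).
        assert (Hs : sin th ^ 2 = 1 - cos th ^ 2).
        { assert (A := sin2_cos2 th); unfold Rsqr in A; nra. }
        assert (E : minus
          (plus (scal (2 * r) (q th r Y)) (scal (r ^ 2) (minus (scal (2 * cos th) (q th r (p th r Y)))
             (scal (2 * r) (q th r (q th r Y))))))
          (plus (scal (cos th) (p th r Y)) (scal (r * cos th)
             (minus (scal (2 * cos th) (p th r (p th r Y))) (scal (2 * r) (p th r (q th r Y)))))) =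
          plus (scal (- cos th) (p th r Y))
           (scal (2 * r * (sin th) ^ 2) (p th r (p th r Y)))).
        { rewrite Hs, E1, <- E2; vring. }
        exact (eq_rect _ (is_derive (fun r => minus (scal (r ^ 2) (q th r Y))
          (scal (r * cos th) (p th r Y)) : V) r) D _ E).
      - intros th r Hth Hr; apply (continuous_plus (V := V)).
        + apply (continuous_scal_fun (W := V) (fun z : R * R => - cos (fst z))); [|now apply HcP].
          apply (continuous_comp_fst (fun x => - cos x)), (ex_derive_continuous (V := R_NormedModule)).
          auto_derive; easy.
        + apply (continuous_scal_fun (W := V) (fun z : R * R => 2 * snd z * sin (fst z) ^ 2)).
          * apply (continuous_mult (K := R_AbsRing) (fun z : R * R => 2 * snd z)).
            -- apply (continuous_mult (K := R_AbsRing)); [apply continuous_const|apply continuous_snd].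
            -- apply (continuous_comp_fst (fun x => sin x ^ 2)), (ex_derive_continuous (V := R_NormedModule)).
               auto_derive; easy.
          * apply (op_continuous_apply p (fun th r => p th r Y)); [|now apply HcP].
            apply (sector_family_continuous T C phi0 q p th r L HC Hf Hth Hr).
      - intros eps He; apply ends_char.
        set (K1 := (1 + 4 * C) * norm w); set (K2 := 2 * C * norm Y').
        assert (HK1 : 0 <= K1) by (apply Rmult_le_pos; lra).
        assert (HK2 : 0 <= K2) by (unfold K2; nra).
        (* Since [q Y = p w], the first term is at most [r C |w|], and the second at most
           [r (1 + 3 C) |w|]. *)
        assert (Hb1 : forall th r, phi <= th <= PI -> 0 < r ->
          norm (minus (scal (r ^ 2) (q th r Y)) (scal (r * cos th) (p th r Y))) <= r * K1).
        { intros th r Hth Hr; destruct (Hf th r ltac:(lra) Hr) as (H & Hq & Hp).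
          apply Rle_trans with (1 := norm_minus_le (W := V) _ _).
          rewrite !(norm_scal_real (W := V)).
          rewrite <- (quad_inv_commute T _ _ _ _ _ _ L H HwY).
          destruct (Hbd th r ltac:(lra) Hr) as [B _].
          rewrite Rabs_mult, (Rabs_pos_eq r), (Rabs_pos_eq (r ^ 2)) by (try apply pow2_ge_0; lra).
          assert (Hc : Rabs (cos th) <= 1) by apply Rabs_le, COS_bound.
          apply Rle_trans with (r ^ 2 * (C / r * norm w) + r * 1 * ((1 + 3 * C) * norm w)).
          - apply Rplus_le_compat.
            + apply Rmult_le_compat_l; [apply pow2_ge_0|apply Hp].
            + apply Rmult_le_compat; [|apply norm_ge_0| |easy].
              * apply Rmult_le_pos; [lra|apply Rabs_pos].
              * apply Rmult_le_compat_l; lra.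
          - right; unfold K1; field; lra. }
        (* The quadratic relation [p Y' = Y - r^2 q Y + 2 r cos th p Y] turns the difference into
           [r cos th p Y - p Y'], of order [1 / r]. *)
        assert (Hb2 : forall th r, phi <= th <= PI -> 0 < r ->
          norm (minus (minus (scal (r ^ 2) (q th r Y)) (scal (r * cos th) (p th r Y))) Y) <= K2 / r).
        { intros th r Hth Hr; destruct (Hf th r ltac:(lra) Hr) as (H & Hq & Hp).
          assert (EQ : p th r Y' = plus (minus Y (scal (r ^ 2) (q th r Y)))
            (scal (2 * r * cos th) (p th r Y))).
          { apply (proj1 L (p th r Y)); [|apply H].
            now apply (quad_inv_p_graph T _ _ (q th r) (p th r) Y Y' L H). }
          assert (E : minus (minus (scal (r ^ 2) (q th r Y)) (scal (r * cos th) (p th r Y))) Y =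
            minus (scal (r * cos th) (p th r Y)) (p th r Y')) by (rewrite EQ; vring).
          apply (norm_le_eq (W := V) _ _ _ E).
          apply Rle_trans with (1 := norm_minus_le (W := V) _ _).
          rewrite !(norm_scal_real (W := V)).
          destruct (Hbd th r ltac:(lra) Hr) as [_ B].
          rewrite Rabs_mult, (Rabs_pos_eq r) by lra.
          assert (Hc : Rabs (cos th) <= 1) by apply Rabs_le, COS_bound.
          apply Rle_trans with (r * 1 * (C / r ^ 2 * norm Y') + C / r * norm Y').
          - apply Rplus_le_compat; [|apply Hp].
            apply Rmult_le_compat; [|apply norm_ge_0| |easy].
            * apply Rmult_le_pos; [lra|apply Rabs_pos].
            * apply Rmult_le_compat_l; lra.
          - right; unfold K2; field; lra. }
        exists (eps / (K1 + 1)), (Rmax (eps / (K1 + 1)) (K2 / eps)); repeat split.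
        + apply Rdiv_lt_0_compat; lra.
        + apply Rmax_l.
        + assert (E0 : minus (minus (scal (a ^ 2) (q th a Y)) (scal (a * cos th) (p th a Y))) zero =
            minus (scal (a ^ 2) (q th a Y)) (scal (a * cos th) (p th a Y))) by vring.
          apply (norm_le_eq (W := V) _ _ _ E0).
          apply Rle_trans with (1 := Hb1 th a H2 H).
          apply Rle_trans with (eps / (K1 + 1) * (K1 + 1)); [|right; field; lra].
          apply Rmult_le_compat; lra.
        + assert (Hb : 0 < b).
          { apply Rlt_trans with (2 := H1), Rlt_le_trans with (2 := Rmax_l _ _).
            apply Rdiv_lt_0_compat; lra. }
          apply Rle_trans with (1 := Hb2 th b H2 Hb).
          assert (Hb3 : K2 / eps <= b) by (apply Rlt_le, Rle_lt_trans with (2 := H1), Rmax_r).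
          apply Rmult_le_reg_r with b; [easy|].
          replace (K2 / b * b) with (eps * (K2 / eps)) by (field; lra).
          apply Rmult_le_compat_l; lra.
      - apply (half_int_ext (W := V) (fun _ => zero)).
        + intros r _; rewrite sin_PI; vring.
        + exact (half_int_zero (W := V)). }
    assert (EI : scal (-1) I = scal (PI - phi) Y).
    { transitivity (minus zero I); [vring|rewrite E; vring]. }
    assert (HI2 := is_RInt_gen_scal (V := V) _ (-1) _ HI).
    assert (HI3 := eq_rect _ (fun l => half_int _ l) HI2 _ EI).
    revert HI3; apply (half_int_ext (W := V)); intros r Hr; vring.
Qed.

(** * Rational functions of [T] *)

Lemma cis_add x y : cis (x + y) = (cis x * cis y)%C.
Proof. apply Ceq; simpl; [apply cos_plus|rewrite sin_plus; ring]. Qed.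

Lemma cis_INR n x : cis (INR n * x) = (cis x ^ n)%C.
Proof.
  induction n as [|n IH].
  - apply Ceq; simpl; rewrite Rmult_0_l, ?cos_0, ?sin_0; easy.
  - rewrite S_INR, Rmult_plus_distr_r, Rmult_1_l, cis_add, IH; simpl; ring.
Qed.

Lemma ray_cis th r : ray th r = (RtoC r * cis th)%C.
Proof. apply Ceq; simpl; ring. Qed.

(** The scalar corrections of the induction on factors. The line element [e^(i phi) dr] raises the
    exponent to [a = j + 1], which must stay below the degree [p + l] of the denominator. *)
Lemma rational_Im_integral j p l t phi : 0 < t -> 0 <= phi < PI -> (j + 1 < p + l)%nat ->
  half_int (fun r => Im (ray phi r ^ j * / ((ray phi r + RtoC t) ^ p) *
    / ((ray phi r + 1) ^ l) * cis phi)%C) 0.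
Proof.
  intros Ht Hphi Hl; assert (Hpi := PI_RGT_0).
  assert (Hj : 0 < INR (j + 1) < INR (p + l)).
  { split; [apply lt_0_INR; lia|apply lt_INR; lia]. }
  assert (H := ray_fun_Im_integral (INR (j + 1)) p l t phi Ht Hphi Hj).
  revert H; apply half_int_ext_R; intros r Hr; f_equal; unfold ray_fun.
  rewrite plus_INR; simpl (INR 1).
  replace (INR j + 1 - 1) with (INR j) by ring.
  rewrite Rmult_plus_distr_r, Rmult_1_l, cis_add, cis_INR, Rpower_pow, ray_cis by easy.
  rewrite Cpow_mult_l, <- RtoC_pow; ring.
Qed.

(** [- Im (z e^(i phi) (s - T)^(-1))] for [s = r e^(i phi)], written with real operators. *)
Definition res_Im {V : QBanach} (phi r : R) (q p : Bop V) (z : C) (v : V) : V :=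
  minus (scal (Im (z * cis phi)%C) (p v)) (scal (r * Im z) (q v)).

Lemma res_Im_add {V : QBanach} phi r (q p : Bop V) z z' v :
  res_Im phi r q p (z + z')%C v = plus (res_Im phi r q p z v) (res_Im phi r q p z' v).
Proof. unfold res_Im; vring; unfold Im; simpl; ring. Qed.

Lemma res_Im_scal {V : QBanach} phi r (q p : Bop V) (x : R) z v :
  res_Im phi r q p (RtoC x * z)%C v = scal x (res_Im phi r q p z v).
Proof. unfold res_Im; vring; unfold Im; simpl; ring. Qed.

Lemma res_Im_plus {V : QBanach} phi r (q p : Bop V) z u v :
  res_Im phi r q p z (plus u v) = plus (res_Im phi r q p z u) (res_Im phi r q p z v).
Proof. unfold res_Im; bop_push; vring. Qed.

Lemma res_Im_scal_r {V : QBanach} phi r (q p : Bop V) z (x : R) v :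
  res_Im phi r q p z (scal x v) = scal x (res_Im phi r q p z v).
Proof. unfold res_Im; bop_push; vring. Qed.

(** The identity [s (s - T)^(-1) = (s - T)^(-1) T + 1]. *)
Lemma res_Im_mult_ray {V : QBanach} (T : op V) phi r q p z x u : linear_graph T ->
  quad_inv T (2 * r * cos phi) (r ^ 2) q p -> T x u ->
  res_Im phi r q p (z * ray phi r)%C x =
  minus (res_Im phi r q p z u) (scal (Im (z * cis phi)%C) x).
Proof.
  intros L H Hxu; unfold res_Im.
  assert (E1 := quad_inv_commute _ _ _ _ _ _ _ L H Hxu).
  assert (E2 : p u = plus (minus x (scal (r ^ 2) (q x))) (scal (2 * r * cos phi) (p x))).
  { apply (proj1 L (p x)); [|apply H].
    now apply (quad_inv_p_graph T _ _ q p x u L H). }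
  assert (A : Im (z * ray phi r * cis phi)%C =
    r * (2 * cos phi * Im (z * cis phi)%C - Im z)).
  { assert (B := sin2_cos2 phi); unfold Rsqr in B.
    destruct z as [z1 z2]; simpl.
    replace (sin phi * sin phi) with (1 - cos phi * cos phi) in B by lra.
    transitivity (r * (2 * cos phi * (z1 * sin phi) + z2 * (cos phi * cos phi - sin phi * sin phi)));
      [ring|].
    replace (sin phi * sin phi) with (1 - cos phi * cos phi) by (assert (D := sin2_cos2 phi);
      unfold Rsqr in D; lra).
    ring. }
  assert (A' : Im (z * ray phi r)%C = r * Im (z * cis phi)%C).
  { destruct z; simpl; ring. }
  rewrite A, A', E2, <- E1; vring.
Qed.

(** Trades a scalar factor [s/(s+t)] for the operator [T (t+T)^(-1)] on the vector. Writing
    [y = T x + t x] with [x = (t+T)^(-1) y], the factor [s + t] cancels and a scalar multiple of [x]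
    is left over. *)
Lemma res_Im_step {V : QBanach} (T : op V) phi r q p t (St : Bop V) z y : linear_graph T ->
  quad_inv T (2 * r * cos phi) (r ^ 2) q p -> lin_inv T t St ->
  (ray phi r + RtoC t)%C <> 0%C ->
  res_Im phi r q p (z * (ray phi r / (ray phi r + RtoC t)))%C y =
  minus (res_Im phi r q p z (minus y (scal t (St y))))
    (scal (t * Im (z / (ray phi r + RtoC t) * cis phi)%C) (St y)).
Proof.
  intros L H HS Hne.
  set (z' := (z / (ray phi r + RtoC t))%C).
  replace (z * (ray phi r / (ray phi r + RtoC t)))%C with (z' * ray phi r)%C
    by (unfold z'; field; easy).
  set (x := St y : V); set (g := minus y (scal t x) : V).
  assert (Hxg : T x g) by apply HS.
  assert (Ey : y = plus g (scal t x)) by (unfold g; vring).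
  transitivity (res_Im phi r q p (z' * ray phi r)%C (plus g (scal t x))); [f_equal; exact Ey|].
  assert (Ez : z = (z' * ray phi r + RtoC t * z')%C) by (unfold z'; field; easy).
  clearbody z'; rewrite Ez, (res_Im_plus (V := V)), res_Im_scal_r, res_Im_add, res_Im_scal.
  rewrite (res_Im_mult_ray T phi r q p z' x g L H Hxg); vring.
Qed.

(** The same exchange of [1/(s+1)] for [(1+T)^(-1)]. *)
Lemma res_Im_step_1 {V : QBanach} (T : op V) phi r q p (St : Bop V) z y : linear_graph T ->
  quad_inv T (2 * r * cos phi) (r ^ 2) q p -> lin_inv T 1 St ->
  (ray phi r + 1)%C <> 0%C ->
  res_Im phi r q p (z * / (ray phi r + 1))%C y =
  plus (res_Im phi r q p z (St y)) (scal (Im (z / (ray phi r + 1) * cis phi)%C) (St y)).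
Proof.
  intros L H HS Hne.
  set (z' := (z / (ray phi r + 1))%C); fold z'.
  set (x := St y : V); set (g := minus y (scal 1 x) : V).
  assert (Hxg : T x g) by apply HS.
  assert (Ey : y = plus g x) by (unfold g; vring).
  transitivity (res_Im phi r q p z' (plus g x)); [f_equal; exact Ey|].
  assert (Ez : z = (z' * ray phi r + z')%C) by (unfold z'; field; easy).
  clearbody z'; rewrite Ez, (res_Im_plus (V := V)), res_Im_add, (res_Im_mult_ray T phi r q p z' x g L H Hxg); vring.
Qed.

Lemma half_int_scal_vec {V : QBanach} (f : R -> R) (l : R) (v : V) :
  half_int f l -> half_int (fun t => scal (f t) v : V) (scal l v).
Proof.
  apply (half_int_linear (U := R_NormedModule) (W := V) (fun x : R => scal x v)).
  exact (is_linear_scal_l (K := R_AbsRing) (V := V) v).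
Qed.

Lemma half_int_vec_eq {V : QBanach} (f g : R -> V) (l l' : V) :
  (forall t, 0 < t -> f t = g t) -> l = l' -> half_int f l -> half_int g l'.
Proof. intros E <-; now apply (half_int_ext (W := V)). Qed.

(** [T (t+T)^(-1)] in the form [1 - t (t+T)^(-1)], defined on every vector. *)
Definition G_op {V : QBanach} (t : R) (St : Bop V) (y : V) : V := minus y (scal t (St y)).

Lemma iter_comm {A : Type} (f g : A -> A) n x :
  (forall x, f (g x) = g (f x)) -> Nat.iter n f (g x) = g (Nat.iter n f x).
Proof. intros H; induction n as [|n IH]; [easy|]; simpl; now rewrite IH. Qed.

Lemma iter_succ_r {A : Type} (f : A -> A) n x : Nat.iter n f (f x) = f (Nat.iter n f x).
Proof. now apply iter_comm. Qed.

Lemma lin_inv_comm {V : QBanach} (T : op V) s t (Ss St : Bop V) v : linear_graph T ->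
  lin_inv T s Ss -> lin_inv T t St -> Ss (St v) = St (Ss v).
Proof.
  intros L Hs Ht; apply (lin_inv_commute T s Ss St v L Hs); intros w u Hwu.
  now apply (lin_inv_graph T t).
Qed.

Lemma G_op_comm {V : QBanach} (T : op V) s t (Ss St : Bop V) v : linear_graph T ->
  lin_inv T s Ss -> lin_inv T t St -> Ss (G_op t St v) = G_op t St (Ss v).
Proof.
  intros L Hs Ht; unfold G_op; bop_push; now rewrite (lin_inv_comm T s t Ss St v L Hs Ht).
Qed.

(** The Riesz-Dunford integral of [(s/(s+t))^m (1+s)^(-k)] is [(T (t+T)^(-1))^m (1+T)^(-k)]: the
    case [m = k = 1] comes from [integral_p], and each further factor only adds a scalar integral
    that vanishes. *)
Lemma rational_calculus {V : QBanach} (T : op V) C phi0 phi q p t (St S1 : Bop V) (m k : nat) :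
  linear_graph T -> 0 < C -> sector_family T C phi0 q p ->
  0 <= phi0 < phi -> phi < PI -> 0 < t -> lin_inv T t St -> lin_inv T 1 S1 ->
  forall y, half_int (fun r => res_Im phi r (q phi r) (p phi r)
     ((ray phi r / (ray phi r + RtoC t)) ^ S m * / (ray phi r + 1) ^ S k)%C y : V)
   (scal PI (Nat.iter (S k) S1 (Nat.iter (S m) (G_op t St) y))).
Proof.
  intros L HC Hf Hphi Hphi' Ht HSt HS1.
  assert (HQ : forall r, 0 < r ->
    quad_inv T (2 * r * cos phi) (r ^ 2) (q phi r) (p phi r)).
  { intros r Hr; apply (Hf phi r); lra. }
  assert (Nt : forall r, 0 < r -> (ray phi r + RtoC t)%C <> 0%C).
  { intros r Hr; apply ray_plus_neq_0; lra. }
  assert (N1 : forall r, 0 < r -> (ray phi r + 1)%C <> 0%C).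
  { intros r Hr; apply ray_plus_neq_0; lra. }
  induction k as [|k IHk]; [induction m as [|m IHm]|]; intros y.
  - set (g := G_op t St y).
    assert (A1 := integral_p T C phi0 phi q p (S1 (St y)) (S1 g)
      (minus g (scal 1 (S1 g))) L HC Hf Hphi Hphi'
      (lin_inv_graph T 1 S1 _ _ L HS1 (proj1 HSt y)) (proj1 HS1 g)).
    assert (A2 := half_int_scal_vec _ _ (S1 g) (integral_resolvent_Im phi ltac:(lra))).
    (* The three terms of the base case: [A1] contributes [(PI - phi) S1 g], [A2] contributes
       [phi S1 g], and [A3] vanishes, so the total [PI S1 g] is independent of the angle. *)
    assert (A3 := half_int_scal_vec _ _ (St y)
      (rational_Im_integral 0 1 1 t phi Ht ltac:(lra) ltac:(lia))).
    assert (A := is_RInt_gen_minus (V := V) _ _ _ _ (is_RInt_gen_plus (V := V) _ _ _ _ A1 A2)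
      (is_RInt_gen_scal (V := V) _ t _ A3)).
    refine (half_int_vec_eq _ _ _ _ _ _ A).
    + intros r Hr.
      replace ((ray phi r / (ray phi r + RtoC t)) ^ 1 * / (ray phi r + 1) ^ 1)%C with
        (/ (ray phi r + 1) * (ray phi r / (ray phi r + RtoC t)))%C by (simpl; field; split; [apply N1|apply Nt]; easy).
      rewrite (res_Im_step T phi r _ _ t St _ y L (HQ r Hr) HSt (Nt r Hr)).
      replace (/ (ray phi r + 1))%C with (RtoC 1 * / (ray phi r + 1))%C at 2 by ring.
      rewrite (res_Im_step_1 T phi r _ _ S1 _ _ L (HQ r Hr) HS1 (N1 r Hr)).
      fold (G_op t St y); fold g; unfold res_Im at 1.
      replace (Im (RtoC 1 * cis phi)%C) with (sin phi) by (simpl; ring).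
      replace (Im (RtoC 1)) with 0 by easy.
      replace (1 / (ray phi r + 1) * cis phi)%C with (cis phi * / (ray phi r + 1))%C
        by (unfold Cdiv; ring).
      replace (/ (ray phi r + 1) / (ray phi r + RtoC t) * cis phi)%C with
        (ray phi r ^ 0 * / (ray phi r + RtoC t) ^ 1 * / (ray phi r + 1) ^ 1 * cis phi)%C
        by (simpl; field; split; [apply N1|apply Nt]; easy).
      vring.
    + simpl; fold g; vring.
  - assert (A1 := IHm (G_op t St y)).
    assert (A2 := half_int_scal_vec _ _ (St y)
      (rational_Im_integral (S m) (S (S m)) 1 t phi Ht ltac:(lra) ltac:(lia))).
    assert (A := is_RInt_gen_minus (V := V) _ _ _ _ A1 (is_RInt_gen_scal (V := V) _ t _ A2)).
    refine (half_int_vec_eq _ _ _ _ _ _ A).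
    + intros r Hr; assert (Ntr := Nt r Hr); assert (N1r := N1 r Hr).
      replace ((ray phi r / (ray phi r + RtoC t)) ^ S (S m) * / (ray phi r + 1) ^ 1)%C with
        ((ray phi r / (ray phi r + RtoC t)) ^ S m * / (ray phi r + 1) ^ 1 *
         (ray phi r / (ray phi r + RtoC t)))%C by (rewrite (Cpow_S _ (S m)); ring).
      rewrite (res_Im_step T phi r _ _ t St _ y L (HQ r Hr) HSt (Nt r Hr)); fold (G_op t St y).
      replace ((ray phi r / (ray phi r + RtoC t)) ^ S m * / (ray phi r + 1) ^ 1 /
        (ray phi r + RtoC t) * cis phi)%C with
        (ray phi r ^ S m * / (ray phi r + RtoC t) ^ S (S m) * / (ray phi r + 1) ^ 1 * cis phi)%C.
      * vring.
      * unfold Cdiv; rewrite Cpow_mult_l, Cpow_inv by easy; rewrite (Cpow_S _ (S m)).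
        field; repeat split; try easy; now apply Cpow_nz.
    + rewrite iter_succ_r; simpl; vring.
  - assert (A1 := IHk (S1 y)).
    assert (A2 := half_int_scal_vec _ _ (S1 y)
      (rational_Im_integral (S m) (S m) (S (S k)) t phi Ht ltac:(lra) ltac:(lia))).
    assert (A := is_RInt_gen_plus (V := V) _ _ _ _ A1 A2).
    refine (half_int_vec_eq _ _ _ _ _ _ A).
    + intros r Hr; assert (Ntr := Nt r Hr); assert (N1r := N1 r Hr).
      assert (E : (/ (ray phi r + 1) ^ S (S k) = / (ray phi r + 1) ^ S k * / (ray phi r + 1))%C).
      { rewrite (Cpow_S _ (S k)); field; split; [easy|now apply Cpow_nz]. }
      replace ((ray phi r / (ray phi r + RtoC t)) ^ S m * / (ray phi r + 1) ^ S (S k))%C with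
        ((ray phi r / (ray phi r + RtoC t)) ^ S m * / (ray phi r + 1) ^ S k *
          / (ray phi r + 1))%C by (rewrite E; ring).
      rewrite (res_Im_step_1 T phi r _ _ S1 _ y L (HQ r Hr) HS1 (N1 r Hr)).
      f_equal; f_equal; f_equal.
      unfold Cdiv; rewrite Cpow_mult_l, Cpow_inv by easy.
      rewrite E; ring.
    + rewrite (iter_comm (G_op t St) S1) by (intros x; symmetry; apply (G_op_comm T 1 t S1 St x L HS1 HSt)).
      rewrite iter_succ_r; simpl; vring.
Qed.

Lemma Bop_linear {V : QBanach} (A : Bop V) : is_linear (A : V -> V).
Proof.
  destruct (Bop_bound A) as (C & HC & HA).
  split; [apply bop_add|apply bop_scal|now exists C].
Qed.

Lemma iter_linear {V : QBanach} (A : Bop V) n : is_linear (Nat.iter n A : V -> V).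
Proof.
  induction n as [|n IH]; simpl; [apply is_linear_id|].
  exact (is_linear_comp (Nat.iter n A) A IH (Bop_linear A)).
Qed.

(** Separates the variables: [r/(r+t) <= 1] lowers the exponent to [eps + a], then [eps] of it is
    estimated by [r/t] and [a] of it by [(1+r)/(1+t)]. *)
Lemma ray_power_bound (eps a : R) (m : nat) (r t : R) : 0 < r -> 0 < t -> 0 < eps -> 0 < a ->
  eps + a <= INR m ->
  (r / (r + t)) ^ m <= (Rpower r eps * Rpower t (- eps)) * (Rpower (1 + r) a * Rpower (1 + t) (- a)).
Proof.
  intros Hr Ht He Ha Hm.
  assert (Hx : 0 < r / (r + t)) by (apply Rdiv_lt_0_compat; lra).
  assert (Hx1 : r / (r + t) <= 1).
  { apply Rmult_le_reg_r with (r + t); [lra|]; unfold Rdiv; rewrite Rmult_assoc, Rinv_l; lra. }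
  assert (Hdiv : forall u v c, 0 < u -> 0 < v -> Rpower (u / v) c = Rpower u c * Rpower v (- c)).
  { intros u v c Hu Hv; rewrite Rpower_Ropp.
    assert (P := Rpower_pos v c).
    apply Rmult_eq_reg_r with (Rpower v c); [|lra].
    rewrite Rmult_assoc, Rinv_l, Rmult_1_r by lra.
    rewrite Rpower_mult_distr; [f_equal; field; lra|now apply Rdiv_lt_0_compat|easy]. }
  rewrite <- Rpower_pow by easy.
  apply Rle_trans with (Rpower (r / (r + t)) (eps + a)).
  - unfold Rpower; apply exp_increasing_le.
    assert (ln (r / (r + t)) <= 0).
    { rewrite <- ln_1; destruct Hx1 as [H|H]; [now apply Rlt_le, ln_increasing|rewrite H; lra]. }
    nra.
  - rewrite Rpower_plus, <- !Hdiv by lra.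
    apply Rmult_le_compat; try (apply Rlt_le, Rpower_pos); apply Rle_Rpower_l; try lra; split; try easy.
    + apply Rmult_le_compat_l; [lra|]; apply Rinv_le_contravar; lra.
    + apply Rmult_le_reg_r with ((r + t) * (1 + t)); [nra|].
      replace (r / (r + t) * ((r + t) * (1 + t))) with (r * (1 + t)) by (field; lra).
      replace ((1 + r) / (1 + t) * ((r + t) * (1 + t))) with ((1 + r) * (r + t)) by (field; lra).
      nra.
Qed.

Lemma Cmod_kernel_le c phi : -1 < c <= cos phi -> forall m k, exists K, 0 < K /\
  forall r t, 0 < r -> 0 < t ->
    Cmod ((ray phi r / (ray phi r + RtoC t)) ^ m * / (ray phi r + 1) ^ k)%C <=
    K * ((r / (r + t)) ^ m * Rpower (1 + r) (- INR k)).
Proof.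
  intros Hc m k; assert (Hc1 := COS_bound phi).
  set (kk := sqrt ((1 + c) / 2)); assert (Hk : 0 < kk) by (apply sqrt_lt_R0; lra).
  exists (/ kk ^ m * / kk ^ k); split.
  { apply Rmult_lt_0_compat; apply Rinv_0_lt_compat; now apply pow_lt. }
  intros r t Hr Ht.
  assert (G1 := Cmod_ray_plus_ge c phi r t ltac:(lra) ltac:(lra) ltac:(lra)).
  assert (G2 := Cmod_ray_plus_ge c phi r 1 ltac:(lra) ltac:(lra) ltac:(lra)).
  fold kk in G1, G2.
  assert (P1 : 0 < kk * (r + t)) by (apply Rmult_lt_0_compat; lra).
  assert (P2 : 0 < kk * (r + 1)) by (apply Rmult_lt_0_compat; lra).
  rewrite Cmod_mult, Cmod_pow.
  replace (/ kk ^ m * / kk ^ k * ((r / (r + t)) ^ m * Rpower (1 + r) (- INR k))) with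
    ((r / (kk * (r + t))) ^ m * / (kk * (r + 1)) ^ k).
  - apply Rmult_le_compat; try apply pow_le; try apply Cmod_ge_0.
    + apply pow_incr; split; [apply Cmod_ge_0|].
      unfold Cdiv; rewrite Cmod_mult; apply Rmult_le_compat; try apply Cmod_ge_0.
      * rewrite ray_cis, Cmod_mult, Cmod_cis, Cmod_R, Rabs_pos_eq by lra; lra.
      * now apply Cmod_inv_le.
    + now apply Cmod_pow_inv_le.
  - rewrite <- pow_inv_Rpower by lra; rewrite (Rplus_comm r 1).
    unfold Rdiv; rewrite !Rpow_mult_distr, !pow_inv, !Rpow_mult_distr, !Rinv_mult; ring.
Qed.

Lemma res_Im_norm_le {V : QBanach} phi r C (q p : Bop V) z v : 0 < r ->
  norm (q v) <= C / r ^ 2 * norm v -> norm (p v) <= C / r * norm v ->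
  norm (res_Im phi r q p z v) <= 2 * C * / r * norm v * Cmod z.
Proof.
  intros Hr Hq Hp; unfold res_Im.
  apply Rle_trans with (1 := norm_minus_le (W := V) _ _); rewrite !(norm_scal_real (W := V)).
  assert (A : Rabs (Im (z * cis phi)%C) <= Cmod z).
  { apply Rle_trans with (1 := im_le_Cmod _); rewrite Cmod_mult, Cmod_cis; lra. }
  assert (B : Rabs (r * Im z) <= r * Cmod z).
  { rewrite Rabs_mult, Rabs_pos_eq by lra; apply Rmult_le_compat_l; [lra|apply im_le_Cmod]. }
  apply Rle_trans with (Cmod z * (C / r * norm v) + r * Cmod z * (C / r ^ 2 * norm v)).
  - apply Rplus_le_compat; apply Rmult_le_compat; try easy; try apply Rabs_pos; apply norm_ge_0.
  - right; field; lra.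
Qed.

Lemma res_Im_eq {V : QBanach} phi r (q p : Bop V) (z z1 z2 : C) v :
  z1 = (z * cis phi)%C -> z2 = z ->
  minus (scal (Im z1) (p v)) (scal (r * Im z2) (q v)) = res_Im phi r q p z v.
Proof. now intros -> ->. Qed.

(** The double integral of [t^(a-1)] times the rational calculus kernel. The inner integral in [r]
    is [rational_calculus], the inner integral in [t] is [Stieltjes_power]; equating the two orders
    of integration gives the relation between [LB] and [w]. *)
Lemma Balakrishnan_core {V : QBanach} (T : op V) C phi0 phi q p (S : R -> Bop V)
    (a K : R) (m k : nat) (v w LB : V) :
  linear_graph T -> 0 < C -> sector_family T C phi0 q p ->
  0 <= phi0 < phi -> phi < PI -> (forall t, 0 < t -> lin_inv T t (S t)) ->
  0 < a -> a < INR m -> a < INR k ->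
  half_int (fun t => Rpower t (a - 1) * / (t + 1) ^ m) K ->
  half_int (fun t => scal (Rpower t (a - 1)) (Nat.iter m (G_op t (S t)) v) : V) w ->
  half_int (fun r => res_Im phi r (q phi r) (p phi r)
    (RtoC (Rpower r a) * cis (a * phi) * / (ray phi r + 1) ^ k)%C v) LB ->
  scal K LB = scal PI (Nat.iter k (S 1) w).
Proof.
  intros L HC Hf Hphi Hphi' HS Ha Hm Hk HK Hw HLB.
  assert (Hreg : phi0 < phi < 2 * PI - phi0) by lra.
  (* Half of the smallest gap makes [t^(a-eps-1) (1+t)^(-a)] and [r^(eps-1) (1+r)^(a-k)] integrable,
     and leaves [eps + a <= m] for [ray_power_bound]. *)
  set (eps := Rmin a (Rmin (INR m - a) (INR k - a)) / 2).
  assert (He : 0 < eps /\ eps < a /\ eps < INR m - a /\ eps < INR k - a).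
  { assert (P : 0 < Rmin a (Rmin (INR m - a) (INR k - a))) by (repeat apply Rmin_pos; lra).
    assert (P1 := Rmin_l a (Rmin (INR m - a) (INR k - a))).
    assert (P2 := Rmin_r a (Rmin (INR m - a) (INR k - a))).
    assert (P3 := Rmin_l (INR m - a) (INR k - a)); assert (P4 := Rmin_r (INR m - a) (INR k - a)).
    unfold eps; lra. }
  clearbody eps; destruct He as (He0 & He1 & He2 & He3).
  destruct (Cmod_kernel_le (cos phi) phi ltac:(split; [apply cos_gt_m1; lra|lra]) m k)
    as (M & HM & HMle).
  set (h := fun t r => ((ray phi r / (ray phi r + RtoC t)) ^ m * / (ray phi r + 1) ^ k)%C).
  set (f := fun t r => scal (Rpower t (a - 1)) (res_Im phi r (q phi r) (p phi r) (h t r) v) : V).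
  assert (Nv := norm_ge_0 v).
  set (C0 := 2 * C * norm v * M).
  assert (HC0 : 0 <= C0) by (unfold C0; repeat apply Rmult_le_pos; lra).
  symmetry.
  apply (Fubini_half_int (W := V) f (C0 * 4 * 4) (Rmin (a - eps) (a - (a - eps)))
    (Rmin eps (INR k - a - eps))
    (fun t => scal (Rpower t (a - 1)) (scal PI (Nat.iter k (S 1) (Nat.iter m (G_op t (S t)) v))))
    (fun r => res_Im phi r (q phi r) (p phi r)
      (RtoC K * (RtoC (Rpower r a) * cis (a * phi) * / (ray phi r + 1) ^ k))%C v)).
  - apply Rmin_pos; lra.
  - apply Rmin_pos; lra.
  - intros t r Ht Hr.
    assert (Ntr := ray_plus_neq_0 phi r t ltac:(lra) Hr Ht).
    assert (N1r := ray_plus_neq_0 phi r 1 ltac:(lra) Hr Rlt_0_1).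
    assert (Hh : ccont (fun z : R * R => h (fst z) (snd z)) (t, r)).
    { assert (Hray : ccont (fun z : R * R => ray phi (snd z)) (t, r)).
      { split; apply (continuous_mult (K := R_AbsRing) (fun z : R * R => snd z));
          try apply continuous_snd; apply continuous_const. }
      unfold h; apply ccont_mult.
      - apply ccont_pow, ccont_mult; [easy|]; apply ccont_inv; [easy|].
        apply ccont_plus; [easy|apply ccont_RtoC, continuous_fst].
      - apply ccont_inv; [now apply Cpow_nz|]; apply ccont_pow, ccont_plus; [easy|apply ccont_const]. }
    destruct (sector_family_continuous T C phi0 q p phi r L HC Hf Hreg Hr) as [Cq Cp].
    assert (Hop : forall A : R -> R -> Bop V, op_continuous A phi r ->
      continuous (fun z : R * R => A phi (snd z) v : V) (t, r)).
    { intros A HA; apply (continuous_comp snd (fun r => A phi r v : V)); [apply continuous_snd|].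
      apply (jointly_continuous_2 (fun th r => A th r v)); now apply op_continuous_const. }
    apply (continuous_scal_fun (W := V) (fun z : R * R => Rpower (fst z) (a - 1))).
    { apply (continuous_comp_fst (fun t => Rpower t (a - 1))); now apply continuous_Rpower. }
    apply (continuous_minus (V := V)).
    + apply (continuous_scal_fun (W := V)
        (fun z : R * R => Im (h (fst z) (snd z) * cis phi)%C)); [|now apply Hop].
      apply (ccont_mult (fun z : R * R => h (fst z) (snd z)) (fun _ => cis phi)); [easy|apply ccont_const].
    + apply (continuous_scal_fun (W := V)
        (fun z : R * R => snd z * Im (h (fst z) (snd z))%C)); [|now apply Hop].
      apply (continuous_mult (K := R_AbsRing) (fun z : R * R => snd z)); [apply continuous_snd|apply Hh].
  - intros t r Ht Hr; unfold f; rewrite (norm_scal_real (W := V)).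
    rewrite Rabs_pos_eq by apply Rlt_le, Rpower_pos.
    destruct (Hf phi r Hreg Hr) as (_ & Hq & Hp).
    assert (D1 := kap_dominates (a - eps) a t Ht ltac:(lra)).
    assert (D2 := kap_dominates eps (INR k - a) r Hr ltac:(lra)).
    assert (P1 := Rpower_pos t (a - 1)).
    apply Rle_trans with (C0 * (Rpower t (a - eps - 1) * Rpower (1 + t) (- a)) *
      (Rpower r (eps - 1) * Rpower (1 + r) (- (INR k - a)))).
    + apply Rle_trans with (Rpower t (a - 1) * (2 * C * / r * norm v *
        (M * ((Rpower r eps * Rpower t (- eps)) * (Rpower (1 + r) a * Rpower (1 + t) (- a)) *
          Rpower (1 + r) (- INR k))))).
      * apply Rmult_le_compat_l; [lra|].
        apply Rle_trans with (1 := res_Im_norm_le phi r C _ _ (h t r) v Hr (Hq v) (Hp v)).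
        apply Rmult_le_compat_l.
        { repeat apply Rmult_le_pos; try lra; now apply Rlt_le, Rinv_0_lt_compat. }
        apply Rle_trans with (1 := HMle r t Hr Ht), Rmult_le_compat_l; [lra|].
        apply Rmult_le_compat_r; [apply Rlt_le, Rpower_pos|].
        apply ray_power_bound; lra.
      * right; unfold C0.
        replace (a - eps - 1) with ((a - 1) + - eps) by ring.
        replace (- (INR k - a)) with (a + - INR k) by ring.
        replace (eps - 1) with (eps + - (1)) by ring.
        rewrite !Rpower_plus, (Rpower_Ropp r 1), Rpower_1 by easy; ring.
    + set (k1 := kap (Rmin (a - eps) _) t) in *; set (k2 := kap (Rmin eps _) r) in *.
      replace (C0 * 4 * 4 * k1 * k2) with (C0 * (4 * k1) * (4 * k2)) by ring.
      assert (Q1 := Rpower_pos t (a - eps - 1)); assert (Q2 := Rpower_pos (1 + t) (- a)).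
      assert (Q3 := Rpower_pos r (eps - 1)); assert (Q4 := Rpower_pos (1 + r) (- (INR k - a))).
      apply Rmult_le_compat; try easy.
      * repeat apply Rmult_le_pos; lra.
      * apply Rmult_le_pos; lra.
      * apply Rmult_le_compat_l; easy.
  - intros t Ht.
    destruct m as [|m']; [simpl in Hm; lra|]; destruct k as [|k']; [simpl in Hk; lra|].
    assert (H := rational_calculus T C phi0 phi q p t (S t) (S 1) m' k' L HC Hf Hphi Hphi' Ht
      (HS t Ht) (HS 1 Rlt_0_1) v).
    exact (is_RInt_gen_scal (V := V) _ (Rpower t (a - 1)) _ H).
  - intros r Hr.
    assert (H := Stieltjes_power a m phi r K ltac:(lra) ltac:(lra) Hr HK).
    apply (chalf_int_scal _ _ (/ (ray phi r + 1) ^ k)%C) in H.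
    assert (H1 := half_int_scal_vec _ _ (p phi r v) (proj2 (chalf_int_scal _ _ (cis phi) H))).
    assert (H2 := half_int_scal_vec _ _ (q phi r v) (half_int_const_mult _ _ r (proj2 H))).
    assert (H3 := is_RInt_gen_minus (V := V) _ _ _ _ H1 H2).
    refine (half_int_vec_eq _ _ _ _ _ _ H3).
    + intros t Ht; unfold f, h; rewrite <- res_Im_scal; apply res_Im_eq; ring.
    + apply res_Im_eq; ring.
  - assert (HL : is_linear (fun u : V => scal PI (Nat.iter k (S 1) u))).
    { apply (is_linear_comp (Nat.iter k (S 1)) (fun u : V => scal PI u)); [apply iter_linear|].
      exact (is_linear_scal_r (K := R_AbsRing) (V := V) PI Rmult_comm). }
    assert (H := half_int_linear (U := V) (W := V) _ HL _ _ Hw).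
    revert H; apply (half_int_ext (W := V)); intros t Ht.
    rewrite (linear_scal _ (iter_linear (S 1) k)); vring.
  - assert (H := is_RInt_gen_scal (V := V) _ K _ HLB).
    revert H; apply (half_int_ext (W := V)); intros r Hr; symmetry; apply res_Im_scal.
Qed.

(** * Quaternions *)

Lemma quat_eq (p q : quat) : q0 p = q0 q -> q1 p = q1 q -> q2 p = q2 q -> q3 p = q3 q -> p = q.
Proof. destruct p, q; simpl; congruence. Qed.

(** For an imaginary unit [J] this is the isometric ring embedding of the complex numbers onto
    [C_J]; computations in that plane are carried out in [C]. *)
Definition emb (J : quat) (z : C) : quat := qadd (qreal (Re z)) (qscale (Im z) J).

Definition qpoint (J : quat) (th r : R) : quat := qscale r (qcis J th).

Lemma imag_unit_sq (J : quat) : imag_unit J -> q0 J = 0 /\ q1 J ^ 2 + q2 J ^ 2 + q3 J ^ 2 = 1.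
Proof.
  intros [H0 H1]; split; [easy|]; unfold qabs in H1; rewrite H0 in H1.
  set (u := q1 J ^ 2 + q2 J ^ 2 + q3 J ^ 2).
  replace (0 ^ 2 + q1 J ^ 2 + q2 J ^ 2 + q3 J ^ 2) with u in H1 by (unfold u; ring).
  assert (Hu : 0 <= u) by (unfold u; nra).
  rewrite <- (sqrt_sqrt u Hu), H1; ring.
Qed.

Lemma emb_qpoint J th r : emb J (ray th r) = qpoint J th r.
Proof. apply quat_eq; simpl; unfold Re, Im; simpl; ring. Qed.

Lemma emb_mult J z w : imag_unit J -> emb J (z * w)%C = qmul (emb J z) (emb J w).
Proof.
  intros HJ; destruct (imag_unit_sq J HJ) as [H0 H1].
  apply quat_eq; simpl; unfold Re, Im; simpl; rewrite H0; try ring.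
  transitivity (fst z * fst w - snd z * snd w * (q1 J ^ 2 + q2 J ^ 2 + q3 J ^ 2)); [|ring].
  rewrite H1; ring.
Qed.

Lemma qabs_emb J z : imag_unit J -> qabs (emb J z) = Cmod z.
Proof.
  intros HJ; destruct (imag_unit_sq J HJ) as [H0 H1].
  unfold qabs, Cmod; f_equal; simpl; unfold Re, Im; rewrite H0.
  transitivity (fst z ^ 2 + snd z ^ 2 * (q1 J ^ 2 + q2 J ^ 2 + q3 J ^ 2)); [ring|].
  rewrite H1; ring.
Qed.

Lemma emb_conj J z : imag_unit J -> emb J (Cconj z) = qconj (emb J z).
Proof.
  intros HJ; destruct (imag_unit_sq J HJ) as [H0 _].
  apply quat_eq; simpl; unfold Re, Im; simpl; rewrite ?H0; ring.
Qed.

Lemma emb_inv J z : imag_unit J -> emb J (/ z)%C = qinv (emb J z).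
Proof.
  intros HJ; unfold qinv; rewrite qabs_emb, <- emb_conj by easy.
  rewrite <- Cmod_sq; apply quat_eq; simpl; unfold Re, Im, Rdiv; ring.
Qed.

Lemma emb_pow J z n : imag_unit J -> emb J (z ^ n)%C = qpow (emb J z) n.
Proof.
  intros HJ; induction n as [|n IH]; [apply quat_eq; simpl; ring|].
  simpl; now rewrite <- IH, <- emb_mult.
Qed.

Lemma qabs_scale x p : qabs (qscale x p) = Rabs x * qabs p.
Proof.
  unfold qabs; simpl.
  rewrite <- sqrt_Rsqr_abs, <- sqrt_mult_alt by apply Rle_0_sqr.
  f_equal; unfold Rsqr; ring.
Qed.

Lemma qabs_qpoint J th r : imag_unit J -> 0 <= r -> qabs (qpoint J th r) = r.
Proof.
  intros HJ Hr; rewrite <- emb_qpoint, qabs_emb, ray_cis, Cmod_mult, Cmod_cis, Cmod_R by easy.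
  rewrite Rabs_pos_eq; lra.
Qed.

Lemma q0_qpoint J th r : imag_unit J -> q0 (qpoint J th r) = r * cos th.
Proof. intros [H0 _]; simpl; rewrite H0; ring. Qed.

Lemma qarg_qpoint J th r : imag_unit J -> 0 < r -> 0 <= th <= PI -> qarg (qpoint J th r) = th.
Proof.
  intros HJ Hr Hth; unfold qarg; rewrite q0_qpoint, qabs_qpoint by (easy || lra).
  replace (r * cos th / r) with (cos th) by (field; lra); now apply acos_cos.
Qed.

Lemma imag_unit_opp J : imag_unit J -> imag_unit (qopp J).
Proof.
  intros [H0 H1]; split; [simpl; rewrite H0; ring|].
  rewrite <- H1; unfold qabs; simpl; f_equal; ring.
Qed.

Lemma qpoint_neg J th r : qpoint J (- th) r = qpoint (qopp J) th r.
Proof. apply quat_eq; simpl; rewrite ?cos_neg, ?sin_neg; ring. Qed.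

Lemma qdir_qpoint J th r : imag_unit J -> 0 < r -> 0 < th < PI -> qdir (qpoint J th r) = J.
Proof.
  intros HJ Hr Hth; destruct (imag_unit_sq J HJ) as [H0 _].
  assert (Hs0 : 0 < sin th) by (apply sin_gt_0; lra).
  assert (Hs : 0 < r * sin th) by now apply Rmult_lt_0_compat.
  assert (E : qim (qpoint J th r) = qscale (r * sin th) J).
  { apply quat_eq; simpl; rewrite ?H0; ring. }
  assert (E2 : qabs (qim (qpoint J th r)) = r * sin th).
  { rewrite E, qabs_scale, (proj2 HJ), Rabs_pos_eq; lra. }
  unfold qdir; destruct (Req_EM_T _ _) as [H|H]; [lra|].
  rewrite E2, E; apply quat_eq; simpl; field; lra.
Qed.

Lemma qpower_qpoint J th r a : imag_unit J -> 0 < r -> 0 < th < PI ->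
  qpower (qpoint J th r) a = emb J (RtoC (Rpower r a) * cis (a * th))%C.
Proof.
  intros HJ Hr Hth; unfold qpower.
  rewrite qdir_qpoint, qarg_qpoint, qabs_qpoint by (easy || lra).
  apply quat_eq; simpl; unfold Rpower, Re, Im; simpl; ring.
Qed.

Lemma emb_opp J z : emb (qopp J) z = emb J (Cconj z).
Proof. apply quat_eq; simpl; unfold Re, Im; simpl; ring. Qed.

(** [qarg] takes values in [[0, PI]], so a point at a negative angle in [C_J] is read as a point at
    the opposite angle in the plane of [- J], whose embedding is the conjugate one. *)
Lemma qpower_qpoint_neg J th r a : imag_unit J -> 0 < r -> 0 < th < PI ->
  qpower (qpoint J (- th) r) a = emb J (RtoC (Rpower r a) * cis (a * - th))%C.
Proof.
  intros HJ Hr Hth; rewrite qpoint_neg, qpower_qpoint, emb_opp by (easy || now apply imag_unit_opp).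
  f_equal; replace (a * - th) with (- (a * th)) by ring.
  apply Ceq; simpl; rewrite ?cos_neg, ?sin_neg; ring.
Qed.

Lemma regularizer_qpoint J th r a k : imag_unit J -> 0 < r -> - PI < th < PI -> th <> 0 ->
  qmul (qpower (qpoint J th r) a) (qinv (qpow (qadd (qreal 1) (qpoint J th r)) k)) =
  emb J (RtoC (Rpower r a) * cis (a * th) * / (ray th r + 1) ^ k)%C.
Proof.
  intros HJ Hr Hth Hne.
  assert (E : qpower (qpoint J th r) a = emb J (RtoC (Rpower r a) * cis (a * th))%C).
  { destruct (Rlt_le_dec 0 th) as [H|H]; [apply qpower_qpoint; easy|].
    rewrite <- (Ropp_involutive th) at 1 2; apply qpower_qpoint_neg; try easy; lra. }
  assert (E1 : qadd (qreal 1) (qpoint J th r) = emb J (ray th r + 1)%C).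
  { apply quat_eq; simpl; ring. }
  rewrite E, E1, <- emb_pow, <- emb_inv, <- emb_mult by easy; easy.
Qed.

Lemma qabs_dot_le (p q : quat) :
  q0 p * q0 q + q1 p * q1 q + q2 p * q2 q + q3 p * q3 q <= qabs p * qabs q.
Proof.
  unfold qabs; rewrite <- sqrt_mult_alt by nra.
  apply Rsqr_incr_0_var; [|apply sqrt_pos]; rewrite Rsqr_sqrt by (apply Rmult_le_pos; nra).
  unfold Rsqr.
  (* Lagrange's identity: the defect in the Cauchy-Schwarz inequality is the sum of these six
     squares. *)
  assert (H01 := pow2_ge_0 (q0 p * q1 q - q1 p * q0 q)).
  assert (H02 := pow2_ge_0 (q0 p * q2 q - q2 p * q0 q)).
  assert (H03 := pow2_ge_0 (q0 p * q3 q - q3 p * q0 q)).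
  assert (H12 := pow2_ge_0 (q1 p * q2 q - q2 p * q1 q)).
  assert (H13 := pow2_ge_0 (q1 p * q3 q - q3 p * q1 q)).
  assert (H23 := pow2_ge_0 (q2 p * q3 q - q3 p * q2 q)).
  nra.
Qed.

Lemma qabs_sq p : qabs p ^ 2 = q0 p ^ 2 + q1 p ^ 2 + q2 p ^ 2 + q3 p ^ 2.
Proof. unfold qabs; rewrite pow2_sqrt; [easy|nra]. Qed.

Lemma qabs_pos p : 0 <= qabs p.
Proof. apply sqrt_pos. Qed.

Lemma qabs_triangle p q : qabs (qadd p q) <= qabs p + qabs q.
Proof.
  assert (Hp := qabs_pos p); assert (Hq := qabs_pos q).
  apply Rsqr_incr_0_var; [|lra]; rewrite !Rsqr_pow2, qabs_sq; simpl q0; simpl q1; simpl q2; simpl q3.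
  assert (H := qabs_dot_le p q); assert (Ep := qabs_sq p); assert (Eq := qabs_sq q); nra.
Qed.

Lemma q0_le_qabs p : Rabs (q0 p) <= qabs p.
Proof.
  apply Rsqr_incr_0_var; [|apply qabs_pos]; rewrite !Rsqr_pow2, pow2_abs, qabs_sq; nra.
Qed.

(** Points of the open sector satisfy [q0 p > cos psi |p|]. A perturbation of size less than [e],
    half the gap at [s], changes each side by at most [e], so none of them is that close to [s]. *)
Lemma not_closed_sector psi s : 0 <= psi <= PI -> q0 s < cos psi * qabs s -> ~ closed_sector psi s.
Proof.
  intros Hpsi Hs [[E (x & Hx & ->)]|[Hp H]].
  - rewrite E, cos_0, Rmult_1_l in Hs; simpl in Hs.
    replace (qabs (qreal x)) with x in Hs; [lra|].
    unfold qabs; simpl; replace (x * (x * 1) + 0 * (0 * 1) + 0 * (0 * 1) + 0 * (0 * 1)) with (x * x) by ring.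
    symmetry; now apply sqrt_square.
  - destruct (H ((cos psi * qabs s - q0 s) / 2) ltac:(lra)) as (p & (Hp0 & Harg) & Hd).
    set (e := (cos psi * qabs s - q0 s) / 2) in *.
    assert (Hpos : 0 < qabs p).
    { destruct (qabs_pos p) as [Hlt|E0]; [easy|exfalso; apply Hp0].
      assert (E := qabs_sq p); rewrite <- E0 in E.
      apply quat_eq; simpl; nra. }
    assert (Hq := q0_le_qabs p).
    assert (Hrange : -1 <= q0 p / qabs p <= 1).
    { assert (A : Rabs (q0 p / qabs p) <= 1).
      { unfold Rdiv; rewrite Rabs_mult, Rabs_inv, (Rabs_pos_eq (qabs p)) by lra.
        apply Rmult_le_reg_r with (qabs p); [easy|].
        rewrite Rmult_assoc, Rinv_l; lra. }
      unfold Rabs in A; destruct (Rcase_abs _); lra. }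
    assert (Hcos : cos psi < q0 p / qabs p).
    { unfold qarg in Harg; rewrite <- (cos_acos (q0 p / qabs p)) by easy.
      assert (B := acos_bound (q0 p / qabs p)).
      apply cos_decreasing_1; lra. }
    assert (Hc2 : cos psi * qabs p < q0 p).
    { apply Rmult_lt_compat_r with (r := qabs p) in Hcos; [|easy].
      unfold Rdiv in Hcos; rewrite Rmult_assoc, Rinv_l in Hcos; lra. }
    assert (H1 : Rabs (q0 s - q0 p) < e).
    { apply Rle_lt_trans with (2 := Hd); exact (q0_le_qabs (qadd s (qopp p))). }
    assert (H2 : qabs s <= qabs p + e).
    { replace s with (qadd p (qadd s (qopp p))) by (apply quat_eq; simpl; ring).
      apply Rle_trans with (1 := qabs_triangle _ _); lra. }
    assert (H3 : qabs p <= qabs s + e).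
    { replace p with (qadd s (qopp (qadd s (qopp p)))) at 1 by (apply quat_eq; simpl; ring).
      apply Rle_trans with (1 := qabs_triangle _ _).
      replace (qabs (qopp (qadd s (qopp p)))) with (qabs (qadd s (qopp p))); [lra|].
      unfold qabs; simpl; f_equal; ring. }
    apply Rabs_def2 in H1; assert (Hc := COS_bound psi).
    assert (Habs : cos psi * qabs s - e <= cos psi * qabs p).
    { destruct (Rle_lt_dec 0 (cos psi)); nra. }
    assert (Ee : 2 * e = cos psi * qabs s - q0 s) by (unfold e; field).
    lra.
Qed.

(** * Sectorial operators *)

Lemma closed_operator_linear {V : QBanach} (T : op V) : closed_operator T -> linear_graph T.
Proof.
  intros (H1 & _ & H3 & H4 & _); split; [easy|split; [easy|]].
  intros v w x H; rewrite <- !ract_real; now apply H4.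
Qed.

Lemma Qop_char {V : QBanach} (T : op V) s v w : linear_graph T ->
  Qop s T v w <-> exists u z, T v u /\ T u z /\
    w = plus (minus z (scal (2 * q0 s) u)) (scal (qabs s ^ 2) v).
Proof.
  intros L; split.
  - intros (a & b & (a1 & b1 & (u & (u1 & Hu1 & Hu) & Hz) & (b2 & (u2 & Hu2 & ->) & ->) & ->) &
      (b3 & Hb3 & ->) & ->).
    change (u1 = v) in Hu1; change (b3 = v) in Hb3; subst u1 b3.
    rewrite (proj1 L v u2 u Hu2 Hu).
    exists u, a1; repeat split; try easy; vring.
  - intros (u & z & Hu & Hz & ->).
    exists (minus z (scal (2 * q0 s) u)), (scal (qabs s ^ 2) v); repeat split.
    + exists z, (scal (-1) (scal (2 * q0 s) u)); repeat split.
      * exists u; split; [|easy]; exists v; split; [|easy]; reflexivity.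
      * exists (scal (2 * q0 s) u); split; [|easy]; now exists u.
      * vring.
    + exists v; split; reflexivity.
Qed.

Lemma S_R_char {V : QBanach} (T : op V) s (q : Bop V) (p : V -> V) v w : linear_graph T ->
  is_bop (op_inv (Qop s T)) q -> (forall v, T (q v) (p v)) ->
  S_R s T v w <-> w = minus (lact (qconj s) (q v)) (p v).
Proof.
  intros L Hq Hp; split.
  - intros (y & (x & Hx & (a & b & Ha & (c & (d & Hd & ->) & ->) & ->)) & ->).
    change (d = x) in Hd; subst d.
    apply Hq in Hx; subst x.
    rewrite (proj1 L _ _ _ Ha (Hp v)); vring.
  - intros ->; exists (minus (p v) (lact (qconj s) (q v))); split; [|vring].
    exists (q v); split; [now apply Hq|].
    exists (p v), (scal (-1) (lact (qconj s) (q v))); split; [apply Hp|]; split.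
    + exists (lact (qconj s) (q v)); split; [|easy].
      exists (q v); split; reflexivity.
    + vring.
Qed.

Lemma Qop_quad_inv {V : QBanach} (T : op V) s (q p : Bop V) : linear_graph T ->
  is_bop (op_inv (Qop s T)) q -> (forall v, T (q v) (p v)) ->
  quad_inv T (2 * q0 s) (qabs s ^ 2) q p.
Proof.
  intros L Hq Hp; split; [easy|split].
  - intros v; assert (H := proj2 (Hq v (q v)) eq_refl); apply (Qop_char T s _ _ L) in H.
    destruct H as (u & z & Hu & Hz & E).
    rewrite (proj1 L _ _ _ Hu (Hp v)) in *.
    apply (graph_eq _ _ _ _ _ Hz); [easy|rewrite E at 1; vring].
  - intros v u z Hu Hz; symmetry; apply Hq, (Qop_char T s _ _ L); now exists u, z.
Qed.

Lemma lact_plus_real {V : QBanach} (x y : R) (J : quat) (v : V) :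
  lact (qadd (qreal x) (qscale y J)) v = plus (scal x v) (scal y (lact J v)).
Proof.
  rewrite lact_addl, lact_real; f_equal.
  replace (qscale y J) with (qmul (qreal y) J) by (apply quat_eq; simpl; ring).
  now rewrite lact_mul, lact_real.
Qed.

Lemma lact_emb {V : QBanach} J z (v : V) :
  lact (emb J z) v = plus (scal (Re z) v) (scal (Im z) (lact J v)).
Proof. apply lact_plus_real. Qed.

(** Averaging the bounds for [J] and [- J] separates the two components of [S_R], and
    [q = a^2 + b^2] for [a = r cos th q - p] and [b = r sin th q]. *)
Lemma Sect_resolvent_bounds {V : QBanach} (T : op V) (J : quat) (C th r : R) :
  linear_graph T -> imag_unit J -> 0 < C -> 0 < r ->
  rho_S T (qpoint J th r) ->
  bounded_by (S_R (qpoint J th r) T) (C / r) ->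
  bounded_by (S_R (qpoint J (- th) r) T) (C / r) ->
  exists q p : Bop V, is_bop (op_inv (Qop (qpoint J th r) T)) q /\ (forall v, T (q v) (p v)) /\
    quad_inv T (2 * r * cos th) (r ^ 2) q p /\
    (forall v, norm (q v) <= (C + 2 * C ^ 2) / r ^ 2 * norm v) /\
    (forall v, norm (p v) <= (C + 2 * C ^ 2) / r * norm v).
Proof.
  intros L HJ HC Hr [q Hq] (S1 & HS1 & HB1) (S2 & HS2 & HB2).
  set (s := qpoint J th r) in *; set (s' := qpoint J (- th) r) in *.
  assert (Es : q0 s = r * cos th) by now apply q0_qpoint.
  assert (Es' : q0 s' = q0 s) by (rewrite Es; unfold s'; rewrite q0_qpoint, cos_neg; easy).
  assert (As : qabs s = r) by (apply qabs_qpoint; [easy|lra]).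
  assert (As' : qabs s' = r) by (apply qabs_qpoint; [easy|lra]).
  (* The conjugate points [s] and [s'] share real part and modulus, hence the same quadratic
     operator and the same inverse. *)
  assert (Hq' : is_bop (op_inv (Qop s' T)) q).
  { intros v w; rewrite <- (Hq v w); unfold op_inv, Qop; rewrite Es', As', As; easy. }
  assert (Hp0 : forall v, {u | T (q v) u}).
  { intros v; apply constructive_indefinite_description.
    assert (H := proj2 (Hq v (q v)) eq_refl); apply (Qop_char T s _ _ L) in H.
    destruct H as (u & z & Hu & _); now exists u. }
  set (p := fun v => proj1_sig (Hp0 v)).
  assert (Hp : forall v, T (q v) (p v)) by (intros v; apply (proj2_sig (Hp0 v))).
  assert (E1 : forall v, S1 v = minus (lact (qconj s) (q v)) (p v)).
  { intros v; apply (S_R_char T s q p v (S1 v) L Hq Hp); now apply HS1. }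
  assert (E2 : forall v, S2 v = minus (lact (qconj s') (q v)) (p v)).
  { intros v; apply (S_R_char T s' q p v (S2 v) L Hq' Hp); now apply HS2. }
  assert (N1 : forall v, norm (S1 v) <= C / r * norm v).
  { intros v; apply Rle_trans with (1 := opnorm_ge S1 v), Rmult_le_compat_r;
      [apply norm_ge_0|exact HB1]. }
  assert (N2 : forall v, norm (S2 v) <= C / r * norm v).
  { intros v; apply Rle_trans with (1 := opnorm_ge S2 v), Rmult_le_compat_r;
      [apply norm_ge_0|exact HB2]. }
  assert (Ec : qconj s = qadd (qreal (r * cos th)) (qscale (- (r * sin th)) J)).
  { destruct HJ as [H0 _]; apply quat_eq; simpl; rewrite ?H0; ring. }
  assert (Ec' : qconj s' = qadd (qreal (r * cos th)) (qscale (r * sin th) J)).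
  { destruct HJ as [H0 _]; apply quat_eq; simpl; rewrite ?cos_neg, ?sin_neg, ?H0; ring. }
  assert (Na : forall v, norm (minus (scal (r * cos th) (q v)) (p v)) <= C / r * norm v).
  { intros v.
    assert (E : minus (scal (r * cos th) (q v)) (p v) = scal (/ 2) (plus (S1 v) (S2 v))).
    { rewrite E1, E2, Ec, Ec', !lact_plus_real; vring; field. }
    apply (norm_le_eq (W := V) _ _ _ E); rewrite (norm_scal_real (W := V)), Rabs_pos_eq by lra.
    assert (H := norm_triangle (V := V) (S1 v) (S2 v)); assert (A := N1 v); assert (B := N2 v).
    apply Rle_trans with (/ 2 * (C / r * norm v + C / r * norm v)); [|lra].
    apply Rmult_le_compat_l; [lra|]; apply Rle_trans with (1 := H); now apply Rplus_le_compat. }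
  assert (Nb : forall v, norm (scal (r * sin th) (q v)) <= C / r * norm v).
  { intros v.
    assert (E : scal (r * sin th) (lact J (q v)) = scal (/ 2) (minus (S2 v) (S1 v))).
    { rewrite E1, E2, Ec, Ec', !lact_plus_real; vring; field. }
    assert (EN : norm (scal (r * sin th) (q v)) = norm (scal (r * sin th) (lact J (q v)))).
    { rewrite !(norm_scal_real (W := V)), norm_lact, (proj2 HJ); ring. }
    rewrite EN; apply (norm_le_eq (W := V) _ _ _ E).
    rewrite (norm_scal_real (W := V)), Rabs_pos_eq by lra.
    assert (H := norm_minus_le (W := V) (S2 v) (S1 v)); assert (A := N1 v); assert (B := N2 v).
    apply Rle_trans with (/ 2 * (C / r * norm v + C / r * norm v)); [|lra].
    apply Rmult_le_compat_l; [lra|]; apply Rle_trans with (1 := H); now apply Rplus_le_compat. }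
  assert (Pa : forall u v, p (plus u v) = plus (p u) (p v)).
  { intros u v; apply (proj1 L (q (plus u v))); [apply Hp|].
    rewrite bop_add; apply L; apply Hp. }
  (* Right linearity and boundedness of [p] are read off from [p = conj(s) q - S_R], a combination
     of bounded right-linear operators. *)
  assert (Pr : forall v a, p (ract v a) = ract (p v) a).
  { intros v a.
    assert (E : p (ract v a) = minus (lact (qconj s) (q (ract v a))) (S1 (ract v a)))
      by (rewrite E1; vring).
    rewrite E, !bop_ract, E1, <- lact_ract.
    assert (M : minus (lact (qconj s) (q v)) (p v) = plus (lact (qconj s) (q v)) (scal (-1) (p v)))
      by vring.
    rewrite M, ract_addl, ract_scal; vring. }
  assert (Pb : exists M, forall v, norm (p v) <= M * norm v).
  { destruct (Bop_bound q) as (M & HM & HqM); exists (r * M + C / r); intros v.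
    assert (E : p v = minus (lact (qconj s) (q v)) (S1 v)) by (rewrite E1; vring).
    apply (norm_le_eq (W := V) _ _ _ E), Rle_trans with (1 := norm_minus_le (W := V) _ _).
    rewrite norm_lact, Rmult_plus_distr_r; apply Rplus_le_compat; [|apply N1].
    replace (qabs (qconj s)) with r.
    - rewrite Rmult_assoc; apply Rmult_le_compat_l; [lra|apply HqM].
    - rewrite <- As; unfold qabs; simpl; f_equal; ring. }
  set (P := Build_Bop V p Pa Pr Pb).
  assert (HQ : quad_inv T (2 * r * cos th) (r ^ 2) q P).
  { replace (2 * r * cos th) with (2 * q0 s) by (rewrite Es; ring); rewrite <- As.
    now apply Qop_quad_inv. }
  assert (Hcr : 0 <= C / r) by (apply Rlt_le, Rdiv_lt_0_compat; lra).
  assert (Nq : forall v, norm (q v) <= 2 * C ^ 2 / r ^ 2 * norm v).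
  { intros v; set (a := fun v => minus (scal (r * cos th) (q v)) (P v)).
    set (b := fun v => scal (r * sin th) (q v) : V).
    assert (E : q v = plus (a (a v)) (b (b v))).
    { unfold a, b; rewrite !(Bop_minus_apply (V := V)), !(bop_scal (V := V)).
      assert (X1 := quad_inv_pp T _ _ _ _ v L HQ).
      assert (X2 := quad_inv_pq T _ _ _ _ _ _ _ _ v L HQ HQ).
      assert (Hs := sin2_cos2 th); unfold Rsqr in Hs.
      rewrite X1, <- X2; vring.
      replace (sin th * sin th) with (1 - cos th * cos th) by lra.
      transitivity (- (r * r) + (r * cos th) * (r * cos th) + (r * r) * (sin th * sin th)); [|ring].
      replace (sin th * sin th) with (1 - cos th * cos th) by lra; ring. }
    apply (norm_le_eq (W := V) _ _ _ E).
    eapply Rle_trans; [apply (norm_triangle (V := V))|].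
    replace (2 * C ^ 2 / r ^ 2 * norm v) with
      (C / r * (C / r * norm v) + C / r * (C / r * norm v)) by (field; lra).
    apply Rplus_le_compat.
    - apply Rle_trans with (1 := Na (a v)); apply Rmult_le_compat_l; [easy|apply Na].
    - apply Rle_trans with (1 := Nb (b v)); apply Rmult_le_compat_l; [easy|apply Nb]. }
  exists q, P; split; [exact Hq|split; [exact Hp|split; [exact HQ|split]]].
  - intros v; apply Rle_trans with (1 := Nq v), Rmult_le_compat_r; [apply norm_ge_0|].
    apply Rmult_le_compat_r; [apply Rlt_le, Rinv_0_lt_compat, pow_lt; lra|lra].
  - intros v.
    assert (E : P v = minus (scal (r * cos th) (q v)) (minus (scal (r * cos th) (q v)) (P v)))
      by vring.
    apply (norm_le_eq (W := V) _ _ _ E), Rle_trans with (1 := norm_minus_le (W := V) _ _).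
    replace ((C + 2 * C ^ 2) / r * norm v) with
      (r * 1 * (2 * C ^ 2 / r ^ 2 * norm v) + C / r * norm v) by (field; lra).
    apply Rplus_le_compat; [|apply Na].
    rewrite (norm_scal_real (W := V)).
    apply Rmult_le_compat; [apply Rabs_pos|apply norm_ge_0| |apply Nq].
    rewrite Rabs_mult, (Rabs_pos_eq r) by lra; apply Rmult_le_compat_l; [lra|].
    apply Rabs_le, COS_bound.
Qed.

Lemma qpoint_not_closed_sector J psi th r : imag_unit J -> 0 < r -> 0 <= psi < th -> th <= PI ->
  ~ closed_sector psi (qpoint J th r) /\ ~ closed_sector psi (qpoint J (- th) r).
Proof.
  intros HJ Hr Hpsi Hth.
  assert (Hc : cos th < cos psi) by (apply cos_decreasing_1; lra).
  split; apply not_closed_sector; try lra;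
    rewrite q0_qpoint, qabs_qpoint, ?cos_neg by (easy || lra); nra.
Qed.

(** The resolvent bounds cover angles up to [PI]; beyond it the angle is replaced by [2 PI - th],
    which has the same cosine and therefore the same [q] and [p]. Choice turns the existence
    statements into functions of the polar coordinates, with zero operators as values outside the
    region. *)
Lemma Sect_sector_family {V : QBanach} (T : op V) (omega psi : R) (J : quat) :
  0 <= omega < psi -> psi < PI -> Sect omega T -> imag_unit J ->
  exists C q p, 0 < C /\ sector_family T C psi q p /\
    forall th r, psi < th <= PI -> 0 < r -> is_bop (op_inv (Qop (qpoint J th r) T)) (q th r).
Proof.
  intros Homega Hpsi (Hcl & Hsp & Hbd) HJ.
  assert (L := closed_operator_linear T Hcl).
  destruct (Hbd psi ltac:(lra)) as (C & HC & HSC).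
  set (C' := C + 2 * C ^ 2).
  assert (HC' : 0 < C') by (unfold C'; nra).
  assert (Hex : forall th r, psi < th <= PI -> 0 < r -> exists q p : Bop V,
    is_bop (op_inv (Qop (qpoint J th r) T)) q /\ (forall v, T (q v) (p v)) /\
    quad_inv T (2 * r * cos th) (r ^ 2) q p /\
    (forall v, norm (q v) <= C' / r ^ 2 * norm v) /\
    (forall v, norm (p v) <= C' / r * norm v)).
  { intros th r Hth Hr.
    destruct (qpoint_not_closed_sector J omega th r HJ Hr ltac:(lra) ltac:(lra)) as [A _].
    destruct (qpoint_not_closed_sector J psi th r HJ Hr ltac:(lra) ltac:(lra)) as [B1 B2].
    apply (Sect_resolvent_bounds T J C th r L HJ HC Hr).
    - apply NNPP; intros H; exact (A (Hsp _ H)).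
    - destruct (HSC _ B1) as [_ H]; rewrite qabs_qpoint in H by (easy || lra); exact H.
    - destruct (HSC _ B2) as [_ H]; rewrite qabs_qpoint in H by (easy || lra); exact H. }
  assert (Hall : forall z : R * R, exists qp : Bop V * Bop V,
    psi < fst z < 2 * PI - psi -> 0 < snd z ->
    (fst z <= PI -> is_bop (op_inv (Qop (qpoint J (fst z) (snd z)) T)) (fst qp)) /\
    quad_inv T (2 * snd z * cos (fst z)) (snd z ^ 2) (fst qp) (snd qp) /\
    (forall v, norm (fst qp v) <= C' / snd z ^ 2 * norm v) /\
    (forall v, norm (snd qp v) <= C' / snd z * norm v)).
  { intros [th r]; simpl.
    destruct (classic (psi < th < 2 * PI - psi /\ 0 < r)) as [[Hth Hr]|Hn].
    - destruct (Rle_lt_dec th PI) as [H|H].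
      + destruct (Hex th r ltac:(lra) Hr) as (q & p & H1 & H2 & H3 & H4 & H5).
        exists (q, p); intros _ _; simpl; easy.
      + destruct (Hex (2 * PI - th) r ltac:(lra) Hr) as (q & p & H1 & H2 & H3 & H4 & H5).
        exists (q, p); intros _ _; simpl; split; [lra|split; [|easy]].
        replace (cos th) with (cos (2 * PI - th)); [easy|].
        rewrite cos_minus, cos_2PI, sin_2PI; ring.
    - exists (Bop_zero, Bop_zero); intros H1 H2; exfalso; now apply Hn. }
  set (qp := fun z => proj1_sig (constructive_indefinite_description _ (Hall z))).
  assert (Hqp := fun z => proj2_sig (constructive_indefinite_description _ (Hall z))).
  exists C', (fun th r => fst (qp (th, r))), (fun th r => snd (qp (th, r))).
  split; [easy|split].
  - intros th r Hth Hr; exact (proj2 (Hqp (th, r) Hth Hr)).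
  - intros th r Hth Hr; apply (Hqp (th, r)); simpl; lra.
Qed.

(** * Completeness of [B(V)] *)

Definition Bop_limit {V : QBanach} (F : (Bop V -> Prop) -> Prop) (A : Bop V) : Prop :=
  forall eps : posreal, F (ball A eps).

Lemma Bop_ball_bound {V : QBanach} (A B : Bop V) (e : R) v :
  ball A e B -> norm (minus (B v) (A v)) <= e * norm v.
Proof.
  intros H; assert (E : minus (B v) (A v) = (minus B A : Bop V) v).
  { simpl; vring. }
  apply (norm_le_eq (W := V) _ _ _ E).
  apply Rle_trans with (1 := opnorm_ge (minus B A) v).
  apply Rmult_le_compat_r; [apply norm_ge_0|now apply Rlt_le].
Qed.

(** Completeness is what allows improper integrals of operators to converge in [B(V)]. The limit is
    taken pointwise; the estimate [Lb], uniform in the vector, makes it a limit in operator norm. *)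
Lemma Bop_cauchy_limit {V : QBanach} (F : (Bop V -> Prop) -> Prop) :
  ProperFilter F -> cauchy F -> exists A, Bop_limit F A.
Proof.
  intros FF HF.
  assert (Hc : forall v : V, cauchy (filtermap (fun A : Bop V => A v : V) F)).
  { intros v eps; assert (Hv := norm_ge_0 v).
    assert (He : 0 < eps / (norm v + 1)) by (apply Rdiv_lt_0_compat; [apply cond_pos|lra]).
    destruct (HF (mkposreal _ He)) as [A HA]; exists (A v).
    unfold filtermap; revert HA; apply filter_imp; intros B HB.
    apply (norm_compat1 (V := V)), Rle_lt_trans with (1 := Bop_ball_bound _ _ _ v HB); simpl.
    apply Rlt_le_trans with (eps / (norm v + 1) * (norm v + 1)).
    - apply Rmult_lt_compat_l; lra.
    - right; field; lra. }
  set (L := fun v : V => lim (filtermap (fun A : Bop V => A v : V) F) : V).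
  assert (HL : forall v eta, 0 < eta -> F (fun A : Bop V => norm (minus (A v) (L v)) < eta)).
  { intros v eta Heta.
    assert (Hn : 0 < eta / norm_factor (V := V)).
    { apply Rdiv_lt_0_compat; [easy|apply norm_factor_gt_0]. }
    assert (Hpf : ProperFilter (filtermap (fun A : Bop V => A v : V) F))
      by exact (filtermap_proper_filter (Bop V) V (fun A : Bop V => A v) F FF).
    assert (H := complete_cauchy _ Hpf (Hc v) (mkposreal _ Hn)).
    unfold filtermap in H; revert H; apply filter_imp; intros A HA.
    assert (B := norm_compat2 (V := V) _ _ _ HA); simpl in B.
    replace (norm_factor * (eta / norm_factor)) with eta in B; [exact B|].
    assert (P := norm_factor_gt_0 (V := V)); field; lra. }
  assert (Key : forall (u w : V) c, 0 <= c -> (forall eta, 0 < eta -> exists A : Bop V,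
      norm (minus u w) <= c * eta) -> u = w).
  { intros u w c Hc0 H; apply minus_eq_0; intros eps He.
    destruct (H (eps / (c + 1))) as [_ HA]; [apply Rdiv_lt_0_compat; lra|].
    apply Rle_trans with (1 := HA).
    apply Rle_trans with ((c + 1) * (eps / (c + 1))).
    - apply Rmult_le_compat_r; [apply Rlt_le, Rdiv_lt_0_compat|]; lra.
    - right; field; lra. }
  assert (La : forall u v, L (plus u v) = plus (L u) (L v)).
  { intros u v; apply (Key _ _ 3); [lra|]; intros eta Heta.
    destruct (filter_ex _ (filter_and _ _ (HL (plus u v) eta Heta)
      (filter_and _ _ (HL u eta Heta) (HL v eta Heta)))) as (A & A1 & A2 & A3).
    exists A.
    assert (E : minus (L (plus u v)) (plus (L u) (L v)) =
      minus (plus (minus (A u) (L u)) (minus (A v) (L v))) (minus (A (plus u v)) (L (plus u v)))).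
    { rewrite bop_add; vring. }
    apply (norm_le_eq (W := V) _ _ _ E), Rle_trans with (1 := norm_minus_le (W := V) _ _).
    eapply Rle_trans; [apply Rplus_le_compat_r, (norm_triangle (V := V))|].
    apply Rle_trans with (eta + eta + eta); [|lra].
    apply Rplus_le_compat; [apply Rplus_le_compat|]; now apply Rlt_le. }
  assert (Lr : forall v a, L (ract v a) = ract (L v) a).
  { intros v a; assert (Ha := qabs_pos a); apply (Key _ _ (1 + qabs a)); [lra|]; intros eta Heta.
    destruct (filter_ex _ (filter_and _ _ (HL (ract v a) eta Heta) (HL v eta Heta)))
      as (A & A1 & A2).
    exists A.
    assert (E : minus (L (ract v a)) (ract (L v) a) =
      minus (ract (minus (A v) (L v)) a) (minus (A (ract v a)) (L (ract v a)))).
    { rewrite bop_ract.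
      assert (M : minus (A v) (L v) = plus (A v) (scal (-1) (L v))) by vring.
      rewrite M, ract_addl, ract_scal; vring. }
    apply (norm_le_eq (W := V) _ _ _ E), Rle_trans with (1 := norm_minus_le (W := V) _ _).
    rewrite norm_ract, Rmult_plus_distr_r, Rplus_comm.
    apply Rplus_le_compat; [lra|].
    rewrite Rmult_comm; apply Rmult_le_compat_l; [easy|now apply Rlt_le]. }
  assert (Lb : forall A0 (e : posreal), F (ball A0 e) -> forall v,
    norm (minus (L v) (A0 v)) <= e * norm v).
  { intros A0 e H v; apply le_epsilon; intros eta Heta.
    destruct (filter_ex _ (filter_and _ _ H (HL v eta Heta))) as (A & A1 & A2).
    apply Rle_trans with (1 := norm_minus_triangle (W := V) _ (A v) _).
    rewrite (norm_minus_sym (W := V)), Rplus_comm.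
    apply Rplus_le_compat; [now apply Bop_ball_bound|now apply Rlt_le]. }
  assert (Lbd : exists C, forall v, norm (L v) <= C * norm v).
  { destruct (HF (mkposreal 1 Rlt_0_1)) as [A0 HA0].
    destruct (Bop_bound A0) as (C & HC & HA); exists (1 + C); intros v.
    assert (E : L v = plus (minus (L v) (A0 v)) (A0 v)) by vring.
    apply (norm_le_eq (W := V) _ _ _ E).
    eapply Rle_trans; [apply (norm_triangle (V := V))|].
    rewrite Rmult_plus_distr_r; apply Rplus_le_compat; [exact (Lb A0 _ HA0 v)|apply HA]. }
  exists (Build_Bop V L La Lr Lbd); intros eps.
  assert (He : 0 < eps / 3) by (assert (H := cond_pos eps); lra).
  destruct (HF (mkposreal _ He)) as [A0 HA0].
  assert (HA0' := Lb A0 _ HA0); revert HA0; apply filter_imp; intros A HA.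
  change (opnorm (minus A (Build_Bop V L La Lr Lbd)) < eps).
  apply Rle_lt_trans with (2 * (eps / 3)); [|assert (H := cond_pos eps); lra].
  apply opnorm_le; [lra|]; intros v.
  assert (E : (minus A (Build_Bop V L La Lr Lbd) : Bop V) v =
    minus (minus (A v) (A0 v)) (minus (L v) (A0 v))) by (simpl; vring).
  apply (norm_le_eq (W := V) _ _ _ E), Rle_trans with (1 := norm_minus_le (W := V) _ _).
  replace (2 * (eps / 3) * norm v) with (eps / 3 * norm v + eps / 3 * norm v) by ring.
  apply Rplus_le_compat; [exact (Bop_ball_bound _ _ _ v HA)|exact (HA0' v)].
Qed.

(** A complete space carries a limit function defined on all filters, so a limit is chosen, with an
    arbitrary value where there is none. *)
Definition Bop_lim {V : QBanach} (F : (Bop V -> Prop) -> Prop) : Bop V :=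
  epsilon (inhabits Bop_zero) (Bop_limit F).

Lemma Bop_lim_correct {V : QBanach} (F : (Bop V -> Prop) -> Prop) :
  ProperFilter F -> cauchy F -> forall eps : posreal, F (ball (Bop_lim F) eps).
Proof. intros FF HF; exact (epsilon_spec _ _ (Bop_cauchy_limit F FF HF)). Qed.

(** Filters finer than each other are equal by extensionality, so the same limit is chosen for
    both. *)
Lemma Bop_lim_close {V : QBanach} (F1 F2 : (Bop V -> Prop) -> Prop) :
  filter_le F1 F2 -> filter_le F2 F1 -> close (Bop_lim F1) (Bop_lim F2).
Proof.
  intros H1 H2; replace F2 with F1; [intros eps; apply ball_center|].
  apply functional_extensionality; intros P; apply propositional_extensionality.
  split; [apply H2|apply H1].
Qed.

Definition Bop_CompleteSpace_mixin {V : QBanach} :=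
  CompleteSpace.Mixin (Bop_UniformSpace (V := V)) Bop_lim Bop_lim_correct Bop_lim_close.
Canonical Bop_CompleteNormedModule {V : QBanach} :=
  CompleteNormedModule.Pack R_AbsRing (Bop V)
    (CompleteNormedModule.Class R_AbsRing _
       (NormedModule.class R_AbsRing (Bop_NormedModule (V := V))) Bop_CompleteSpace_mixin) (Bop V).

(** * The functional calculus *)

Lemma Bop_lact_add {V : QBanach} (a : quat) (A : Bop V) u v :
  lact a (A (plus u v)) = plus (lact a (A u)) (lact a (A v)).
Proof. now rewrite bop_add, lact_addr. Qed.

Lemma Bop_lact_ract {V : QBanach} (a : quat) (A : Bop V) v b :
  lact a (A (ract v b)) = ract (lact a (A v)) b.
Proof. now rewrite bop_ract, lact_ract. Qed.

Lemma Bop_lact_bounded {V : QBanach} (a : quat) (A : Bop V) :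
  exists C, forall v, norm (lact a (A v)) <= C * norm v.
Proof.
  destruct (Bop_bound A) as (C & _ & HA); exists (qabs a * C); intros v.
  rewrite norm_lact, Rmult_assoc; apply Rmult_le_compat_l; [apply qabs_pos|apply HA].
Qed.

Definition Bop_lact {V : QBanach} (a : quat) (A : Bop V) : Bop V :=
  Build_Bop V _ (Bop_lact_add a A) (Bop_lact_ract a A) (Bop_lact_bounded a A).

(** [v |-> w1 (q v) - w2 (p v)] for [w1, w2] in [C_J]. *)
Definition plane_comb {V : QBanach} (J : quat) (q p : Bop V) (w1 w2 : C) : Bop V :=
  minus (plus (scal (Re w1) q) (scal (Im w1) (Bop_lact J q)))
        (plus (scal (Re w2) p) (scal (Im w2) (Bop_lact J p))).

Lemma plane_comb_apply {V : QBanach} J (q p : Bop V) w1 w2 v :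
  plane_comb J q p w1 w2 v = minus (lact (emb J w1) (q v)) (lact (emb J w2) (p v)).
Proof. rewrite !lact_emb; simpl; vring. Qed.

Lemma opnorm_plane_comb {V : QBanach} J (q p : Bop V) w1 w2 cq cp : imag_unit J ->
  0 <= cq -> 0 <= cp ->
  (forall v, norm (q v) <= cq * norm v) -> (forall v, norm (p v) <= cp * norm v) ->
  opnorm (plane_comb J q p w1 w2) <= Cmod w1 * cq + Cmod w2 * cp.
Proof.
  intros HJ Hcq Hcp Hq Hp; assert (P1 := Cmod_ge_0 w1); assert (P2 := Cmod_ge_0 w2).
  apply opnorm_le; [apply Rplus_le_le_0_compat; now apply Rmult_le_pos|]; intros v.
  rewrite plane_comb_apply.
  apply Rle_trans with (1 := norm_minus_le (W := V) _ _).
  rewrite !norm_lact, !qabs_emb, Rmult_plus_distr_r, !Rmult_assoc by easy.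
  apply Rplus_le_compat; apply Rmult_le_compat_l; easy.
Qed.

Lemma op_continuous_Bop {V : QBanach} (A : R -> R -> Bop V) th r :
  op_continuous A th r -> continuous (fun r => A th r) r.
Proof.
  intros H; refine (proj2 (continuous_norm_eps (U := R_UniformSpace) (W := Bop_NormedModule (V := V)) _ _) _).
  intros eps He; destruct (H (eps / 2) ltac:(lra)) as [e Hb]; exists e; intros r' Hr'.
  change (opnorm (minus (A th r') (A th r)) < eps).
  apply Rle_lt_trans with (eps / 2); [|lra]; apply opnorm_le; [lra|]; intros v.
  assert (E : (minus (A th r') (A th r) : Bop V) v = minus (A th r' v) (A th r v)) by (simpl; vring).
  apply (norm_le_eq (W := V) _ _ _ E).
  apply (Hb (th, r')); split; [apply ball_center|exact Hr'].
Qed.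

Lemma op_continuous_lact {V : QBanach} (a : quat) (A : R -> R -> Bop V) th r :
  op_continuous A th r -> op_continuous (fun th r => Bop_lact a (A th r)) th r.
Proof.
  intros H eps He; assert (Ha := qabs_pos a).
  generalize (H (eps / (qabs a + 1)) ltac:(apply Rdiv_lt_0_compat; lra)).
  apply filter_imp; intros z Hz v; simpl.
  assert (E : minus (lact a (A (fst z) (snd z) v)) (lact a (A th r v)) =
    lact a (minus (A (fst z) (snd z) v) (A th r v))).
  { assert (M : minus (A (fst z) (snd z) v) (A th r v) =
      plus (A (fst z) (snd z) v) (lact (qreal (-1)) (A th r v))) by (rewrite lact_real; vring).
    rewrite M, lact_addr, <- lact_mul.
    replace (qmul a (qreal (-1))) with (qmul (qreal (-1)) a) by (apply quat_eq; simpl; ring).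
    rewrite lact_mul, lact_real; vring. }
  apply (norm_le_eq (W := V) _ _ _ E); rewrite norm_lact.
  apply Rle_trans with ((qabs a + 1) * (eps / (qabs a + 1) * norm v)).
  - apply Rmult_le_compat; [easy|apply norm_ge_0|lra|apply Hz].
  - right; field; lra.
Qed.

Definition power_kernel (a : R) (k : nat) (th r : R) : C :=
  (RtoC (Rpower r a) * cis (a * th) * / (ray th r + 1) ^ k)%C.

Lemma power_kernel_cont a k th r : - PI < th < PI -> 0 < r -> ccont (power_kernel a k th) r.
Proof.
  intros Hth Hr; assert (N1 := ray_plus_neq_0 th r 1 Hth Hr Rlt_0_1).
  unfold power_kernel; apply ccont_mult; [apply ccont_mult|].
  - apply ccont_RtoC; now apply continuous_Rpower.
  - apply ccont_const.
  - apply ccont_inv; [now apply Cpow_nz|]; apply ccont_pow, ccont_plus; [|apply ccont_const].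
    split; apply (ex_derive_continuous (V := R_NormedModule)); simpl; auto_derive; easy.
Qed.

Lemma power_kernel_bound a k th : - PI < th < PI -> exists K, 0 < K /\
  forall r, 0 < r -> Cmod (power_kernel a k th r) <= K * (Rpower r a * Rpower (1 + r) (- INR k)).
Proof.
  intros Hth; assert (Hc := cos_gt_m1 th Hth); assert (Hc1 := COS_bound th).
  destruct (Cmod_ray_fun_le a a 0 k 1 (cos th) Rlt_0_1 ltac:(lra)) as (K & HK & Hle).
  exists K; split; [easy|]; intros r Hr.
  replace (power_kernel a k th r) with (ray_fun a a 0 k 1 th r).
  - apply (Hle th r Hr); lra.
  - unfold power_kernel, ray_fun; simpl; f_equal.
    replace (/ 1)%C with (RtoC 1) by (apply Ceq; simpl; field); ring.
Qed.

Lemma Qop_qpoint_neg {V : QBanach} (T : op V) J th r : imag_unit J -> 0 < r ->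
  Qop (qpoint J (- th) r) T = Qop (qpoint J th r) T.
Proof.
  intros HJ Hr; unfold Qop; rewrite !q0_qpoint, !qabs_qpoint, cos_neg by (easy || lra); easy.
Qed.

(** Along the ray [ds_J = - J ds] contributes [- J e^(J th)], that is [- i e^(i th)] in [C]; the two
    coefficients come from [S_R = conj(s) q - p]. *)
Lemma is_bop_integrand {V : QBanach} (T : op V) J th r (q p : Bop V) (z : C) : linear_graph T ->
  imag_unit J -> is_bop (op_inv (Qop (qpoint J th r) T)) q -> (forall v, T (q v) (p v)) ->
  is_bop (op_lscal (qmul (emb J z) (qmul (qopp J) (qcis J th))) (S_R (qpoint J th r) T))
    (plane_comb J q p (z * (- Ci * cis th) * Cconj (ray th r)) (z * (- Ci * cis th))).
Proof.
  intros L HJ Hq Hp v w.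
  assert (Ec : qmul (emb J z) (qmul (qopp J) (qcis J th)) = emb J (z * (- Ci * cis th))%C).
  { rewrite !emb_mult by easy; f_equal; f_equal; apply quat_eq; simpl; ring. }
  assert (E : plane_comb J q p (z * (- Ci * cis th) * Cconj (ray th r)) (z * (- Ci * cis th)) v =
    lact (emb J (z * (- Ci * cis th))%C) (minus (lact (qconj (qpoint J th r)) (q v)) (p v))).
  { rewrite plane_comb_apply.
    set (c := (z * (- Ci * cis th))%C).
    assert (M : minus (lact (qconj (qpoint J th r)) (q v)) (p v) =
      plus (lact (qconj (qpoint J th r)) (q v)) (lact (qreal (-1)) (p v))) by (rewrite lact_real; vring).
    rewrite M, lact_addr, <- !lact_mul, <- emb_qpoint, <- emb_conj, <- emb_mult by easy.
    replace (qmul (emb J c) (qreal (-1))) with (qmul (qreal (-1)) (emb J c))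
      by (apply quat_eq; simpl; ring).
    rewrite lact_mul, lact_real; vring. }
  rewrite E; split.
  - intros (u & Hu & ->); apply (S_R_char T _ q p v u L Hq Hp) in Hu; rewrite Hu, Ec; easy.
  - intros ->; exists (minus (lact (qconj (qpoint J th r)) (q v)) (p v)); split; [|now rewrite Ec].
    now apply (S_R_char T _ q p v _ L Hq Hp).
Qed.

Lemma Bop_eval_linear {V : QBanach} (v : V) :
  is_linear (U := Bop_NormedModule (V := V)) (V := V) (fun A : Bop V => A v : V).
Proof.
  split; [easy|easy|].
  exists (norm v + 1); split; [assert (H := norm_ge_0 v); lra|]; intros A.
  apply Rle_trans with (1 := opnorm_ge A v).
  change (norm A) with (opnorm A); rewrite Rmult_comm; apply Rmult_le_compat_r;
    [apply opnorm_pos|lra].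
Qed.

Lemma half_int_ray {V : QBanach} (T : op V) C phi0 phi q p J a k th :
  linear_graph T -> imag_unit J -> 0 < C -> sector_family T C phi0 q p ->
  0 <= phi0 < phi -> phi < PI -> - PI < th < PI -> 0 < a < INR k ->
  exists B : Bop V, is_int_pos (fun r => plane_comb J (q phi r) (p phi r)
    (power_kernel a k th r * (- Ci * cis th) * Cconj (ray th r))
    (power_kernel a k th r * (- Ci * cis th))) B.
Proof.
  intros L HJ HC Hf Hphi Hphi' Hth Ha.
  assert (Hreg : phi0 < phi < 2 * PI - phi0) by lra.
  destruct (power_kernel_bound a k th Hth) as (K & HK & Hle).
  assert (Ew : forall z, Cmod (z * (- Ci * cis th))%C = Cmod z).
  { intros z; rewrite !Cmod_mult, Cmod_opp, Cmod_cis.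
    replace Ci with (cis (PI / 2)) by (apply Ceq; [apply cos_PI2|apply sin_PI2]).
    rewrite Cmod_cis; ring. }
  (* The term [conj(s) q] has norm at most [r C / r^2] and [p] at most [C / r], whence the factor
     [2 C]; the remaining [1 / r] lowers the exponent of [r^a] to [a - 1]. *)
  apply (half_int_pos (W := Bop_CompleteNormedModule (V := V)) _ (2 * C * K) a (INR k) Ha).
  - intros r Hr; destruct (sector_family_continuous T C phi0 q p phi r L HC Hf Hreg Hr) as [Cq Cp].
    assert (Hw2 : ccont (fun r => power_kernel a k th r * (- Ci * cis th))%C r).
    { apply ccont_mult; [now apply power_kernel_cont|apply ccont_const]. }
    assert (Hw1 : ccont (fun r => power_kernel a k th r * (- Ci * cis th) * Cconj (ray th r))%C r).
    { apply ccont_mult; [easy|].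
      split; apply (ex_derive_continuous (V := R_NormedModule)); simpl; auto_derive; easy. }
    unfold plane_comb.
    apply (continuous_minus (V := Bop_NormedModule (V := V)));
      apply (continuous_plus (V := Bop_NormedModule (V := V)));
      apply (continuous_scal_fun (W := Bop_NormedModule (V := V)));
      try apply Hw1; try apply Hw2.
    + now apply op_continuous_Bop.
    + apply (op_continuous_Bop (fun th r => Bop_lact J (q th r))); now apply op_continuous_lact.
    + now apply op_continuous_Bop.
    + apply (op_continuous_Bop (fun th r => Bop_lact J (p th r))); now apply op_continuous_lact.
  - intros r Hr; destruct (Hf phi r Hreg Hr) as (_ & Hq & Hp).
    assert (Cr2 : 0 <= C / r ^ 2) by (apply Rlt_le, Rdiv_lt_0_compat; [easy|apply pow_lt; lra]).
    assert (Cr1 : 0 <= C / r) by (apply Rlt_le, Rdiv_lt_0_compat; lra).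
    apply Rle_trans with (1 := opnorm_plane_comb J _ _ _ _ _ _ HJ Cr2 Cr1 Hq Hp).
    rewrite Cmod_mult, Ew, Cmod_conj, ray_cis, Cmod_mult, Cmod_cis, Cmod_R, Rabs_pos_eq by lra.
    replace (Cmod (power_kernel a k th r) * (r * 1) * (C / r ^ 2) +
      Cmod (power_kernel a k th r) * (C / r)) with
      (2 * C * / r * Cmod (power_kernel a k th r)) by (field; lra).
    assert (Hir := Rinv_0_lt_compat _ Hr).
    apply Rle_trans with (2 * C * / r * (K * (Rpower r a * Rpower (1 + r) (- INR k)))).
    + apply Rmult_le_compat_l; [|now apply Hle].
      apply Rmult_le_pos; lra.
    + right; unfold Rminus; rewrite (Rpower_plus a), (Rpower_Ropp r 1), Rpower_1 by easy; ring.
Qed.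

(** On the two rays the kernel takes conjugate values while [q] and [p] are the same, so the [J]
    components cancel in [B2 - B1] and twice [res_Im] remains. *)
Lemma calculus_exists {V : QBanach} (T : op V) C phi0 phi q p J a k :
  linear_graph T -> imag_unit J -> 0 < C -> sector_family T C phi0 q p ->
  (forall r, 0 < r -> is_bop (op_inv (Qop (qpoint J phi r) T)) (q phi r)) ->
  0 <= phi0 < phi -> phi < PI -> 0 < a < INR k ->
  exists B : Bop V,
    is_calculus (fun s => qmul (qpower s a) (qinv (qpow (qadd (qreal 1) s) k))) T J phi B /\
    forall v, half_int (fun r => res_Im phi r (q phi r) (p phi r) (power_kernel a k phi r) v)
      (scal PI (B v)).
Proof.
  intros L HJ HC Hf Hbq Hphi Hphi' Ha; assert (Hpi := PI_RGT_0).
  assert (Hreg : phi0 < phi < 2 * PI - phi0) by lra.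
  destruct (half_int_ray T C phi0 phi q p J a k phi L HJ HC Hf Hphi Hphi' ltac:(lra) Ha) as [B1 HB1].
  destruct (half_int_ray T C phi0 phi q p J a k (- phi) L HJ HC Hf Hphi Hphi' ltac:(lra) Ha) as [B2 HB2].
  exists (scal (/ (2 * PI)) (minus B2 B1)); split.
  - exists B1, B2; split; [|split; [|easy]].
    + eexists; split; [|exact HB1]; intros r Hr; cbv zeta.
      fold (qpoint J phi r); rewrite regularizer_qpoint by (easy || lra).
      apply is_bop_integrand; [easy|easy|now apply Hbq|apply (Hf phi r Hreg Hr)].
    + eexists; split; [|exact HB2]; intros r Hr; cbv zeta.
      fold (qpoint J (- phi) r); rewrite regularizer_qpoint by (easy || lra).
      apply is_bop_integrand; [easy|easy|rewrite Qop_qpoint_neg by easy; now apply Hbq|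
        apply (Hf phi r Hreg Hr)].
  - intros v.
    assert (H1 := half_int_linear (U := Bop_NormedModule (V := V)) (W := V) _ (Bop_eval_linear v) _ _ (proj1 HB1)).
    assert (H2 := half_int_linear (U := Bop_NormedModule (V := V)) (W := V) _ (Bop_eval_linear v) _ _ (proj1 HB2)).
    assert (H := is_RInt_gen_scal (V := V) _ (/ 2) _ (is_RInt_gen_minus (V := V) _ _ _ _ H2 H1)).
    refine (half_int_vec_eq _ _ _ _ _ _ H).
    + intros r Hr; rewrite !plane_comb_apply, !lact_emb.
      set (z := power_kernel a k phi r).
      assert (N1 := ray_plus_neq_0 phi r 1 ltac:(lra) Hr Rlt_0_1).
      assert (Ez : power_kernel a k (- phi) r = Cconj z).
      { unfold z, power_kernel.
        rewrite !Cmult_conj, Cinv_conj, Cpow_conj, Cplus_conj by now apply Cpow_nz.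
        assert (R1 : Cconj (RtoC (Rpower r a)) = RtoC (Rpower r a)) by (apply Ceq; simpl; ring).
        assert (R2 : cis (a * - phi) = Cconj (cis (a * phi))).
        { replace (a * - phi) with (- (a * phi)) by ring.
          apply Ceq; simpl; [apply cos_neg|apply sin_neg]. }
        assert (R3 : Cconj 1 = RtoC 1) by (apply Ceq; simpl; ring).
        assert (R4 : ray (- phi) r = Cconj (ray phi r)).
        { apply Ceq; simpl; rewrite ?cos_neg, ?sin_neg; ring. }
        rewrite R1, R2, R3, R4; easy. }
      assert (Ew : forall th, (- Ci * cis th * Cconj (ray th r) = - Ci * RtoC r)%C).
      { intros th; assert (Hs := sin2_cos2 th); unfold Rsqr in Hs.
        rewrite ray_cis, Cmult_conj.
        replace (Cconj (RtoC r)) with (RtoC r) by (apply Ceq; simpl; ring).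
        assert (Hcc : (cis th * Cconj (cis th) = 1)%C) by (apply Ceq; simpl; lra).
        transitivity (- Ci * RtoC r * (cis th * Cconj (cis th)))%C; [ring|rewrite Hcc; ring]. }
      rewrite Ez; clearbody z; unfold res_Im.
      rewrite <- !(Cmult_assoc _ (- Ci * cis _)%C), !Ew.
      destruct z as [z1 z2].
      vring; unfold Re, Im; simpl; rewrite ?cos_neg, ?sin_neg; field.
    + assert (E : (scal (/ (2 * PI)) (minus B2 B1) : Bop V) v =
        scal (/ (2 * PI)) (minus (B2 v) (B1 v))) by (simpl; vring).
      rewrite E; vring; field; lra.
Qed.

(** * Balakrishnan's formula *)

(** The inverse of [t + T], read off at [s = - t], the point of angle [PI], where
    [Q_s(T) = (t + T)^2]. *)
Definition neg_resolvent {V : QBanach} (q p : R -> R -> Bop V) (t : R) : Bop V :=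
  Bop_plus (p PI t) (Bop_scal t (q PI t)).

Lemma neg_resolvent_lin_inv {V : QBanach} (T : op V) C phi0 q p t : linear_graph T ->
  sector_family T C phi0 q p -> 0 <= phi0 < PI -> 0 < t -> lin_inv T t (neg_resolvent q p t).
Proof.
  intros L Hf Hphi Ht.
  apply (lin_inv_of_quad T t (q PI t) (p PI t)); [easy| |easy].
  replace (- (2 * t)) with (2 * t * cos PI) by (rewrite cos_PI; ring).
  apply (Hf PI t); lra.
Qed.

Lemma neg_resolvent_norm {V : QBanach} (T : op V) C phi0 q p t v :
  sector_family T C phi0 q p -> 0 <= phi0 < PI -> 0 < t ->
  norm (neg_resolvent q p t v) <= 2 * C / t * norm v.
Proof.
  intros Hf Hphi Ht; destruct (Hf PI t ltac:(lra) Ht) as (_ & Hq & Hp); simpl.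
  eapply Rle_trans; [apply (norm_triangle (V := V))|].
  rewrite (norm_scal_real (W := V)), Rabs_pos_eq by lra.
  apply Rle_trans with (C / t * norm v + t * (C / t ^ 2 * norm v)).
  - apply Rplus_le_compat; [apply Hp|apply Rmult_le_compat_l; [lra|apply Hq]].
  - right; field; lra.
Qed.

Lemma neg_resolvent_continuous {V : QBanach} (T : op V) C phi0 q p (u : R -> V) t :
  linear_graph T -> 0 < C -> sector_family T C phi0 q p -> 0 <= phi0 < PI -> 0 < t ->
  continuous u t -> continuous (fun t => neg_resolvent q p t (u t) : V) t.
Proof.
  intros L HC Hf Hphi Ht Hu.
  destruct (sector_family_continuous T C phi0 q p PI t L HC Hf ltac:(lra) Ht) as [Cq Cp].
  assert (Hu2 : jointly_continuous (fun _ t => u t) PI t).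
  { apply (continuous_comp snd u); [apply continuous_snd|exact Hu]. }
  apply (continuous_plus (V := V)).
  - apply (jointly_continuous_2 (fun th t => p th t (u t))); now apply op_continuous_apply.
  - apply (continuous_scal_fun (W := V) (fun t => t)); [apply continuous_id|].
    apply (jointly_continuous_2 (fun th t => q th t (u t))); now apply op_continuous_apply.
Qed.

(** [(T (t+T)^(-1))^n v = (t+T)^(-n) T^n v]: on the domain of [T^n] bounded factors become decaying
    ones. *)
Lemma iter_G_domain {V : QBanach} (T : op V) t (St : Bop V) n v w : linear_graph T ->
  lin_inv T t St -> op_pow T n v w -> Nat.iter n (G_op t St) v = Nat.iter n St w.
Proof.
  intros L H; revert w; induction n as [|n IH]; intros w Hw; [symmetry; exact Hw|].
  destruct Hw as (u & Hu & Huw); simpl; rewrite (IH u Hu).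
  rewrite <- (iter_comm St (G_op t St)) by (intros x; now apply (G_op_comm T t t)).
  assert (E : G_op t St u = St w).
  { unfold G_op; rewrite <- (proj2 H u w Huw) at 1; bop_push; vring. }
  rewrite E; apply iter_succ_r.
Qed.

Lemma iter_norm_le {V : QBanach} (f : V -> V) M n : 0 <= M ->
  (forall v, norm (f v) <= M * norm v) -> forall v, norm (Nat.iter n f v) <= M ^ n * norm v.
Proof.
  intros HM Hf; induction n as [|n IH]; intros v; simpl; [lra|].
  apply Rle_trans with (1 := Hf _); rewrite Rmult_assoc; now apply Rmult_le_compat_l.
Qed.

Lemma G_op_norm_le {V : QBanach} (T : op V) C phi0 q p t y : 0 < C ->
  sector_family T C phi0 q p -> 0 <= phi0 < PI -> 0 < t ->
  norm (G_op t (neg_resolvent q p t) y) <= (1 + 2 * C) * norm y.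
Proof.
  intros HC Hf Hphi Ht; unfold G_op.
  apply Rle_trans with (1 := norm_minus_le (W := V) _ _).
  rewrite (norm_scal_real (W := V)), Rabs_pos_eq by lra.
  assert (H := neg_resolvent_norm T C phi0 q p t y Hf Hphi Ht).
  apply Rmult_le_compat_l with (r := t) in H; [|lra].
  replace (t * (2 * C / t * norm y)) with (2 * C * norm y) in H by (field; lra).
  rewrite Rmult_plus_distr_r, Rmult_1_l; now apply Rplus_le_compat_l.
Qed.

(** Near [0] all [m] factors are bounded by [1 + 2 C] and [a > 0] suffices. At infinity [n] of them
    are exchanged for resolvents of size [2 C / t], and [a < n] gives convergence. *)
Lemma Balakrishnan_integral_exists {V : QBanach} (T : op V) C phi0 q p a n m v :
  linear_graph T -> 0 < C -> sector_family T C phi0 q p -> 0 <= phi0 < PI ->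
  0 < a < INR n -> (n <= m)%nat -> op_dom (op_pow T n) v ->
  exists w, is_int_pos (fun t => scal (Rpower t (a - 1))
    (Nat.iter m (G_op t (neg_resolvent q p t)) v) : V) w.
Proof.
  intros L HC Hf Hphi Ha Hnm (w & Hw).
  set (G := fun t => G_op t (neg_resolvent q p t)).
  set (M := 1 + 2 * C); assert (HM : 0 < M) by (unfold M; lra).
  assert (HG : forall t y, 0 < t -> norm (G t y) <= M * norm y).
  { intros t y Ht; now apply (G_op_norm_le T C phi0). }
  assert (Nv := norm_ge_0 v); assert (Nw := norm_ge_0 w).
  assert (B1 : forall t, 0 < t -> norm (Nat.iter m (G t) v) <= M ^ m * norm v).
  { intros t Ht; apply iter_norm_le; [lra|]; intros y; now apply HG. }
  set (M2 := M ^ (m - n) * (2 * C) ^ n).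
  assert (HM2 : 0 <= M2) by (unfold M2; apply Rmult_le_pos; apply pow_le; lra).
  assert (B2 : forall t, 0 < t -> norm (Nat.iter m (G t) v) <= M2 * / t ^ n * norm w).
  { intros t Ht.
    assert (E : Nat.iter m (G t) v = Nat.iter (m - n) (G t) (Nat.iter n (G t) v))
      by (rewrite <- Nat.iter_add; f_equal; lia).
    rewrite E.
    apply Rle_trans with (M ^ (m - n) * norm (Nat.iter n (G t) v)).
    - apply iter_norm_le; [lra|]; intros y; now apply HG.
    - unfold G; rewrite (iter_G_domain T t _ n v w L) by
        (easy || now apply (neg_resolvent_lin_inv T C phi0)).
      unfold M2; rewrite !Rmult_assoc; apply Rmult_le_compat_l; [apply pow_le; lra|].
      rewrite <- Rmult_assoc, <- pow_inv, <- Rpow_mult_distr.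
      apply iter_norm_le.
      + apply Rmult_le_pos; [lra|now apply Rlt_le, Rinv_0_lt_compat].
      + intros y; now apply (neg_resolvent_norm T C phi0). }
  set (K := 2 ^ n * (M ^ m * norm v + M2 * norm w)).
  assert (Mm : 0 <= M ^ m * norm v) by (apply Rmult_le_pos; [apply pow_le; lra|easy]).
  assert (Mw : 0 <= M2 * norm w) by now apply Rmult_le_pos.
  apply (half_int_pos (W := V) _ K a (INR n) Ha).
  - intros t Ht; apply (continuous_scal_fun (W := V)); [now apply continuous_Rpower|].
    clear B1 B2 Hnm K M2 HM2 Mm Mw; induction m as [|m IH]; simpl; [apply continuous_const|].
    apply (continuous_minus (V := V)); [exact IH|].
    apply (continuous_scal_fun (W := V) (fun t => t)); [apply continuous_id|].
    now apply (neg_resolvent_continuous T C phi0).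
  - intros t Ht; rewrite (norm_scal_real (W := V)), Rabs_pos_eq by apply Rlt_le, Rpower_pos.
    assert (P1 := Rpower_pos t (a - 1)).
    rewrite (Rmult_comm K), Rmult_assoc; apply Rmult_le_compat_l; [lra|].
    rewrite <- pow_inv_Rpower, Rmult_comm by lra.
    assert (P2 : 0 < (1 + t) ^ n) by (apply pow_lt; lra).
    apply Rmult_le_reg_r with ((1 + t) ^ n); [easy|].
    rewrite Rmult_assoc, Rinv_l, Rmult_1_r by lra.
    destruct (Rle_lt_dec t 1) as [H|H].
    + apply Rle_trans with (M ^ m * norm v * 2 ^ n).
      * apply Rmult_le_compat; [apply norm_ge_0|lra|now apply B1|apply pow_incr; lra].
      * unfold K; rewrite Rmult_comm; apply Rmult_le_compat_l; [apply pow_le; lra|lra].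
    + assert (P3 : 0 < t ^ n) by (apply pow_lt; lra).
      apply Rle_trans with (M2 * / t ^ n * norm w * (2 * t) ^ n).
      * apply Rmult_le_compat; [apply norm_ge_0|lra|now apply B2|apply pow_incr; lra].
      * rewrite Rpow_mult_distr.
        replace (M2 * / t ^ n * norm w * (2 ^ n * t ^ n)) with (2 ^ n * (M2 * norm w)) by (field; lra).
        unfold K; apply Rmult_le_compat_l; [apply pow_le; lra|lra].
Qed.

(** Vectors of the form [(1+T)^(-k) w] lie in the domain of [(1+T)^k]; this is how membership in the
    domain of the fractional power is obtained. *)
Lemma op_pow_resolvent {V : QBanach} (T : op V) (S1 : Bop V) k w : lin_inv T 1 S1 ->
  op_pow (op_add op_id T) k (Nat.iter k S1 w) w.
Proof.
  intros (H & _); revert w; induction k as [|k IH]; intros w; [reflexivity|].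
  exists (S1 w); split.
  - simpl; rewrite <- iter_succ_r; apply IH.
  - exists (S1 w), (minus w (scal 1 (S1 w))); repeat split; [apply H|vring].
Qed.

Lemma op_inv_shift {V : QBanach} (T : op V) t (St : Bop V) v : lin_inv T t St ->
  op_inv (op_add (op_scal t op_id) T) v (St v).
Proof.
  intros (H & _); exists (scal t (St v)), (minus v (scal t (St v))); repeat split; [|apply H|vring].
  exists (St v); split; reflexivity.
Qed.

Lemma op_pow_G {V : QBanach} (T : op V) t (St : Bop V) m v : lin_inv T t St ->
  op_pow (op_mul T (op_inv (op_add (op_scal t op_id) T))) m v (Nat.iter m (G_op t St) v).
Proof.
  intros H; induction m as [|m IH]; [reflexivity|].
  exists (Nat.iter m (G_op t St) v); split; [exact IH|].
  exists (St (Nat.iter m (G_op t St) v)); split; [now apply op_inv_shift|apply H].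
Qed.

(** Common form of both formulas: the constant enters only through [c * K = 1], and the conclusion
    follows once the regularized operator is seen to map [v] to [(1+T)^(-k) (c w)]. *)
Lemma Balakrishnan_frac_pow (V : QBanach) (omega : R) (T : op V) (J : quat) (phi : R)
    (a K c : R) (n m k : nat) (v : V) :
  0 <= omega < PI -> Sect omega T -> imag_unit J -> omega < phi < PI ->
  0 < a -> a < INR n -> (n <= m)%nat -> a < INR k -> op_dom (op_pow T n) v ->
  half_int (fun t => Rpower t (a - 1) * / (t + 1) ^ m) K -> c * K = 1 ->
  exists (S : R -> Bop V) (w : V), (forall t, 0 < t -> lin_inv T t (S t)) /\
    is_int_pos (fun t => scal (Rpower t (a - 1)) (Nat.iter m (G_op t (S t)) v) : V) w /\
    frac_pow k J phi T a v (scal c w).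
Proof.
  intros Homega HT HJ Hphi Ha Han Hnm Hak Hv HK HcK; assert (Hpi := PI_RGT_0).
  (* An angle strictly between [omega] and [phi], so that the ray at [phi] is interior to the region
     of the resolvent bounds. *)
  set (psi := (omega + phi) / 2).
  assert (Hpsi : omega < psi < phi) by (unfold psi; lra); clearbody psi.
  assert (L := closed_operator_linear T (proj1 HT)).
  destruct (Sect_sector_family T omega psi J ltac:(lra) ltac:(lra) HT HJ)
    as (C & q & p & HC & Hf & Hbq).
  assert (HS := fun t Ht => neg_resolvent_lin_inv T C psi q p t L Hf ltac:(lra) Ht).
  destruct (Balakrishnan_integral_exists T C psi q p a n m v L HC Hf ltac:(lra) ltac:(lra) Hnm Hv)
    as [w Hw].
  exists (neg_resolvent q p), w; split; [exact HS|split; [exact Hw|]].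
  destruct (calculus_exists T C psi phi q p J a k L HJ HC Hf
    ltac:(intros r Hr; apply Hbq; [lra|easy]) ltac:(lra) ltac:(lra) ltac:(lra)) as (B & HB & HBv).
  exists B; split; [exact HB|].
  assert (Ham : a < INR m) by (apply Rlt_le_trans with (1 := Han); now apply le_INR).
  assert (E := Balakrishnan_core T C psi phi q p (neg_resolvent q p) a K m k v w _ L HC Hf
    ltac:(lra) ltac:(lra) HS Ha Ham Hak HK (proj1 Hw) (HBv v)).
  assert (EB : B v = Nat.iter k (neg_resolvent q p 1) (scal c w)).
  { rewrite (linear_scal _ (iter_linear (neg_resolvent q p 1) k)).
    transitivity (scal (c * K) (B v)); [rewrite HcK; vring|].
    transitivity (scal (c * / PI) (scal K (scal PI (B v)))); [vring; field; lra|].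
    rewrite E; vring; field; lra. }
  exists (Nat.iter k (neg_resolvent q p 1) (scal c w)); split.
  - symmetry; exact EB.
  - apply op_pow_resolvent, HS, Rlt_0_1.
Qed.

Lemma Beta_integral (a : R) (m : nat) : 0 < a < INR m ->
  exists K, half_int (fun t => Rpower t (a - 1) * / (t + 1) ^ m) K /\
    Gamma (INR m) * K = Gamma a * Gamma (INR m - a).
Proof.
  intros Ha.
  destruct (half_int_exists_R (fun t => Rpower t (a - 1) * Rpower (1 + t) (- INR m)) 1 a (INR m) Ha)
    as [K HK].
  - intros t Ht; apply (ex_derive_continuous (V := R_NormedModule)).
    unfold Rpower; auto_derive; repeat split; lra.
  - intros t Ht; rewrite Rmult_1_l, Rabs_pos_eq; [lra|].
    apply Rlt_le, Rmult_lt_0_compat; apply Rpower_pos.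
  - exists K; split; [|now apply Beta_Gamma].
    revert HK; apply half_int_ext_R; intros t Ht.
    now rewrite <- pow_inv_Rpower, (Rplus_comm t 1) by lra.
Qed.

Theorem theorem4p9 (V : QBanach) (omega : R) (T : op V)
    (homega : 0 <= omega < PI) (hT : Sect omega T)
    (J : quat) (hJ : imag_unit J) (phi : R) (hphi : omega < phi < PI) :
  (forall (alpha : R) (k : nat), 0 < alpha < 1 -> alpha < INR k ->
     forall v : V, op_dom T v ->
     exists w : V,
       op_integral
         (fun t => op_scal (Rpower t (alpha - 1))
                     (op_mul (op_inv (op_add (op_scal t op_id) T)) T)) v w /\
       frac_pow k J phi T alpha v (scal (sin (alpha * PI) / PI) w)) /\
  (forall (alpha : R) (n m k : nat),
     0 < alpha -> alpha < INR n -> (n <= m)%nat -> alpha < INR k ->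
     forall v : V, op_dom (op_pow T n) v ->
     exists w : V,
       op_integral
         (fun t => op_scal (Rpower t (alpha - 1))
                     (op_pow (op_mul T (op_inv (op_add (op_scal t op_id) T))) m)) v w /\
       frac_pow k J phi T alpha v
         (scal (Gamma (INR m) / (Gamma alpha * Gamma (INR m - alpha))) w)).
Proof.
  split.
  - intros a k Ha Hk v [u Hu]; assert (Hpi := PI_RGT_0).
    destruct (Beta_integral a 1 ltac:(simpl; lra)) as (K & HK & _).
    assert (HE := Euler_reflection a K Ha HK).
    destruct (Balakrishnan_frac_pow V omega T J phi a K (sin (a * PI) / PI) 1 1 k v
      homega hT hJ hphi ltac:(lra) ltac:(simpl; lra) (le_n 1) Hk) as (S & w & HS & Hw & Hpow).
    + exists u, v; split; [reflexivity|exact Hu].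
    + exact HK.
    (* For [m = 1] the constant is the reciprocal of [K = PI / sin (a PI)]. *)
    + transitivity (K * sin (a * PI) / PI); [field; lra|rewrite HE; field; lra].
    + exists w; split; [|exact Hpow].
      eexists; split; [|exact Hw]; intros t Ht; simpl.
      exists (G_op t (S t) v); split; [|easy].
      exists u; split; [exact Hu|].
      (* The first formula has [T] on the right of the resolvent; on the domain of [T] the two
         orders agree. *)
      assert (E : G_op t (S t) v = S t u).
      { unfold G_op; rewrite <- (proj2 (HS t Ht) v u Hu) at 1; bop_push; vring. }
      rewrite E; now apply op_inv_shift, HS.
  - intros a n m k Ha Hn Hnm Hk v Hv.
    assert (Ham : a < INR m) by (apply Rlt_le_trans with (1 := Hn); now apply le_INR).
    destruct (Beta_integral a m ltac:(lra)) as (K & HK & HG).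
    destruct (half_int_Gamma a Ha) as [_ G1].
    destruct (half_int_Gamma (INR m - a) ltac:(lra)) as [_ G2].
    destruct (Balakrishnan_frac_pow V omega T J phi a K
      (Gamma (INR m) / (Gamma a * Gamma (INR m - a))) n m k v
      homega hT hJ hphi Ha Hn Hnm Hk Hv HK) as (S & w & HS & Hw & Hpow).
    + transitivity (Gamma (INR m) * K / (Gamma a * Gamma (INR m - a))); [field; lra|].
      rewrite HG; field; lra.
    + exists w; split; [|exact Hpow].
      eexists; split; [|exact Hw]; intros t Ht; simpl.
      exists (Nat.iter m (G_op t (S t)) v); split; [|easy].
      now apply op_pow_G, HS.
Qed.
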